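(* Let $n$ be even and consider the stable roommates problem on $n$ people in which each person independently ranks the other $n-1$ people according to a uniformly random ordering. Let $X$ be the number of stable matchings. Then for all sufficiently large even $n$, \[ \mathbb{P}(X \geq 1) \leq n^{-1/17}. \]
   Context: A matching is a perfect matching of the $n$ people, and $M(i)$ denotes the partner of $i$ in a matching $M$. A matching $M$ is stable if there is no pair $\{i,j\}$ of people who are not matched to each other in $M$ such that $i$ prefers $j$ to $M(i)$ and $j$ prefers $i$ to $M(j)$. *)

(* Defs.v *)
From mathcomp Require Import all_boot all_order all_algebra.
From mathcomp Require Import reals exp.

Set Implicit Arguments.
Unset Strict Implicit.
Unset Printing Implicit Defensive.

Import Order.TTheory GRing.Theory Num.Theory.

(* The rankings of the other n - 1 people by person i, most preferred first:
   a duplicate-free list of length n - 1 that avoids i contains every other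
   person exactly once. *)
Definition rankings n (i : 'I_n) : {set n.-1.-tuple 'I_n} :=
  [set r : n.-1.-tuple 'I_n | uniq r & i \notin r].

(* A profile whose i-th entry is not in rankings i has probability 0, see
   profile_prob below. *)
Definition profile n := {ffun 'I_n -> n.-1.-tuple 'I_n}.

Definition prefers n (p : profile n) (i j k : 'I_n) : bool :=
  index j (p i) < index k (p i).

(* A matching is given by its partner function i |-> M i. *)
Definition matching n (M : {ffun 'I_n -> 'I_n}) : bool :=
  [forall i, (M i != i) && (M (M i) == i)].

Definition blocking n (p : profile n) (M : {ffun 'I_n -> 'I_n}) (i j : 'I_n)
    : bool :=
  [&& i != j, M i != j, prefers p i j (M i) & prefers p j i (M j)].

Definition stable n (p : profile n) (M : {ffun 'I_n -> 'I_n}) : bool :=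
  ~~ [exists i, exists j, blocking p M i j].

Definition nb_stable_matchings n (p : profile n) : nat :=
  #|[set M : {ffun 'I_n -> 'I_n} | matching M & stable p M]|.

Local Open Scope ring_scope.

Definition uniform_prob (R : realType) (T : finType) (A : {set T}) (x : T)
    : R :=
  (x \in A)%:R / #|A|%:R.

(* Independence of the n rankings: the law of the profile is the product of
   the uniform laws on rankings i. *)
Definition profile_prob (R : realType) n (p : profile n) : R :=
  \prod_(i < n) uniform_prob R (rankings i) (p i).

Definition Prob (R : realType) n (E : pred (profile n)) : R :=
  \sum_(p : profile n | E p) profile_prob R p.

(* Main.v *)
(* Write P(X >= 1) as the sum over matchings M of E[1/X; M stable]. The first
   moment, the sum of the probabilities that M is stable, is O(1), so it is enough
   to show that X is typically large once some M is stable.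

   Fix M and a profile for which M is stable, and call j a suitor of i if j prefers
   i to M(j). Send i to f(i) = M(s(i)), where s(i) is the suitor that i likes most.
   A cycle of f can be rotated (each i on it is matched to s(i)), and short cycles
   are typically far enough from one another for any set of them to be rotated
   simultaneously; hence X >= 2^N, where N is the number of short cycles.

   Exchanging the values of f at u and at w = f^l(u) can be achieved by relabelling
   four rankings and cuts a new cycle of length l out of the orbit of u. Counting
   these involutions gives, for phi(x) = E[x^N], the inequality
   H phi <= phi' + error on [0, 1] with H = 1/2 + ... + 1/L, so that E[2^-N] is at most
   exp(-H/2) up to a constant and errors, about L^(-1/2).

   The errors are controlled on regular profiles, where everybody has many suitors
   and the sets of suitors overlap little: permuting suitors inside one ranking
   shows that s(i) is uniformly distributed over the suitors of i. Irregular
   profiles are rare by weighted first moments: given who prefers whom to his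
   partner, the number of profiles is a product of Beta integrals, and after
   exchanging sums the weights are integrated against a product of factors
   exp(- sqrt n * x_i). *)
Require Import Defs.
From mathcomp Require Import all_boot all_order all_algebra all_fingroup.
From mathcomp Require Import fingraph zify ring lra.
From mathcomp Require Import reals sequences exp.

Set Implicit Arguments.
Unset Strict Implicit.
Unset Printing Implicit Defensive.

Import Order.TTheory GRing.Theory Num.Theory.

(** Probabilities given that [M] is stable are quotients of cardinalities, and the conditional
    estimates are injections between sets of profiles obtained by relabelling a few rankings.
    Irregular profiles are compared not with the number of profiles for which [M] is stable but with
    a common upper bound [kappa], whose sum over all matchings is of the order of the total number
    of profiles. The obstacle is that rotations of different short cycles must not interfere.
    Closing a cycle takes two coincidences among about sqrt n suitors, so a person lies on a cycle
    of a given length with probability about 1/n, and about L people lie on cycles of length at most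
    L. Two of them interfere with probability about n^(-1/2). By Markov's inequality more than q
    people are concerned with probability L/q, and the union bound over pairs costs q^2 n^(-1/2).
    Balancing both with L^(-1/2) gives q = L^(3/2), L near n^(1/7) and a rate near n^(-1/14); the
    exponent 1/17 leaves room for the small powers of n lost in the regularity conditions. *)

Section SeqFacts.
Variable T : eqType.
Implicit Types (P : pred T) (l : seq T).

Lemma head_filter_eq P l x0 t :
  t \in l -> P t -> (forall k, k \in l -> P k -> index t l <= index k l) ->
  head x0 (filter P l) = t.
Proof.
elim: l => //= a l IH; rewrite in_cons => tl Pt mn.
case: ifP => Pa /=.
  by have := mn a (mem_head _ _) Pa; rewrite eqxx; case: eqP.
have ta : a != t by apply/eqP=> E; rewrite E Pt in Pa.
have tl' : t \in l by move: tl; rewrite eq_sym (negPf ta).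
apply: IH => // k kl Pk.
have ka : a != k by apply/eqP=> E; rewrite E Pk in Pa.
by have := mn k; rewrite in_cons kl orbT (negPf ka) [a == t](negPf ta) ltnS; apply.
Qed.

Lemma head_filterP P l x0 k : k \in l -> P k ->
  [/\ head x0 (filter P l) \in l, P (head x0 (filter P l)) &
      index (head x0 (filter P l)) l <= index k l].
Proof.
elim: l => //= a l IH; rewrite in_cons => kl Pk.
case: ifP => Pa /=; first by rewrite mem_head eqxx.
have ka : a != k by apply/eqP=> E; rewrite E Pk in Pa.
have kl' : k \in l by move: kl; rewrite eq_sym (negPf ka).
have [h1 h2 h3] := IH kl' Pk; split=> //; first by rewrite in_cons h1 orbT.
have ha : a != head x0 (filter P l) by apply/eqP=> E; rewrite -E Pa in h2.
by rewrite (negPf ka) (negPf ha).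
Qed.

End SeqFacts.

(** * Profiles for which a fixed matching is stable *)

Section Fixed.
Variables (n : nat) (M : {ffun 'I_n -> 'I_n}).
Hypothesis matM : matching M.
Implicit Types (p : profile n) (i j k r t u w a b : 'I_n).

Lemma matchK i : M (M i) = i.
Proof. by have /forallP/(_ i)/andP[_ /eqP] := matM. Qed.
Lemma match_neq i : M i != i.
Proof. by have /forallP/(_ i)/andP[] := matM. Qed.
Lemma match_inj : injective M.
Proof. exact: can_inj matchK. Qed.
Lemma match_eq i j : (M i == j) = (i == M j).
Proof. by apply/eqP/eqP => [<-|->]; rewrite matchK. Qed.

(* The favourite suitor [best p i] of [i] is the junk value [M i] when [i] has no
   suitor, so that [next_suitor p i = i] in that case. *)
Definition Omega : {set profile n} :=
  [set p : profile n | [forall i, p i \in rankings i] & stable p M].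
Definition acc p j i := prefers p j i (M j).
Definition suitors p i := [set j | acc p j i].
Definition admired p j := [set i | acc p j i].
Definition best p i := head (M i) [seq j <- p i | acc p j i].
Definition next_suitor p i := M (best p i).

Section InOmega.
Variable p : profile n.
Hypothesis pO : p \in Omega.

Lemma rank_uniq i : uniq (p i).
Proof. by move: pO; rewrite inE => /andP[/forallP/(_ i)]; rewrite inE => /andP[]. Qed.
Lemma rank_self i : i \notin p i.
Proof. by move: pO; rewrite inE => /andP[/forallP/(_ i)]; rewrite inE => /andP[]. Qed.
Lemma rank_mem i j : (j \in p i) = (j != i).
Proof.
have sub : {subset p i <= predC1 i}.
  by move=> x xp; rewrite inE; apply: contraTneq xp => ->; exact: rank_self.
have sz : size (enum (predC1 i)) <= size (p i).
  by rewrite size_tuple -cardE cardC1 card_ord.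
have [|_ /(_ j)] := uniq_min_size (rank_uniq i) _ sz.
  by move=> x /sub; rewrite mem_enum.
by rewrite mem_enum inE => ->.
Qed.
(** The index of an absent element is the length of the list: everyone ranks himself below all
    others, so comparisons of indices keep a meaning for him. *)
Lemma index_self i : index i (p i) = n.-1.
Proof. by rewrite memNindex ?rank_self ?size_tuple. Qed.
Lemma index_le i j : index j (p i) <= n.-1.
Proof. by rewrite -[X in _ <= X](size_tuple (p i)) index_size. Qed.
Lemma rank_index_inj i j k : index j (p i) = index k (p i) -> j = k.
Proof.
have [->|ji] := eqVneq j i; have [->|ki] := eqVneq k i => //.
- rewrite index_self => E; have : index k (p i) < n.-1.
    by rewrite -[X in _ < X](size_tuple (p i)) index_mem rank_mem.
  by rewrite -E ltnn.
- rewrite index_self => E; have : index j (p i) < n.-1.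
    by rewrite -[X in _ < X](size_tuple (p i)) index_mem rank_mem.
  by rewrite E ltnn.
by move=> E; apply: (@index_inj _ i (p i) j k _ _ E); rewrite rank_mem.
Qed.

Lemma acc_irr i : acc p i i = false.
Proof. by rewrite /acc /prefers index_self ltnNge index_le. Qed.
Lemma acc_match i : acc p i (M i) = false.
Proof. by rewrite /acc /prefers ltnn. Qed.
Lemma acc_neq i j : acc p i j -> i != j.
Proof. by apply: contraTneq => ->; rewrite acc_irr. Qed.
(** The side conditions of [blocking] are automatic, since [acc] holds neither for oneself nor for
    one's partner. With the converse [in_Omega], stability of [M] is the asymmetry of [acc], the
    form used from here on. *)
Lemma acc_asym i j : acc p i j -> acc p j i = false.
Proof.
move=> ij; have ne := acc_neq ij.
move: pO; rewrite inE => /andP[_ /existsPn/(_ i)/existsPn/(_ j)].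
rewrite /blocking ne -![prefers _ _ _ _]/(acc p _ _) ij /=.
case: eqP => [E|_] /=; last by move/negPf.
by rewrite -E acc_match in ij.
Qed.

Lemma best_eq i t : acc p t i ->
  (forall k, acc p k i -> index t (p i) <= index k (p i)) -> best p i = t.
Proof.
move=> ti mn; apply: head_filter_eq => //; first by rewrite rank_mem (acc_neq ti).
by move=> k _; apply: mn.
Qed.

Lemma bestP i k : acc p k i ->
  acc p (best p i) i /\ index (best p i) (p i) <= index k (p i).
Proof.
by move=> ki; have [|_] := @head_filterP _ (acc p ^~ i) (p i) (M i) k _ ki;
  rewrite ?rank_mem ?(acc_neq ki).
Qed.

Lemma best_acc i : best p i != M i -> acc p (best p i) i.
Proof.
rewrite /best; case E : [seq j <- p i | acc p j i] => [|a l]; first by rewrite eqxx.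
have : a \in [seq j <- p i | acc p j i] by rewrite E mem_head.
by rewrite mem_filter => /andP[].
Qed.

Lemma next_suitor_acc i : next_suitor p i != i -> acc p (best p i) i.
Proof. by rewrite /next_suitor match_eq => /best_acc. Qed.

Lemma index_match_lt i j : acc p j i -> index (M i) (p i) < index j (p i).
Proof.
move=> ji; have /negbT := acc_asym ji; rewrite /acc /prefers -leqNgt leq_eqVlt.
case/orP=> [/eqP/rank_index_inj E|//].
by rewrite -E /acc matchK /prefers ltnn in ji.
Qed.

End InOmega.

Definition relab (s : 'I_n -> {perm 'I_n}) p : profile n :=
  [ffun k => map_tuple (s k) (p k)].

Implicit Types s : 'I_n -> {perm 'I_n}.

Lemma index_relab s p k a : index (s k a) (relab s p k) = index a (p k).
Proof. by rewrite ffunE /= (index_map perm_inj). Qed.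
Lemma index_relabV s p k a :
  index a (relab s p k) = index ((s k)^-1%g a) (p k).
Proof. by rewrite -[in RHS](index_relab s) permKV. Qed.

Lemma relab_rankings s p : (forall k, s k k = k) ->
  [forall i, p i \in rankings i] -> [forall i, relab s p i \in rankings i].
Proof.
move=> sk /forallP pv; apply/forallP => i; have := pv i; rewrite !inE ffunE /=.
rewrite map_inj_uniq; last exact: perm_inj.
by rewrite -(mem_map (@perm_inj _ (s i))) sk.
Qed.

Lemma in_Omega p : [forall i, p i \in rankings i] ->
  (forall i j, acc p i j -> acc p j i = false) -> p \in Omega.
Proof.
move=> pv st; rewrite inE pv; apply/existsPn => i; apply/existsPn => j.
by apply/negP => /and4P[_ _ /st]; rewrite /acc => ->.
Qed.

Lemma relab_comp s1 s2 p : relab s1 (relab s2 p) = relab (fun k => s2 k * s1 k)%g p.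
Proof.
apply/ffunP => k; rewrite !ffunE; apply: val_inj => /=.
by rewrite -map_comp; apply: eq_map => x; rewrite permM.
Qed.

Lemma relab1 s p : (forall k, s k = 1%g) -> relab s p = p.
Proof.
move=> s1; apply/ffunP => k; rewrite !ffunE s1; apply: val_inj => /=.
by rewrite -[RHS]map_id; apply: eq_map => x; rewrite perm1.
Qed.

Definition rowp r (g : {perm 'I_n}) k : {perm 'I_n} := if k == r then g else 1%g.

Section Row.
Variables (p : profile n) (r : 'I_n) (g : {perm 'I_n}).
Hypothesis pO : p \in Omega.
Hypothesis gr : g r = r.
Hypothesis gM : g (M r) = M r.
Hypothesis gacc : forall i, g i != i -> acc p r i = false /\ acc p r (g i) = false.

Let q := relab (rowp r g) p.

(** [g] permutes only people whom [r] ranks below [M r] and leaves [M r] in place, so the set of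
    people before [M r] is unchanged. *)
Lemma row_acc i j : acc q i j = acc p i j.
Proof.
rewrite /acc /prefers /q !index_relabV /rowp; case: eqP => [->|_]; last first.
  by rewrite invg1 !perm1.
have -> : (g^-1)%g (M r) = M r by rewrite -{1}gM permK.
have [E|gj] := eqVneq (g j) j; first by rewrite -{1}E permK.
have [x gx] : exists x, g x = j by exists (g^-1 j)%g; rewrite permKV.
have xj : g x != x by apply: contraNneq gj => E; rewrite -gx !E.
rewrite -{1}gx permK.
have [h1 _] := gacc gj; have [h2 _] := gacc xj.
by move: h1 h2; rewrite /acc /prefers => -> ->.
Qed.

Lemma row_Omega : q \in Omega.
Proof.
apply: in_Omega.
  apply: relab_rankings; last by move: pO; rewrite inE => /andP[].
  by move=> k; rewrite /rowp; case: eqP => [->|]; rewrite ?perm1.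
by move=> i j; rewrite !row_acc; apply: acc_asym.
Qed.

Lemma row_best_other k : k != r -> best q k = best p k.
Proof.
move=> kr; have E : q k = p k.
  apply: val_inj; rewrite ffunE /rowp (negPf kr) /=.
  by rewrite -[RHS]map_id; apply: eq_map => x; rewrite perm1.
by rewrite /best E; congr head; apply: eq_filter => j; rewrite row_acc.
Qed.
End Row.

Lemma acc_matchl p i : acc p (M i) i = false.
Proof. by rewrite /acc matchK /prefers ltnn. Qed.

Lemma acc_neq_match p i j : acc p j i -> j != M i.
Proof. by apply: contraTneq => ->; rewrite acc_matchl. Qed.
End Fixed.

Lemma card_dep_pairs (A B : finType) (E : {set A}) (F : A -> {set B}) :
  #|[set x : A * B | (x.1 \in E) && (x.2 \in F x.1)]| = \sum_(x in E) #|F x|.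
Proof.
rewrite -sum1_card (eq_bigr (fun x => \sum_(y in F x) 1)); last first.
  by move=> x _; rewrite sum1_card.
by rewrite pair_big_dep /=; apply: eq_bigl => -[x y]; rewrite inE.
Qed.

(** * Resampling the favourite suitor inside one ranking *)

Section Resampling.
Variables (n : nat) (M : {ffun 'I_n -> 'I_n}).
Hypothesis matM : matching M.
Implicit Types (p q : profile n) (i j k t u w a b : 'I_n).

Local Notation Omega := (Omega M).
Local Notation acc := (acc M).
Local Notation best := (best M).
Local Notation suitors := (suitors M).

Section Swap.
Variables (p : profile n) (r a b : 'I_n).
Hypothesis pO : p \in Omega.
Hypotheses (ar : acc p a r) (br : acc p b r).
Let q := relab (rowp r (tperm a b)) p.

(** By stability [r] ranks its suitors [a] and [b] below [M r], so their exchange is invisible to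
    [acc] and affects only which suitor [r] likes most. *)
Lemma swap_row : [/\ q \in Omega, forall i j, acc q i j = acc p i j,
  forall k, k != r -> best q k = best p k & best q r = tperm a b (best p r)].
Proof.
have gr : tperm a b r = r by rewrite tpermD // (acc_neq pO).
have gM : tperm a b (M r) = M r by rewrite tpermD // (acc_neq_match matM (p := p)).
have gacc i : tperm a b i != i -> acc p r i = false /\ acc p r (tperm a b i) = false.
  by case: tpermP => [-> _|-> _|_ _]; rewrite ?eqxx //; split; apply: (acc_asym pO).
have qO := row_Omega pO gr gM gacc; have accE := row_acc gM gacc.
split=> // [k kr|]; first exact: row_best_other.
have ga k : acc p k r -> acc p (tperm a b k) r by case: tpermP => [->|->|].
have [bA bmin] := bestP pO ar.
apply: (best_eq qO); first by rewrite accE ga.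
move=> k; rewrite accE => kr; rewrite !index_relabV /rowp eqxx tpermV tpermK.
by have [] := bestP pO (ga _ kr).
Qed.
End Swap.

(* Given everything except the favourite suitor of [r p], each of the suitors of
   [r p] is equally likely to be the favourite one. *)
Lemma resample (Om : {set profile n}) (r : profile n -> 'I_n)
    (T : profile n -> {set 'I_n}) (d D : nat) :
  Om \subset Omega ->
  (forall p q, p \in Om -> q \in Omega -> (forall i j, acc q i j = acc p i j) ->
     (forall k, k != r p -> best q k = best p k) ->
     [/\ q \in Om, r q = r p & T q = T p]) ->
  (forall p, p \in Om -> d <= #|suitors p (r p)|) ->
  (forall p, p \in Om -> #|suitors p (r p) :&: T p| <= D) ->
  #|[set p in Om | best p (r p) \in T p]| * d <= #|Om| * D.
Proof.
move=> sOm inv hd hD; case: d hd => [|d] hd; first by rewrite muln0.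
set E := [set p in Om | _].
pose P := [set x : profile n * 'I_n | (x.1 \in E) && (x.2 \in suitors x.1 (r x.1))].
pose P' := [set x : profile n * 'I_n |
  (x.1 \in Om) && (x.2 \in suitors x.1 (r x.1) :&: T x.1)].
(* Exchange the favourite with the chosen suitor and remember the old favourite. This undoes itself,
   and it maps [P] into [P'] because the remembered favourite lies in [T]. *)
pose phi (x : profile n * 'I_n) :=
  (relab (rowp (r x.1) (tperm (best x.1 (r x.1)) x.2)) x.1, best x.1 (r x.1)).
have ineq1 : #|E| * d.+1 <= #|P|.
  rewrite (card_dep_pairs E (fun p => suitors p (r p))) -sum_nat_const.
  apply: leq_sum => p.
  by rewrite inE => /andP[pOm _]; apply: hd.
have ineq2 : #|P'| <= #|Om| * D.
  rewrite (card_dep_pairs Om (fun p => suitors p (r p) :&: T p)) -sum_nat_const.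
  by apply: leq_sum => p; apply: hD.
apply: leq_trans ineq1 (leq_trans _ ineq2).
have main x : x \in P -> phi x \in P' /\ phi (phi x) = x.
  case: x => p a; rewrite !inE /= => /andP[/andP[pOm bT] ar].
  have pO := subsetP sOm _ pOm; have [br bm] := bestP pO ar.
  have [qO accE bE bqr] := swap_row pO br ar.
  have [qOm rq Tq] := inv _ _ pOm qO accE bE.
  rewrite tpermL in bqr; set q := relab _ p in qO accE bE qOm rq Tq bqr *.
  rewrite qOm rq Tq accE br bT; split=> //.
  rewrite /phi /= -/q rq bqr; congr pair.
  rewrite /q relab_comp relab1 // => k; rewrite /rowp.
  by case: eqP => _; rewrite ?mulg1 // tpermC tperm2.
rewrite -(card_in_imset (f := phi) (D := mem P)); last first.
  by move=> x y /main[_ Ex] /main[_ Ey] E'; rewrite -Ex E' Ey.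
by apply/subset_leq_card/subsetP => _ /imsetP[x /main[? _] ->].
Qed.

(** In [Omega]: [j] stands strictly between [M r] and the favourite suitor in the ranking of [r].
    This position obstructs both the switches ([card_uncuttable]) and the simultaneous rotations
    ([conflict_cases]). *)
Definition ahead p r j := [&& prefers p r j (best p r), ~~ acc p r j & j != M r].

Section ThreeCycle.
Variables (p : profile n) (r j a : 'I_n).
Hypothesis pO : p \in Omega.
Hypothesis ar : acc p a r.
Hypothesis abest : a != best p r.
Hypothesis jr : ahead p r j.
Let t := best p r.
(** The cycle [j -> t -> a -> j]. After relabelling, [t] stands at the old place of [j], [a] at that
    of [t] and [j] at that of [a]: the favourite is still [t], and [a] has become the second
    favourite, from which it can be recovered. *)
Definition rot3 j t a : {perm 'I_n} := (tperm j a * tperm t a)%g.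
Let q := relab (rowp r (rot3 j t a)) p.

Lemma rot3_spec : [/\ q \in Omega, forall i j, acc q i j = acc p i j,
  forall k, best q k = best p k &
  head r [seq k <- q r | acc q k r && (k != best q r)] = a].
Proof.
have [jpref jacc jM] := and3P jr.
have [tr tmin] := bestP pO ar; rewrite -/t in tr tmin jpref.
have jltt : index j (p r) < index t (p r) by [].
have jt : j != t by apply: contraTneq jltt => ->; rewrite ltnn.
have jnS : ~~ acc p j r.
  by apply/negP => /(bestP pO)[_]; rewrite leqNgt jltt.
have ja : j != a by apply: contraTneq ar => <-.
have jnr : j != r.
  apply: contraTneq jltt => ->; rewrite (index_self pO) -leqNgt.
  exact: index_le.
have [tnr anr] := (acc_neq pO tr, acc_neq pO ar).
have ta : t != a by rewrite eq_sym.
have gj : rot3 j t a j = t by rewrite permM tpermL tpermR.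
have gt : rot3 j t a t = a by rewrite permM (@tpermD _ j a t) // tpermL.
have ga : rot3 j t a a = j by rewrite permM tpermR tpermD // eq_sym.
have gD x : x != j -> x != t -> x != a -> rot3 j t a x = x.
  by move=> xj xt xa; rewrite permM (@tpermD _ j a x) ?tpermD // eq_sym.
have gr : rot3 j t a r = r by rewrite gD // eq_sym.
have gM : rot3 j t a (M r) = M r.
  by rewrite gD // eq_sym // (acc_neq_match matM (p := p)).
have nacc x : (x == j) || (x == t) || (x == a) -> acc p r x = false.
  by case/orP=> [/orP[]|] /eqP->; first exact: negPf; apply: (acc_asym pO).
have gacc i : rot3 j t a i != i ->
    acc p r i = false /\ acc p r (rot3 j t a i) = false.
  have [->|ij] := eqVneq i j; first by rewrite gj !nacc ?eqxx ?orbT.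
  have [->|it] := eqVneq i t; first by rewrite gt !nacc ?eqxx ?orbT.
  have [->|ia] := eqVneq i a; first by rewrite ga !nacc ?eqxx ?orbT.
  by rewrite gD // eqxx.
have qO := row_Omega pO gr gM gacc; have accE := row_acc gM gacc.
have idx x : index (rot3 j t a x) (q r) = index x (p r).
  by rewrite -(index_relab (rowp r (rot3 j t a)) p r) /rowp eqxx.
have it : index t (q r) = index j (p r) by rewrite -gj idx.
have ia : index a (q r) = index t (p r) by rewrite -gt idx.
have ik x : acc p x r -> x != t -> x != a -> index x (q r) = index x (p r).
  by move=> xr xt xa; rewrite -{1}(gD x) // ?idx //; apply: contraNneq jnS => <-.
have bqr : best q r = t.
  apply: (best_eq qO); rewrite ?accE // => k; rewrite accE => kr.
  have [->//|kt] := eqVneq k t; rewrite it.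
  have [->|ka] := eqVneq k a; first by rewrite ia ltnW.
  by rewrite ik // (leq_trans (ltnW jltt)) //; have [] := bestP pO kr.
split=> // [k|].
  by have [->|kr] := eqVneq k r; [exact: bqr | exact: row_best_other].
rewrite bqr; apply: head_filter_eq; rewrite ?(rank_mem qO) // ?accE ?ar //.
move=> k _; rewrite accE => /andP[kr kt].
have [->//|ka] := eqVneq k a; rewrite ia ik //.
by have [] := bestP pO kr.
Qed.
End ThreeCycle.

(* Given all the favourite suitors and who prefers whom to his partner, a person
   who is not a suitor of [r p] comes before all the suitors with probability
   at most [1 / (#|suitors| + 1)]. *)
Lemma reshuffle (Om : {set profile n}) (r J : profile n -> 'I_n) (d : nat) :
  Om \subset Omega ->
  (forall p q, p \in Om -> q \in Omega -> (forall i j, acc q i j = acc p i j) ->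
     (forall k, best q k = best p k) -> [/\ q \in Om, r q = r p & J q = J p]) ->
  (forall p, p \in Om -> d < #|suitors p (r p)|) ->
  #|[set p in Om | ahead p (r p) (J p)]| * d <= #|Om|.
Proof.
move=> sOm inv hd; set E := [set p in Om | _].
pose P := [set x : profile n * 'I_n |
  (x.1 \in E) && (x.2 \in suitors x.1 (r x.1) :\ best x.1 (r x.1))].
pose phi (x : profile n * 'I_n) :=
  relab (rowp (r x.1) (rot3 (J x.1) (best x.1 (r x.1)) x.2)) x.1.
(* The suitor used by [phi] is the second favourite of the new profile, so [psi] inverts [phi]; each
   profile of [E] has at least [d] images, one for each suitor other than the favourite. *)
pose snd q := head (r q) [seq k <- q (r q) | acc q k (r q) && (k != best q (r q))].
pose psi q := (relab (rowp (r q) (rot3 (J q) (best q (r q)) (snd q))^-1%g) q, snd q).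
have ineq1 : #|E| * d <= #|P|.
  rewrite (card_dep_pairs E (fun p => suitors p (r p) :\ best p (r p))) -sum_nat_const.
  apply: leq_sum => p.
  rewrite inE => /andP[pOm _]; have := hd p pOm.
  by rewrite (cardsD1 (best p (r p))); case: (_ \in _); rewrite ?add1n ?ltnS // => /ltnW.
apply: leq_trans ineq1 _.
have main x : x \in P -> phi x \in Om /\ psi (phi x) = x.
  case: x => p a; rewrite !inE /= => /andP[/andP[pOm aj] /andP[ab ar]].
  have pO := subsetP sOm _ pOm.
  have [qO accE bE hE] := rot3_spec pO ar ab aj.
  have [qOm rq Jq] := inv _ _ pOm qO accE bE.
  split=> //; rewrite /phi /psi /snd /=; set q := relab _ p in qO accE bE hE qOm rq Jq *.
  rewrite rq Jq hE bE; congr pair; rewrite /q relab_comp relab1 // => k; rewrite /rowp.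
  by case: eqP => _; rewrite ?mulg1 // mulgV.
rewrite -(card_in_imset (f := phi) (D := mem P)); last first.
  by move=> x y /main[_ Ex] /main[_ Ey] E'; rewrite -Ex E' Ey.
by apply/subset_leq_card/subsetP => _ /imsetP[x /main[? _] ->].
Qed.

End Resampling.

(** * Exchanging the favourite suitors of two people *)

Section Switch.
Variables (n : nat) (M : {ffun 'I_n -> 'I_n}).
Hypothesis matM : matching M.
Implicit Types (p q : profile n) (i j k t u w x : 'I_n).

Local Notation Omega := (Omega M).
Local Notation acc := (acc M).
Local Notation best := (best M).

(** The last two conditions say that [u] ranks [best p w] no higher than its own favourite suitor,
    hence below [M u], and symmetrically for [w]. So neither becomes part of a blocking pair, and
    each takes over the other's favourite. The first conditions provide genuine suitors and exclude
    coincidences among the four people and their partners. *)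
Definition switchable p u w :=
  [&& [&& u != w, best p u != M u, best p w != M w & best p u != best p w],
      [&& u != best p w, w != best p u, M u != best p w & M w != best p u],
      ~~ prefers p u (best p w) (best p u) &
      ~~ prefers p w (best p u) (best p w)].

Definition switch_perm p u w k : {perm 'I_n} :=
  if (k == u) || (k == w) then tperm (best p u) (best p w)
  else if (k == best p u) || (k == best p w) then tperm u w else 1%g.

(* [next_suitor] of the switched profile is the old one with the values at [u] and
   [w] exchanged: when [w] is reached from [u] along [next_suitor], the switch cuts
   a new cycle out of this path. *)
Definition switch p u w := relab (switch_perm p u w) p.

Lemma switchableC p u w : switchable p u w = switchable p w u.
Proof.
rewrite /switchable [w == u]eq_sym [best p w == best p u]eq_sym.
by apply/and3P/and3P => -[/and4P[? ? ? ?] /and4P[? ? ? ?] /andP[? ?]];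
  split; first [apply/and4P | apply/andP]; split.
Qed.

Lemma switchC p u w : switch p u w = switch p w u.
Proof.
apply/ffunP => k; rewrite !ffunE /switch_perm orbC (tpermC (best p u)).
by rewrite (orbC (k == best p u)) (tpermC u).
Qed.

Section Spec.
Variables (p : profile n) (u w : 'I_n).
Hypothesis pO : p \in Omega.
Hypothesis sw : switchable p u w.
Local Notation t := (best p u).
Local Notation t' := (best p w).
Local Notation q := (switch p u w).

Let uw : u != w. Proof. by have /and3P[/and4P[]] := sw. Qed.
Let tt' : t != t'. Proof. by have /and3P[/and4P[]] := sw. Qed.
Let ut' : u != t'. Proof. by have /and3P[_ /and4P[]] := sw. Qed.
Let wt : w != t. Proof. by have /and3P[_ /and4P[]] := sw. Qed.
Let Mut' : M u != t'. Proof. by have /and3P[_ /and4P[]] := sw. Qed.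
Let Mwt : M w != t. Proof. by have /and3P[_ /and4P[]] := sw. Qed.
Let tu : acc p t u. Proof. by have /and3P[/and4P[]] := sw => _ /best_acc. Qed.
Let t'w : acc p t' w. Proof. by have /and3P[/and4P[]] := sw => _ _ /best_acc. Qed.
Let ut : u != t. Proof. by rewrite eq_sym (acc_neq pO). Qed.
Let wt' : w != t'. Proof. by rewrite eq_sym (acc_neq pO). Qed.
Let tMu : t != M u. Proof. exact: acc_neq_match tu. Qed.
Let idxu : index t (p u) <= index t' (p u).
Proof. by have /and3P[_ _ /andP[]] := sw; rewrite /prefers -leqNgt. Qed.

Let sK k x : switch_perm p u w k (switch_perm p u w k x) = x.
Proof. by rewrite /switch_perm; case: ifP => _; [|case: ifP => _]; rewrite ?tpermK // !perm1. Qed.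
Let index_q k x : index x (q k) = index (switch_perm p u w k x) (p k).
Proof. by rewrite -[in RHS](index_relab (switch_perm p u w)) sK. Qed.
Let s_u : switch_perm p u w u = tperm t t'.
Proof. by rewrite /switch_perm eqxx. Qed.
Let s_t : switch_perm p u w t = tperm u w.
Proof. by rewrite /switch_perm eqxx [t == u]eq_sym (negPf ut) [t == w]eq_sym (negPf wt). Qed.
Let s_other k : k != u -> k != w -> k != t -> k != t' -> switch_perm p u w k = 1%g.
Proof. by rewrite /switch_perm => /negPf-> /negPf-> /negPf-> /negPf->. Qed.

Let accu_t : acc p u t = false. Proof. exact: acc_asym. Qed.
Let accu_t' : acc p u t' = false.
Proof.
rewrite /acc /prefers; apply/negbTE; rewrite -leqNgt (leq_trans _ idxu) //.
by rewrite ltnW // (index_match_lt matM).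
Qed.

Lemma switch_acc_src i : acc q u i = acc p u i.
Proof.
rewrite {1}/acc /prefers !index_q s_u (tpermD tMu) //; last by rewrite eq_sym.
rewrite -[LHS]/(acc p u (tperm t t' i)).
by case: tpermP => [->|->|] //; rewrite accu_t accu_t'.
Qed.

Lemma switch_acc_tgt i : acc q t i = acc p t (tperm u w i).
Proof.
rewrite {1}/acc /prefers !index_q s_t (@tpermD _ u w (M t)) //.
  by rewrite -match_eq // eq_sym.
by rewrite -match_eq.
Qed.

Lemma switch_acc_other k i : k != u -> k != w -> k != t -> k != t' ->
  acc q k i = acc p k i.
Proof. by move=> *; rewrite {1}/acc /prefers !index_q s_other // !perm1. Qed.

End Spec.

Section Spec2.
Variables (p : profile n) (u w : 'I_n).
Hypothesis pO : p \in Omega.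
Hypothesis sw : switchable p u w.
Local Notation t := (best p u).
Local Notation t' := (best p w).
Local Notation q := (switch p u w).

Let sw' : switchable p w u. Proof. by rewrite switchableC. Qed.
Let accq_u i : acc q u i = acc p u i. Proof. exact: switch_acc_src. Qed.
Let accq_w i : acc q w i = acc p w i.
Proof. by rewrite switchC; exact: switch_acc_src. Qed.
Let accq_t i : acc q t i = acc p t (tperm u w i). Proof. exact: switch_acc_tgt. Qed.
Let accq_t' i : acc q t' i = acc p t' (tperm u w i).
Proof. by rewrite switchC tpermC; exact: switch_acc_tgt. Qed.
Let accD k i : i != u -> i != w -> acc q k i = acc p k i.
Proof.
move=> iu iw; have [->//|ku] := eqVneq k u; have [->//|kw] := eqVneq k w.
have [->|kt] := eqVneq k t; first by rewrite accq_t tpermD // eq_sym.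
have [->|kt'] := eqVneq k t'; first by rewrite accq_t' tpermD // eq_sym.
exact: switch_acc_other.
Qed.

Let q_acc_asym i j : acc q i j -> acc q j i = false.
Proof.
(* Acceptance of people outside [{u, w}] is unchanged, so only pairs meeting [{u, w}] matter.
   Starting from [x] in [{u, w}] who accepts [y], the person [y] is neither [t] nor [t'], as both
   come after [M x] in the ranking of [x]. *)
have half x y : (x == u) || (x == w) -> acc q x y -> acc q y x = false.
  move=> xuw; have -> : acc q x y = acc p x y by case/orP: xuw => /eqP->.
  have [yuw|] := boolP ((y == u) || (y == w)).
    have -> : acc q y x = acc p y x by case/orP: yuw => /eqP->.
    exact: acc_asym.
  case/norP=> yu yw xy.
  have yt : y != t.
    apply: contraTneq xy => ->; case/orP: xuw => /eqP->.
      by rewrite -accq_u; apply/negbT; rewrite accq_u; apply: acc_asym => //;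
         apply: best_acc => //; have /and3P[/and4P[]] := sw.
    apply/negP; rewrite /acc /prefers => lt1.
    have /and3P[_ _ /andP[_]] := sw; rewrite /prefers -leqNgt => le2.
    have /and3P[/and4P[_ _ /best_acc /(index_match_lt matM pO) lt3 _] _ _] := sw.
    by have := leq_trans (leq_trans lt3 le2) (ltnW lt1); rewrite ltnn.
  have yt' : y != t'.
    apply: contraTneq xy => ->; case/orP: xuw => /eqP->; last first.
      by apply/negbT; apply: acc_asym => //;
         apply: best_acc => //; have /and3P[/and4P[]] := sw.
    apply/negP; rewrite /acc /prefers => lt1.
    have /and3P[_ _ /andP[le2 _]] := sw; rewrite /prefers -leqNgt in le2.
    have /and3P[/and4P[_ /best_acc /(index_match_lt matM pO) lt3 _ _] _ _] := sw.
    by have := leq_trans (leq_trans lt3 le2) (ltnW lt1); rewrite ltnn.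
  by rewrite (@switch_acc_other p u w y x) //; apply: acc_asym.
have [iuw|] := boolP ((i == u) || (i == w)); first exact: half.
case/norP=> iu iw; have [juw|] := boolP ((j == u) || (j == w)).
  by move=> ij; apply/negP => /(half _ _ juw); rewrite ij.
case/norP=> ju jw; rewrite accD // accD //; exact: acc_asym.
Qed.

Lemma switch_Omega : q \in Omega.
Proof.
apply: in_Omega => //; apply: relab_rankings; last by move: pO; rewrite inE => /andP[].
have /and3P[/and4P[uw tu t'w _] /and4P[ut' wt _ _] _] := sw.
have ut : u != t by rewrite eq_sym (acc_neq pO) // best_acc.
have wt' : w != t' by rewrite eq_sym (acc_neq pO) // best_acc.
move=> k; rewrite /switch_perm; case: ifP => [/orP[]/eqP->|/norP[ku kw]].
- by rewrite tpermD // eq_sym.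
- by rewrite tpermD // eq_sym.
by case: ifP => _; rewrite ?perm1 // tpermD // eq_sym.
Qed.

(** The row of [x] may contain [u] and [w] in exchanged places, namely if [x] is [t] or [t'].
    Neither of them is then a suitor of [x]: for one this is stability in [p], for the other
    stability in the switched profile. *)
Lemma switch_best_other x : x != u -> x != w -> best q x = best p x.
Proof.
move=> xu xw; rewrite /best /switch {2}/relab ffunE /=.
set g := switch_perm p u w x.
have gP k : acc p k x -> g k = k.
  move=> kx; rewrite /g /switch_perm (negPf xu) (negPf xw) /=.
  case: ifP => [xt|_]; last by rewrite perm1.
  rewrite tpermD //; apply: contraTneq kx => <-; case/orP: xt => /eqP->.
  - by apply/negbT/acc_asym => //; apply: best_acc => //; have /and3P[/and4P[]] := sw.
  - apply/negP => h; have := q_acc_asym (i := u) (j := t').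
    rewrite accq_u accq_t' tpermL => /(_ h)/negP; apply.
    by apply: best_acc => //; have /and3P[/and4P[]] := sw.
  - apply/negP => h; have := q_acc_asym (i := w) (j := t).
    rewrite accq_w accq_t tpermR => /(_ h)/negP; apply.
    by apply: best_acc => //; have /and3P[/and4P[]] := sw.
  by apply/negbT/acc_asym => //; apply: best_acc => //; have /and3P[/and4P[]] := sw.
rewrite filter_map; have -> : map g (filter (preim g (fun j => acc q j x)) (p x)) =
    filter (fun j => acc p j x) (p x); last by [].
rewrite (@eq_filter _ _ (fun j => acc p j x)).
  rewrite -[RHS]map_id; apply/eq_in_map => k; rewrite mem_filter => /andP[kx _].
  exact: gP.
move=> k /=; rewrite accD //; apply/idP/idP => h; last by rewrite gP.
suff -> : k = g k by [].
by apply: (@perm_inj _ g); rewrite [RHS]gP.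
Qed.

Lemma switch_best_src : best q u = t'.
Proof.
have /and3P[/and4P[uw tu t'w tt'] /and4P[ut' wt _ _] /andP[np _]] := sw.
have au := best_acc tu; have aw := best_acc t'w.
have idx k : index k (q u) = index (tperm t t' k) (p u).
  rewrite -[in RHS](index_relab (switch_perm p u w)).
  have -> : switch_perm p u w u = tperm t t' by rewrite /switch_perm eqxx.
  by rewrite tpermK.
apply: (best_eq switch_Omega); first by rewrite accq_t' tpermL.
move=> k ku; rewrite !idx tpermR; case: tpermP => [_|_|kt kt'] //.
  by rewrite leqNgt.
suff ku' : acc p k u by have [] := bestP pO ku'.
move: ku.
have [->|ku] := eqVneq k u; first by rewrite accq_u.
have [->|kw] := eqVneq k w; first by rewrite accq_w.
by rewrite (@switch_acc_other p u w k u) //; apply/eqP.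
Qed.

End Spec2.

Lemma switch_best_tgt p u w : p \in Omega -> switchable p u w ->
  best (switch p u w) w = best p u.
Proof. by move=> pO sw; rewrite switchC switch_best_src // switchableC. Qed.

(** The two favourites have changed owners, so the second switch applies the same transpositions in
    the same four rows. *)
Lemma switchK p u w : p \in Omega -> switchable p u w ->
  switch (switch p u w) u w = p.
Proof.
move=> pO sw; rewrite {1}/switch /switch_perm switch_best_src // switch_best_tgt //.
rewrite /switch relab_comp relab1 // => k; rewrite /switch_perm.
case: ifP => [_|_]; first by rewrite tpermC tperm2.
by rewrite orbC; case: ifP => _; rewrite ?tperm2 ?mulg1.
Qed.

End Switch.

(** * Cutting short cycles *)

Section ShortCycles.
Variables (T : finType) (L : nat).
Implicit Types (f : T -> T) (x y : T).

(** The condition [fcycle] keeps the points on a cycle and drops those that merely lead to one; on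
    such points [component] is the cycle. Fixed points are left out because [next_suitor p i = i]
    encodes the absence of suitors. *)
Definition short f : {set T} :=
  [set x | fcycle f (orbit f x) && (1 < order f x <= L)].
Definition component f x : {set T} := [set y | fconnect f x y].
Definition short_cycles f : {set {set T}} := component f @: short f.

Lemma short_intro f p x : fcycle f p -> uniq p -> x \in p -> 1 < size p <= L ->
  [/\ x \in short f, order f x = size p & component f x = [set y in p]].
Proof.
move=> fp Up xp szp; have oE := order_cycle fp Up xp; split=> //.
  have [i Ei] := orbit_rot_cycle fp Up xp.
  by rewrite inE oE szp andbT Ei rot_cycle.
by apply/setP => y; rewrite !inE (fconnect_cycle fp xp).
Qed.

Lemma short_orbit f x : x \in short f ->
  [/\ fcycle f (orbit f x), uniq (orbit f x), x \in orbit f x &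
      1 < size (orbit f x) <= L].
Proof.
rewrite inE => /andP[fx ox]; by split; rewrite ?size_orbit.
Qed.

Lemma order_ge_traject f x m : uniq (traject f x m) -> m <= order f x.
Proof.
move=> /card_uniqP E; rewrite -(size_traject f x m) -E; apply/subset_leq_card/subsetP.
by move=> y /trajectP[i _ ->]; apply: fconnect_iter.
Qed.

Lemma card_component f x : #|component f x| = order f x.
Proof. by rewrite cardsE. Qed.

Lemma short_component f x y : x \in short f -> y \in component f x ->
  [/\ y \in short f, component f y = component f x & order f y = order f x].
Proof.
move=> /short_orbit[fx Ux xx sx]; rewrite inE fconnect_orbit => yx.
have [h1 h2 h3] := short_intro fx Ux yx sx.
have [_ h5 h6] := short_intro fx Ux xx sx.
by rewrite h1 h3 h6 h2 h5.
Qed.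

(** A cycle of length [l] contributes [l] terms [1 / l]. *)
Lemma sum_inv_order (R : numFieldType) f :
  (\sum_(x in short f) ((order f x)%:R^-1 : R) <= #|short_cycles f|%:R)%R.
Proof.
rewrite (partition_big_imset (component f)) /= -/(short_cycles f) -sum1_card.
rewrite natr_sum; apply: ler_sum => c /imsetP[x xs ->].
rewrite (eq_bigr (fun=> (order f x)%:R^-1)%R); last first.
  move=> y /andP[ys /eqP yx]; rewrite -(card_component f x) -yx card_component //.
rewrite sumr_const -[leLHS]mulr_natl.
have o0 : 0 < order f x by rewrite /order; apply/card_gt0P; exists x; exact: connect0.
rewrite ler_pdivrMr ?ltr0n // mul1r ler_nat.
rewrite -(card_component f x); apply/subset_leq_card/subsetP => y.
by rewrite unfold_in => /andP[_ /eqP <-]; rewrite inE connect0.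
Qed.

Section CutPath.
Variables (f f' : T -> T) (u : T) (l : nat).
Hypothesis l2 : 1 < l.
Hypothesis lL : l <= L.
Hypothesis Uu : uniq (traject f u (l + L).+1).
Let w := iter l f u.
Hypothesis f'u : f' u = f w.
Hypothesis f'w : f' w = f u.
Hypothesis f'D : forall x, x != u -> x != w -> f' x = f x.
Let c := traject f (f u) l.

Let iter_inj i j : i <= l + L -> j <= l + L ->
  iter i f u = iter j f u -> i = j.
Proof.
move=> il jl; have := @nth_uniq _ u (traject f u (l + L).+1) i j.
by rewrite size_traject !ltnS il jl Uu !nth_traject // => /(_ isT isT isT) E /eqP; rewrite E => /eqP.
Qed.

Let c_mem x : x \in c -> exists i, [/\ 0 < i, i <= l & x = iter i f u].
Proof. by move=> /trajectP[i il ->]; exists i.+1; rewrite -iterSr. Qed.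

Let c_iter i : 0 < i <= l -> iter i f u \in c.
Proof.
by case: i => // i /andP[_ il]; apply/trajectP; exists i; rewrite // -iterSr.
Qed.

Let Uc : uniq c.
Proof.
have := Uu; rewrite trajectS /= => /andP[_].
by move/(take_uniq l); rewrite take_traject // leq_addr.
Qed.

Let cyc_c : fcycle f' c.
Proof.
have wE : w = last (f u) (behead c).
  by rewrite /w /c; case: (l) l2 => // m _; rewrite trajectS /= last_traject -iterSr.
have cE : c = f u :: behead c by rewrite /c; case: (l) l2.
rewrite cE /= rcons_path -wE /= f'w eqxx andbT.
have sz : size (behead c) = l.-1 by rewrite size_behead size_traject.
apply/(pathP (f u)) => i; rewrite sz => il.
rewrite -cE nth_behead /c !nth_traject /=; try lia.
rewrite f'D // -?iterSr.
  by apply/eqP => /(@iter_inj i.+1 0); lia.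
by apply/eqP => /(@iter_inj i.+1 l); lia.
Qed.

(** A point on a short cycle has at most [L] distinct iterates, whereas [u] and [w] both start
    trajectories of [L + 1] distinct points; this is why [Uu] reaches [L] steps beyond [w]. *)
Let no_cycle_f x : x \in short f -> (u \notin orbit f x) && (w \notin orbit f x).
Proof.
move=> xs; have [fx Ux xx /andP[_ sx]] := short_orbit xs.
have main y : y \in orbit f x -> ~~ uniq (traject f y L.+1).
  move=> yx; apply/negP => /order_ge_traject.
  by rewrite (order_cycle fx Ux yx); apply/negP; rewrite -ltnNge.
apply/andP; split; apply/negP => /main/negP; apply.
  by have := take_uniq L.+1 Uu; rewrite take_traject //; lia.
have := Uu; rewrite -addnS trajectD cat_uniq => /and3P[_ _].
by [].
Qed.

(** Under [f'] the point [u] is followed by the [L] points that came after [w], which are distinct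
    and different from [u]. *)
Let no_cycle_f' x : x \in short f' -> u \notin orbit f' x.
Proof.
move=> xs; have [fx Ux xx /andP[_ sx]] := short_orbit xs.
apply/negP => ux; have := order_cycle fx Ux ux.
suff: L < order f' u by move=> h E; move: h; rewrite E ltnNge sx.
apply: order_ge_traject; rewrite trajectS f'u -[f w]/(iter l.+1 f u).
set z := iter l.+1 f u; have zE m : iter m f z = iter (m + l.+1) f u by rewrite iterD.
have zE' m : m <= L -> iter m f' z = iter m f z.
  elim: m => // m IH mL; rewrite !iterS IH ?(ltnW mL) // zE f'D //.
    by apply/eqP => /(@iter_inj (m + l.+1) 0); lia.
  by apply/eqP => /(@iter_inj (m + l.+1) l); lia.
have tE m : m <= L -> traject f' z m = traject f z m.
  by elim: m => // m IH mL; rewrite !trajectSr IH ?(ltnW mL) // zE' // ltnW.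
rewrite tE //=; apply/andP; split.
  by apply/trajectP => -[i iL]; rewrite zE => /(@iter_inj 0 (i + l.+1)); lia.
have := Uu; rewrite -addSn trajectD cat_uniq => /and3P[_ _].
by [].
Qed.

Let c_size : 1 < size c <= L. Proof. by rewrite size_traject l2. Qed.

Let wc : w \in c. Proof. by apply: c_iter; lia. Qed.

Lemma short_cut_new i : 0 < i <= l ->
  [/\ iter i f u \in short f', order f' (iter i f u) = l,
      component f' (iter i f u) = [set y in c] & iter i f u \notin short f].
Proof.
move=> il; have [h1 h2 h3] := short_intro cyc_c Uc (c_iter il) c_size.
split=> //; first by rewrite h2 size_traject.
apply/negP => xs; have [fx Ux xx _] := short_orbit xs.
have /andP[_] := no_cycle_f xs; rewrite -fconnect_orbit => /negP; apply.
by rewrite /w (_ : l = (l - i) + i) ?iterD ?fconnect_iter //; lia.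
Qed.

Lemma short_cut_old x : x \in short f ->
  x \in short f' /\ component f' x = component f x.
Proof.
move=> xs; have [fx Ux xx sx] := short_orbit xs.
have /andP[un wn] := no_cycle_f xs.
have f'x : fcycle f' (orbit f x).
  apply: (@sub_in_cycle _ (mem (orbit f x)) (frel f)) fx; last by apply/allP.
  move=> y z yx _ /= /eqP <-; apply/eqP/f'D.
    by apply: contraNneq un => <-.
  by apply: contraNneq wn => <-.
have [h1 _ h2] := short_intro f'x Ux xx sx.
by have [_ _ h3] := short_intro fx Ux xx sx; rewrite h1 h2 h3.
Qed.

Lemma short_cut_inv x : x \in short f' -> x \in short f \/ x \in c.
Proof.
move=> xs; have [fx Ux xx sx] := short_orbit xs.
have un := no_cycle_f' xs.
have [wx|wn] := boolP (w \in orbit f' x).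
  right; rewrite -(fconnect_cycle cyc_c wc) fconnect_orbit.
  have [_ _ h1] := short_intro fx Ux wx sx.
  have : x \in component f' w by rewrite h1 inE.
  by rewrite inE -fconnect_orbit.
left; have f'x : fcycle f (orbit f' x).
  apply: (@sub_in_cycle _ (mem (orbit f' x)) (frel f')) fx; last by apply/allP.
  move=> y z yx _ /= /eqP <-; apply/eqP; rewrite f'D //.
    by apply: contraNneq un => <-.
  by apply: contraNneq wn => <-.
by have [] := short_intro f'x Ux xx sx.
Qed.

(** Old short cycles avoid [u] and [w] and survive. A short cycle of [f'] avoids [u]; if it contains
    [w] it is [c], otherwise it is an old one. *)
Lemma card_short_cycles_cut : #|short_cycles f'| = #|short_cycles f|.+1.
Proof.
have l1 : 0 < l <= l by rewrite (ltnW l2) leqnn.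
have [ws _ wE wns] := short_cut_new l1.
have -> : short_cycles f' = [set y in c] |: short_cycles f.
  apply/setP => C; rewrite in_setU1; apply/imsetP/orP.
    move=> [x xs ->]; have [xf|/c_mem[i [i0 il ->]]] := short_cut_inv xs.
      right; apply/imsetP; exists x => //.
      by have [] := short_cut_old xf.
    by left; have [|_ _ -> _] := @short_cut_new i; rewrite ?i0.
  case=> [/eqP->|/imsetP[x xs ->]]; first by exists w.
  by exists x; have [] := short_cut_old xs.
rewrite cardsU1; suff -> : [set y in c] \notin short_cycles f by [].
apply/negP => /imsetP[x xs E].
have : w \in component f x by rewrite -E inE.
by case/(short_component xs) => wf _ _; rewrite wf in wns.
Qed.

End CutPath.
End ShortCycles.

(** * A differential inequality for generating functions *)

Section Growth.
Variable R : realType.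
Local Open Scope ring_scope.

Lemma expr_ge_tangent (x h : R) (k : nat) : 0 <= x -> 0 <= h ->
  x ^+ k + h * (k%:R * x ^+ k.-1) <= (x + h) ^+ k.
Proof.
move=> x0 h0; elim: k => [|k IH]; first by rewrite !expr0 mul0r mulr0 addr0.
have x0h : 0 <= x + h by rewrite addr_ge0.
rewrite [leRHS]exprS; apply: le_trans (ler_wpM2l x0h IH).
case: k IH => [|k] _; first by rewrite /= expr0 expr1; lra.
rewrite /= !exprS -!natr1; set y := x ^+ k; set c := k%:R.
have y0 : 0 <= y by rewrite exprn_ge0.
have c0 : 0 <= c by rewrite ler0n.
have t0 : 0 <= h * h * ((c + 1) * y) by rewrite !mulr_ge0 // addr_ge0.
nra.
Qed.

Lemma expR_ratio_le (y : R) : 0 <= y -> expR (y / (1 + y)) <= 1 + y.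
Proof.
move=> y0; have y1 : 0 < 1 + y by rewrite ltr_wpDr.
have := expR_ge1Dx (- (y / (1 + y))); rewrite expRN.
have -> : 1 + - (y / (1 + y)) = (1 + y)^-1 by field; rewrite gt_eqF.
by rewrite lef_pV2 ?posrE ?expR_gt0.
Qed.

(* If the generating function [phi x = sum_i x ^+ N i] satisfies
   [H * phi <= phi' + B] on [0, 1] then [(phi - B / H) * exp (- H * x)] is
   nondecreasing; the proof discretizes this. *)
Lemma gen_fun_half (I : finType) (A : {pred I}) (N : I -> nat) (H B : R) :
  0 < H -> 0 <= B ->
  (forall x : R, 0 <= x <= 1 -> H * (\sum_(i in A) x ^+ N i)
     <= \sum_(i in A) (N i)%:R * x ^+ (N i).-1 + B) ->
  \sum_(i in A) 2^-1 ^+ N i <= B / H + expR (4^-1 - H / 2) * #|A|%:R.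
Proof.
move=> H0 B0 hyp; pose phi (x : R) := \sum_(i in A) x ^+ N i.
pose b := B / H; have HbB : H * b = B by rewrite /b; field; rewrite gt_eqF.
(* Euler steps of size [h = 1 / (2 (m + 1))] lead from 1/2 to 1. As [H ^ 2 <= m + 1], the
   discretization costs at most [h * H ^ 2 / 2 <= 1/4] in the exponent, whence the [4^-1] of the
   statement. *)
have [m mH] : exists m : nat, H ^+ 2 <= m.+1%:R.
  exists (Num.truncn (H ^+ 2)); apply/ltW.
  by have /andP[] := Num.Theory.truncn_itv (exprn_ge0 2 (ltW H0)).
have m0 : 0 < m.+1%:R :> R by rewrite ltr0n.
pose h : R := (2 * m.+1%:R)^-1.
have h0 : 0 <= h by rewrite invr_ge0 mulr_ge0 // ltW.
have step x : 0 <= x <= 1 -> (phi x - b) * (1 + h * H) <= phi (x + h) - b.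
  move=> /[dup] /hyp hx /andP[x0 _].
  have t : phi x + h * (\sum_(i in A) (N i)%:R * x ^+ (N i).-1) <= phi (x + h).
    rewrite mulr_sumr -big_split /=; apply: ler_sum => i _.
    exact: expr_ge_tangent.
  have := ler_wpM2l h0 hx; rewrite -/(phi x) -HbB; lra.
have hm : h * m.+1%:R = 2^-1 by rewrite /h invfM -mulrA mulVf ?mulr1 // gt_eqF.
have iter k : (k <= m.+1)%N ->
    (phi 2^-1 - b) * (1 + h * H) ^+ k <= phi (2^-1 + k%:R * h) - b.
  elim: k => [|k IH] km; first by rewrite mul0r addr0 expr0 mulr1.
  have kh : k%:R * h <= 2^-1.
    by rewrite -hm [h * _]mulrC ler_wpM2r // ler_nat ltnW.
  have kh0 : 0 <= k%:R * h by rewrite mulr_ge0.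
  have -> : 2^-1 + k.+1%:R * h = 2^-1 + k%:R * h + h by rewrite -natr1; ring.
  rewrite exprSr mulrA.
  apply: le_trans (step _ _); last by apply/andP; split; lra.
  by rewrite ler_wpM2r ?IH ?(ltnW km) // addr_ge0 ?mulr_ge0 // ltW.
have {iter} := iter m.+1 (leqnn _); rewrite mulrC [_ * h]mulrC hm.
have -> : 2^-1 + 2^-1 = 1 :> R by lra.
have -> : phi 1 = #|A|%:R.
  by rewrite /phi (eq_bigr (fun=> 1)) ?sumr_const // => i _; rewrite expr1n.
have hH0 : 0 <= h * H by rewrite mulr_ge0 // ltW.
have growth : expR (H / 2 - 4^-1) <= (1 + h * H) ^+ m.+1.
  apply: le_trans (lerXn2r _ _ _ (expR_ratio_le hH0)); rewrite ?nnegrE ?expR_ge0 ?addr_ge0 //.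
  rewrite -expRM_natl ler_expR.
  have d0 : 1 + h * H != 0 by rewrite gt_eqF //; lra.
  have -> : m.+1%:R * (h * H / (1 + h * H)) = H / 2 - H / 2 * (h * H / (1 + h * H)).
    have -> : m.+1%:R * (h * H / (1 + h * H)) = h * m.+1%:R * (H / (1 + h * H)).
      by ring.
    by rewrite hm; field.
  have q1 : h * H / (1 + h * H) <= h * H.
    by rewrite ler_pdivrMr; nra.
  have q2 : h * H ^+ 2 <= 2^-1 by rewrite -hm ler_wpM2l.
  have q3 := ler_wpM2l (ltW H0) q1; lra.
move=> fin; have [le0|gt0] := lerP (phi 2^-1 - b) 0.
  have : 0 <= expR (4^-1 - H / 2) * #|A|%:R by rewrite mulr_ge0 ?expR_ge0.
  by rewrite -/b -/(phi _); lra.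
have fin2 : expR (H / 2 - 4^-1) * (phi 2^-1 - b) <= #|A|%:R.
  apply: (le_trans (ler_wpM2r (ltW gt0) growth)); apply: (le_trans fin).
  by rewrite gerBl divr_ge0 // ltW.
have -> : 4^-1 - H / 2 = - (H / 2 - 4^-1) by lra.
have fin3 : phi 2^-1 - b <= #|A|%:R / expR (H / 2 - 4^-1).
  by rewrite ler_pdivlMr ?expR_gt0 // mulrC.
by rewrite expRN -/(phi _) -/b [_^-1 * _]mulrC; lra.
Qed.

Definition harmonic_tail (L : nat) : R := \sum_(2 <= l < L.+1) l%:R^-1.

(** Since [exp (1 / l) >= (l + 1) / l], the product over [l = 2, ..., L] telescopes to
    [(L + 1) / 2]. *)
Lemma harmonic_expR (L : nat) : (0 < L)%N ->
  (L.+1%:R / 2 : R) <= expR (harmonic_tail L).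
Proof.
rewrite /harmonic_tail; case: L => // L _; elim: L => [|L IH].
  by rewrite big_geq // expR0; lra.
rewrite big_nat_recr //= expRD.
have := expR_ge1Dx (L.+2%:R^-1 : R) => h.
have q1 : 0 <= L.+2%:R / 2 :> R by rewrite divr_ge0.
have q2 : 0 <= 1 + L.+2%:R^-1 :> R by rewrite addr_ge0 ?invr_ge0.
apply: (le_trans _ (ler_pM q1 q2 IH h)).
have L0 : L.+2%:R != 0 :> R by rewrite pnatr_eq0.
rewrite -[L.+3%:R]natr1; move: (L.+2%:R : R) L0 => c c0.
by have -> : c / 2 * (1 + c^-1) = (c + 1) / 2 :> R by field.
Qed.
End Growth.

(** * Births of short cycles *)

Section Births.
Variables (R : realType) (n : nat) (M : {ffun 'I_n -> 'I_n}) (L : nat).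
Hypothesis matM : matching M.
Implicit Types (p q : profile n) (i j k u w x : 'I_n) (l : nat).
Local Notation Omega := (Omega M).
Local Notation best := (best M).
Local Notation nxt := (next_suitor M).

Definition nb_cycles p := #|short_cycles L (nxt p)|.

(** One trajectory length serves all [l <= L]; it covers the [l + L + 1] distinct points required
    for a cut. *)
Definition cuttable p u l :=
  uniq (traject (nxt p) u (L + L).+2) && switchable M p u (iter l (nxt p) u).

(** The switched profile together with [u] and [w] determines [p], by switching back, and [l], as
    the length of the new cycle through [w]. *)
Lemma cut_spec p u l : p \in Omega -> 1 < l <= L -> cuttable p u l ->
  let w := iter l (nxt p) u in let q := switch M p u w in
  [/\ q \in Omega, switch M q u w = p, nb_cycles q = (nb_cycles p).+1,
      w \in short L (nxt q) & order (nxt q) w = l].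
Proof.
move=> pO /andP[l1 lL] /andP[Uu sw] /=; set w := iter l _ u in sw *.
set q := switch M p u w.
have Ul : uniq (traject (nxt p) u (l + L).+1).
  by have := take_uniq (l + L).+1 Uu; rewrite take_traject //; lia.
have qu : nxt q u = nxt p w by rewrite /nxt switch_best_src.
have qw : nxt q w = nxt p u by rewrite /nxt switch_best_tgt.
have qD x : x != u -> x != w -> nxt q x = nxt p x.
  by move=> xu xw; rewrite /nxt switch_best_other.
have ll : 0 < l <= l by rewrite (ltnW l1) leqnn.
have [h1 h2 _ _] := short_cut_new l1 lL Ul qw qD ll.
split=> //; first exact: switch_Omega; first exact: switchK.
exact: card_short_cycles_cut l1 lL Ul qu qw qD.
Qed.

Local Open Scope ring_scope.

Definition uncuttable p : R :=
  \sum_(2 <= l < L.+1) #|[set u | ~~ cuttable p u l]|%:R / l%:R.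

(** Give a cut of length [l] the weight [1 / l]. Cuts [(p, u, l)] map injectively to triples
    [(q, u, w)] with [w] on a short cycle of [q] of length [l], and [q] has one short cycle more
    than [p]. For fixed [q] and [u], the weights over all [w] add up to at most the number of short
    cycles. The right-hand side is [n] times the derivative of the generating function. *)
Lemma birth_flow (x : R) : 0 <= x ->
  \sum_(p in Omega) \sum_(2 <= l < L.+1) #|[set u | cuttable p u l]|%:R / l%:R
     * x ^+ nb_cycles p
  <= \sum_(q in Omega) n%:R * ((nb_cycles q)%:R * x ^+ (nb_cycles q).-1).
Proof.
move=> x0.
pose P := [set z : profile n * ('I_n * 'I_L.+1) |
  [&& z.1 \in Omega, (1 < z.2.2)%N & cuttable z.1 z.2.1 z.2.2]].
pose phi (z : profile n * ('I_n * 'I_L.+1)) :=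
  let w := iter z.2.2 (nxt z.1) z.2.1 in (switch M z.1 z.2.1 w, (z.2.1, w)).
pose P' := [set z : profile n * ('I_n * 'I_n) |
  (z.1 \in Omega) && (z.2.2 \in short L (nxt z.1))].
pose G (z : profile n * ('I_n * 'I_n)) : R :=
  (order (nxt z.1) z.2.2)%:R^-1 * x ^+ (nb_cycles z.1).-1.
have phiP z : z \in P -> [/\ phi z \in P',
    G (phi z) = z.2.2%:R^-1 * x ^+ nb_cycles z.1,
    switch M (phi z).1 (phi z).2.1 (phi z).2.2 = z.1 &
    order (nxt (phi z).1) (phi z).2.2 = z.2.2 :> nat].
  case: z => p [u l]; rewrite inE /= => /and3P[pO l1 cut].
  have lL : (1 < l <= L)%N by rewrite l1 -ltnS ltn_ord.
  have [h1 h2 h3 h4 h5] := cut_spec pO lL cut.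
  by rewrite inE /G /= h1 h4 h5 h3 h2.
have inj : {in P &, injective phi}.
  move=> z z' /phiP[_ _ a1 a2] /phiP[_ _ b1 b2] E.
  have E2 : z.2.2 = z'.2.2 by apply: val_inj; rewrite /= -a2 -b2 E.
  have E1 : z.1 = z'.1 by rewrite -a1 -b1 E.
  have E3 : z.2.1 = z'.2.1 by rewrite -[z.2.1]/((phi z).2.1) E.
  by case: z z' E1 E2 E3 {a1 a2 b1 b2 E} => [p [u l]] [p' [u' l']] /= -> -> ->.
have -> : \sum_(p in Omega) \sum_(2 <= l < L.+1) #|[set u | cuttable p u l]|%:R / l%:R
     * x ^+ nb_cycles p = \sum_(z in P) G (phi z).
  rewrite [RHS](eq_bigr (fun z : profile n * ('I_n * 'I_L.+1) =>
    z.2.2%:R^-1 * x ^+ nb_cycles z.1)); last first.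
    by move=> z /phiP[_ ->].
  rewrite [RHS](eq_bigl (fun z : profile n * ('I_n * 'I_L.+1) => (z.1 \in Omega) &&
     [&& (1 < z.2.2)%N & cuttable z.1 z.2.1 z.2.2])); last by move=> z; rewrite inE.
  rewrite -(pair_big_dep (fun p => p \in Omega)
      (fun p (y : 'I_n * 'I_L.+1) => (1 < y.2)%N && cuttable p y.1 y.2)
      (fun p y => y.2%:R^-1 * x ^+ nb_cycles p)) /=.
  apply: eq_bigr => p _.
  rewrite [RHS](eq_bigl (fun y : 'I_n * 'I_L.+1 => (true && ((1 < y.2)%N && cuttable p y.1 y.2)))) //.
  rewrite -(pair_big_dep xpredT (fun u (l : 'I_L.+1) => (1 < l)%N && cuttable p u l)
      (fun u (l : 'I_L.+1) => l%:R^-1 * x ^+ nb_cycles p)) /=.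
  rewrite (exchange_big_dep (fun l : 'I_L.+1 => (1 < l)%N)) /=; last first.
    by move=> u l _ /andP[].
  rewrite big_geq_mkord; apply: eq_bigr => l l1.
  rewrite (eq_bigl (fun u => u \in [set u | cuttable p u l])); last first.
    by move=> u; rewrite inE; move: l1 => /= ->.
  by rewrite sumr_const -[RHS]mulr_natl mulrA.
rewrite -(big_imset G inj) /=.
have G0 z : 0 <= G z by rewrite mulr_ge0 ?invr_ge0 ?exprn_ge0.
have sub : phi @: P \subset P' by apply/subsetP => _ /imsetP[z /phiP[h _ _ _] ->].
apply: (@le_trans _ _ (\sum_(y in P') G y)).
  rewrite [leRHS](big_setID (phi @: P)) /= (setIidPr sub) lerDl.
  by apply: sumr_ge0 => z _; exact: G0.
rewrite (eq_bigl (fun z : profile n * ('I_n * 'I_n) =>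
    (z.1 \in Omega) && (true && (z.2.2 \in short L (nxt z.1)))));
  last by move=> z; rewrite inE.
rewrite -(pair_big_dep (fun q => q \in Omega)
    (fun q (y : 'I_n * 'I_n) => true && (y.2 \in short L (nxt q)))
    (fun q y => (order (nxt q) y.2)%:R^-1 * x ^+ (nb_cycles q).-1)) /=.
apply: ler_sum => q _.
rewrite -(pair_big_dep xpredT (fun (u w : 'I_n) => w \in short L (nxt q))
    (fun u w => (order (nxt q) w)%:R^-1 * x ^+ (nb_cycles q).-1)) /=.
rewrite sumr_const card_ord -[leLHS]mulr_natl ler_wpM2l //.
by rewrite -mulr_suml ler_wpM2r ?exprn_ge0 // sum_inv_order.
Qed.

(** [birth_flow] divided by [n] is the differential inequality of [gen_fun_half]; the missing cuts
    form the error term, bounded by means of [x ^+ N <= 1]. *)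
Lemma cycles_gen_fun_half : (0 < n)%N -> (1 < L)%N ->
  \sum_(p in Omega) 2^-1 ^+ nb_cycles p
  <= (\sum_(p in Omega) uncuttable p) / (n%:R * harmonic_tail R L)
     + expR (4^-1 - harmonic_tail R L / 2) * #|Omega|%:R.
Proof.
move=> n0 L1; set H := harmonic_tail R L.
have H0 : 0 < H.
  rewrite /H /harmonic_tail big_nat_recr //=; apply: ltr_wpDl; last by rewrite invr_gt0 ltr0n; lia.
  by apply: sumr_ge0 => l _; rewrite invr_ge0.
have nR : 0 < n%:R :> R by rewrite ltr0n.
have U0 p : 0 <= uncuttable p by apply: sumr_ge0 => l _; rewrite divr_ge0.
set W := \sum_(p in Omega) uncuttable p.
have W0 : 0 <= W by apply: sumr_ge0.
have -> : W / (n%:R * H) = W / n%:R / H by rewrite invfM mulrA.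
apply: gen_fun_half => // [|x /andP[x0 x1]]; first by rewrite divr_ge0 // ltW.
have flow := birth_flow x0; rewrite -mulr_sumr in flow.
have split p : \sum_(2 <= l < L.+1) #|[set u | cuttable p u l]|%:R / l%:R
    = n%:R * H - uncuttable p.
  rewrite /H /harmonic_tail mulr_sumr -sumrB; apply: eq_bigr => l _; rewrite -mulrBl; congr (_ / _).
  apply/eqP; rewrite eq_sym subr_eq -natrD; apply/eqP; congr (_%:R).
  have := cardsC [set u | cuttable p u l]; rewrite card_ord => /esym E.
  by apply: etrans E _; congr addn; apply: eq_card => u; rewrite !inE.
have low : n%:R * H * (\sum_(p in Omega) x ^+ nb_cycles p) - W
    <= \sum_(p in Omega) \sum_(2 <= l < L.+1)
         #|[set u | cuttable p u l]|%:R / l%:R * x ^+ nb_cycles p.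
  rewrite mulr_sumr -sumrB; apply: ler_sum => p _; rewrite -mulr_suml split mulrBl.
  by rewrite lerD2l lerN2 ler_piMr // exprn_ile1.
have := le_trans low flow; rewrite lerBlDr -mulrA => h.
by rewrite -(ler_pM2l nR) mulrDr [n%:R * (W / _)]mulrC divfK // gt_eqF.
Qed.
End Births.

(** * Rotations of short cycles *)

Section Rotations.
Variables (n : nat) (M : {ffun 'I_n -> 'I_n}) (L : nat).
Hypothesis matM : matching M.
Variable p : profile n.
Hypothesis pO : p \in Omega M.
Implicit Types (i j x y z : 'I_n).
Local Notation acc := (acc M p).
Local Notation best := (best M p).
Local Notation nxt := (next_suitor M p).
Local Notation Q := (short L nxt).

(** The two ways in which simultaneous rotations could fail: both members of a pair of [M] would be
    moved, or two rotated people would prefer each other to their favourite suitors. *)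
Definition conflict_free :=
  [forall i in Q, forall j in Q, (M i != j) &&
     ~~ (prefers p i j (best i) && prefers p j i (best j))].

Hypothesis cf : conflict_free.

Lemma short_match x : x \in Q -> M x \notin Q.
Proof.
move=> xQ; apply/negP => MQ.
have /forall_inP/(_ x xQ)/forall_inP/(_ _ MQ) := cf.
by rewrite eqxx.
Qed.

Lemma short_no_block i j : i \in Q -> j \in Q ->
  prefers p i j (best i) -> prefers p j i (best j) -> False.
Proof.
move=> iQ jQ h1 h2; have /forall_inP/(_ i iQ)/forall_inP/(_ j jQ) := cf.
by rewrite h1 h2 andbF.
Qed.

Definition prev x := iter (order nxt x).-1 nxt x.

Lemma short_prev x : x \in Q -> nxt (prev x) = x.
Proof.
rewrite inE => /andP[/(orbitPcycle 0 4) E _].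
by rewrite /prev -iterS orderSpred.
Qed.

Lemma short_nxt x : nxt x \in component nxt x.
Proof. by rewrite inE fconnect1. Qed.

Lemma short_prev_component x : prev x \in component nxt x.
Proof. by rewrite inE; exact: (fconnect_iter nxt _ x). Qed.

Lemma short_prev_nxt x : x \in Q -> prev (nxt x) = x.
Proof.
move=> xQ; have [_ _ oE] := short_component xQ (short_nxt x).
have := xQ; rewrite inE => /andP[/(orbitPcycle 0 4) E _].
by rewrite /prev oE -iterSr orderSpred.
Qed.

Lemma short_best_neq x : x \in Q -> best x != M x.
Proof.
move=> xQ; apply/eqP => E; have fx : nxt x = x by rewrite /nxt E matchK.
have := xQ; rewrite inE => /andP[_ /andP[o1 _]]; move: o1.
rewrite (@order_cycle _ nxt [:: x] _ _ x) ?inE //=.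
by rewrite fx eqxx.
Qed.

Section OneUnion.
Variable C : {set {set 'I_n}}.
Hypothesis sC : C \subset short_cycles L nxt.
Let U := cover C.

Let U_short x : x \in U -> x \in Q /\ component nxt x \subset U.
Proof.
move=> /bigcupP[c cC xc]; have /imsetP[z zQ Ec] := subsetP sC _ cC.
rewrite Ec in xc; have [xQ E _] := short_component zQ xc; split=> //.
by rewrite E -Ec; apply: bigcup_sup.
Qed.

(** If [y] is in [U], then [M y] is the favourite suitor of [prev y], so the former partner [M y] of
    [y] receives [prev y]. *)
Definition rotated : {ffun 'I_n -> 'I_n} :=
  [ffun x => if x \in U then best x else if M x \in U then prev (M x) else M x].

Let nxtU x : x \in U -> nxt x \in U.
Proof. by move=> /U_short[xQ /subsetP]; apply; apply: short_nxt. Qed.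
Let prevU x : x \in U -> prev x \in U.
Proof. by move=> /U_short[xQ /subsetP]; apply; apply: short_prev_component. Qed.
Let matchU x : x \in U -> M x \notin U.
Proof.
move=> /U_short[xQ _]; apply/negP => /U_short[MQ _].
by have := short_match xQ; rewrite MQ.
Qed.
Let best_match x : M (best x) = nxt x. Proof. by []. Qed.
Let bestE x : best x = M (nxt x). Proof. by rewrite /next_suitor matchK. Qed.

Lemma rotated_matching : matching rotated.
Proof.
apply/forallP => x; rewrite !ffunE; have [xU|xU] := boolP (x \in U).
  have bU : best x \notin U by rewrite bestE matchU ?nxtU.
  rewrite (negPf bU) best_match nxtU // short_prev_nxt ?eqxx ?andbT; last by case: (U_short xU).
  by apply: contraNneq bU => ->.
have [MxU|MxU] := boolP (M x \in U).
  have [MQ _] := U_short MxU.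
  rewrite prevU // bestE short_prev // matchK // eqxx andbT.
  by apply: contraNneq xU => <-; rewrite prevU.
by rewrite (negPf MxU) matchK // (negPf xU) eqxx andbT match_neq.
Qed.

(** People outside [U] are never worse off: they keep their partner or are a suitor of the new one.
    What they want after the rotation they already wanted in [M]. *)
Let rotated_better x y : x \notin U -> prefers p x y (rotated x) -> acc x y.
Proof.
move=> xU; rewrite ffunE (negPf xU); case: ifP => [MxU|//] h.
have [MQ _] := U_short MxU.
have : acc x (prev (M x)).
  rewrite -{1}[x](matchK matM) -{1}(short_prev MQ) -bestE.
  by apply/best_acc/short_best_neq; case: (U_short (prevU MxU)).
by apply: leq_trans; exact: ltnW h.
Qed.

(** Two people outside [U] would block [M], and two inside are excluded by [conflict_free]. In a
    mixed pair the one outside would be a suitor whom the one inside likes better than the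
    favourite. *)
Lemma rotated_stable : stable p rotated.
Proof.
apply/existsPn => i; apply/existsPn => j; apply/negP => /and4P[_ _ hi hj].
have mixed x y : x \in U -> y \notin U -> prefers p x y (rotated x) ->
    prefers p y x (rotated y) -> False.
  move=> xU yU h1 /(rotated_better yU) h2; move: h1; rewrite ffunE xU /prefers.
  by have [_] := bestP pO h2; rewrite leqNgt => /negP.
have [iU|iU] := boolP (i \in U); have [jU|jU] := boolP (j \in U).
- move: hi hj; rewrite !ffunE iU jU; apply: short_no_block.
    by case: (U_short iU).
  by case: (U_short jU).
- exact: mixed hi hj.
- exact: mixed hj hi.
by have := acc_asym pO (rotated_better iU hi); rewrite (rotated_better jU hj).
Qed.

(** The set of rotated cycles can be read off the new matching, so distinct sets give distinct
    matchings. Restricting to [Q] removes the abandoned partners, who lie outside [Q] by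
    [short_match]. *)
Lemma rotated_support : C = [set c in short_cycles L nxt |
  c \subset [set x in Q | rotated x != M x]].
Proof.
have -> : [set x in Q | rotated x != M x] = U.
  apply/setP => x; rewrite inE ffunE; have [xU|xU] := boolP (x \in U).
    by have [xQ _] := U_short xU; rewrite xQ short_best_neq.
  have [xQ|//] := boolP (x \in Q); rewrite ifN ?eqxx //.
  by apply/negP => /U_short[MQ _]; have := short_match xQ; rewrite MQ.
apply/setP => c; rewrite inE; apply/idP/andP => [cC|[/imsetP[x xQ ->] /subsetP cU]].
  by rewrite (subsetP sC) //; split=> //; apply: bigcup_sup.
have /bigcupP[c' c'C xc'] : x \in U by apply: cU; rewrite inE connect0.
have /imsetP[z zQ Ec] := subsetP sC _ c'C; rewrite Ec in xc'.
by have [_ -> _] := short_component zQ xc'; rewrite -Ec.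
Qed.
End OneUnion.

Lemma stable_ge_cycles : 2 ^ nb_cycles M L p <= nb_stable_matchings p.
Proof.
rewrite /nb_stable_matchings -card_powerset -(@card_in_imset _ _ rotated); last first.
  move=> C1 C2; rewrite !inE => s1 s2 E.
  by rewrite (rotated_support s1) (rotated_support s2) E.
apply/subset_leq_card/subsetP => M' /imsetP[C sC ->]; rewrite powersetE in sC.
by rewrite inE rotated_matching // rotated_stable.
Qed.
End Rotations.

Lemma eq_iter_traject (T : eqType) (f : T -> T) x m i j : uniq (traject f x m) ->
  i < m -> j < m -> (iter i f x == iter j f x) = (i == j).
Proof.
move=> U im jm; have := @nth_uniq _ x (traject f x m) i j.
by rewrite size_traject !nth_traject // im jm U => /(_ isT isT isT).
Qed.

(** * Conditional estimates on regular profiles *)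

Section Regular.
Variables (n : nat) (M : {ffun 'I_n -> 'I_n}) (L d D : nat).
Hypothesis matM : matching M.
Implicit Types (p q : profile n) (i j k u w x y r : 'I_n) (l m : nat).
Local Notation Omega := (Omega M).
Local Notation acc := (acc M).
Local Notation best := (best M).
Local Notation nxt := (next_suitor M).
Local Notation suitors := (suitors M).
Local Notation admired := (admired M).
Local Notation path p u m := (traject (nxt p) u m).

(** The overlaps are the target sets met in the applications of [path_step]: a resampled favourite
    falls into one of them with probability at most [D / d]. All conditions depend on [acc] alone,
    so they survive resampling and reshuffling. *)
Definition regular p :=
  [forall i, forall j,
   [&& d < #|suitors p i|,
       (i != j) ==> (#|suitors p i :&: admired p j| <= D),
       (i != j) ==> (#|suitors p i :&: M @: suitors p j| <= D) &
       #|suitors p i :&: M @: admired p j| <= D]].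

Definition Reg : {set profile n} := [set p in Omega | regular p].

Definition same_acc p q := forall i j, acc q i j = acc p i j.

Lemma same_acc_suitors p q : same_acc p q -> suitors q =1 suitors p.
Proof. by move=> E i; apply/setP => j; rewrite !inE E. Qed.
Lemma same_acc_admired p q : same_acc p q -> admired q =1 admired p.
Proof. by move=> E i; apply/setP => j; rewrite !inE E. Qed.

Lemma Reg_Omega p : p \in Reg -> p \in Omega.
Proof. by rewrite inE => /andP[]. Qed.

Lemma Reg_inv p q : p \in Reg -> q \in Omega -> same_acc p q -> q \in Reg.
Proof.
rewrite !inE => /andP[_ rp] -> E /=.
apply/forallP => i; apply/forallP => j; have /forallP/(_ i)/forallP/(_ j) := rp.
by rewrite !(same_acc_suitors E) !(same_acc_admired E).
Qed.

Lemma Reg_suitors p i : p \in Reg -> d < #|suitors p i|.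
Proof. by rewrite inE => /andP[_ /forallP/(_ i)/forallP/(_ i)/and4P[]]. Qed.
Lemma Reg_co1 p i j : p \in Reg -> i != j -> #|suitors p i :&: admired p j| <= D.
Proof. by rewrite inE => /andP[_ /forallP/(_ i)/forallP/(_ j)/and4P[_ /implyP]]. Qed.
Lemma Reg_co2 p i j : p \in Reg -> i != j ->
  #|suitors p i :&: M @: suitors p j| <= D.
Proof. by rewrite inE => /andP[_ /forallP/(_ i)/forallP/(_ j)/and4P[_ _ /implyP]]. Qed.
Lemma Reg_co3 p i j : p \in Reg -> #|suitors p i :&: M @: admired p j| <= D.
Proof. by rewrite inE => /andP[_ /forallP/(_ i)/forallP/(_ j)/and4P[]]. Qed.

(** The favourite of the [m]-th point is consulted only in the step after it, since the earlier
    points are different from it. *)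
Lemma path_same p q u m : uniq (path p u m.+1) ->
  (forall k, k != iter m (nxt p) u -> best q k = best p k) ->
  forall l, l <= m -> iter l (nxt q) u = iter l (nxt p) u.
Proof.
move=> Up bE; elim=> // l IH lm; rewrite !iterS IH ?(ltnW lm) // /next_suitor bE //.
by rewrite (eq_iter_traject Up) ?ltn_eqF // ltnS ltnW.
Qed.

Lemma path_same_traject p q u m :
  (forall l, l <= m -> iter l (nxt q) u = iter l (nxt p) u) ->
  path q u m.+1 = path p u m.+1.
Proof.
move=> E; apply: (@eq_from_nth _ u); rewrite !size_traject // => l lm.
by rewrite !nth_traject // E.
Qed.

(** The path from [u] is explored one step at a time: given its first [m] steps, the favourite of
    the point reached is uniform over its suitors. *)
Lemma path_step (Om : {set profile n}) (T : profile n -> {set 'I_n}) u m D' :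
  Om \subset Reg -> (forall p, p \in Om -> uniq (path p u m.+1)) ->
  (forall p q, p \in Om -> q \in Reg -> same_acc p q ->
     (forall k, k != iter m (nxt p) u -> best q k = best p k) ->
     (forall l, l <= m -> iter l (nxt q) u = iter l (nxt p) u) ->
     q \in Om /\ T q = T p) ->
  (forall p, p \in Om -> #|suitors p (iter m (nxt p) u) :&: T p| <= D') ->
  #|[set p in Om | best p (iter m (nxt p) u) \in T p]| * d <= #|Om| * D'.
Proof.
move=> sR Up inv hD; apply: (resample matM (r := fun p => iter m (nxt p) u)) => //.
- by apply: subset_trans sR _; apply/subsetP => p /Reg_Omega.
- move=> p q pOm qO accE bE; have pR := subsetP sR _ pOm.
  have qR := Reg_inv pR qO accE.
  have pE := path_same (Up _ pOm) bE.
  by have [qOm Tq] := inv _ _ pOm qR accE bE pE; split=> //; apply: pE.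
by move=> p pOm; apply/ltnW/Reg_suitors/(subsetP sR).
Qed.

(** Each new step returns to a point already visited with probability at most the number of these
    points divided by [d]; [m ^ 2] bounds the sum. *)
Lemma path_repeat u m :
  #|[set p in Reg | ~~ uniq (path p u m.+1)]| * d <= #|Reg| * m ^ 2.
Proof.
elim: m => [|m IH].
  rewrite (_ : [set p in _ | _] = set0) ?cards0 //.
  by apply/setP => p; rewrite !inE andbF.
pose Om := [set p in Reg | uniq (path p u m.+1)].
have : #|[set p in Om | best p (iter m (nxt p) u) \in M @: [set x in path p u m.+1]]| * d
    <= #|Om| * m.+1.
  apply: (path_step (T := fun p => M @: [set x in path p u m.+1])).
  - by apply/subsetP => p /setIdP[].
  - by move=> p /setIdP[].
  - move=> p q /setIdP[_ Up] qR accE bE /path_same_traject E.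
    by rewrite E; split=> //; apply/setIdP; rewrite E.
  - move=> p _; apply: leq_trans (subset_leq_card (subsetIr _ _)) _.
    apply: leq_trans (leq_imset_card _ _) _; rewrite cardsE.
    by apply: leq_trans (card_size _) _; rewrite size_traject.
have : #|Om| <= #|Reg| by apply/subset_leq_card/subsetP => p /setIdP[].
set E := [set p in Om | _] => le1 le2.
have sub : [set p in Reg | ~~ uniq (path p u m.+2)] \subset
    [set p in Reg | ~~ uniq (path p u m.+1)] :|: E.
  apply/subsetP => p /setIdP[pR Np]; apply/setUP.
  have [Up|Up] := boolP (uniq (path p u m.+1)); last by left; apply/setIdP.
  right; apply/setIdP; split; first exact/setIdP.
  move: Np; rewrite trajectSr rcons_uniq Up andbT negbK => h.
  by apply/imsetP; exists (iter m.+1 (nxt p) u); rewrite ?inE // iterS /next_suitor matchK.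
have := leq_trans (subset_leq_card sub) (leq_card_setU _ _).
nia.
Qed.

Lemma card_sub_le (A B : {set profile n}) c b : A \subset B -> #|B| * c <= b -> #|A| * c <= b.
Proof. by move=> /subset_leq_card AB; apply: leq_trans; rewrite leq_mul2r AB orbT. Qed.

Lemma Reg_leq (P : pred (profile n)) : #|[set p in Reg | P p]| <= #|Reg|.
Proof. by apply/subset_leq_card/subsetP => p /setIdP[]. Qed.

Lemma path_hit u m (k : nat) : k <= m ->
  #|[set p in Reg | uniq (path p u m.+1) &&
      (best p (iter m (nxt p) u) == iter k (nxt p) u)]| * d <= #|Reg|.
Proof.
move=> km; pose Om := [set p in Reg | uniq (path p u m.+1)].
apply: leq_trans (Reg_leq (fun p => uniq (path p u m.+1))); rewrite -/Om -[leqRHS]muln1.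
apply: card_sub_le (path_step (Om := Om) (T := fun p => [set iter k (nxt p) u])
  (m := m) (u := u) _ _ _ _).
- by apply/subsetP => p /setIdP[pR /andP[Up h]]; apply/setIdP; split; [exact/setIdP | rewrite inE].
- by apply/subsetP => p /setIdP[].
- by move=> p /setIdP[].
- move=> p q /setIdP[pR Up] qR _ _ E; split; last by rewrite E.
  by apply/setIdP; rewrite (path_same_traject E).
- by move=> p _; rewrite -(cards1 (iter k (nxt p) u)) subset_leq_card ?subsetIr.
Qed.

Lemma path_admired u m : 0 < m ->
  #|[set p in Reg | uniq (path p u m.+1) &&
      acc p u (best p (iter m (nxt p) u))]| * d <= #|Reg| * D.
Proof.
move=> m0; pose Om := [set p in Reg | uniq (path p u m.+1)].
apply: leq_trans (leq_mul (Reg_leq (fun p => uniq (path p u m.+1))) (leqnn D)); rewrite -/Om.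
apply: card_sub_le (path_step (Om := Om) (T := fun p => admired p u) (m := m) (u := u) _ _ _ _).
- by apply/subsetP => p /setIdP[pR /andP[Up h]]; apply/setIdP; split; [exact/setIdP | rewrite inE].
- by apply/subsetP => p /setIdP[].
- by move=> p /setIdP[].
- move=> p q /setIdP[pR Up] qR accE _ E; rewrite (same_acc_admired accE); split=> //.
  by apply/setIdP; rewrite (path_same_traject E).
- move=> p /setIdP[pR Up]; apply: Reg_co1 => //.
  by rewrite (eq_iter_traject (j := 0) Up) // -lt0n.
Qed.

Lemma path_suitors u m : 0 < m ->
  #|[set p in Reg | [&& uniq (path p u m.+1), iter m (nxt p) u != best p u &
      acc p (nxt p (iter m (nxt p) u)) (best p u)]]| * d <= #|Reg| * D.
Proof.
move=> m0; pose P p := uniq (path p u m.+1) && (iter m (nxt p) u != best p u).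
pose Om := [set p in Reg | P p].
(* As [0 < m], [best p u] is already determined by the first step of the path, so it may be used in
   the target set. *)
have bE p q : (forall l, l <= m -> iter l (nxt q) u = iter l (nxt p) u) -> best q u = best p u.
  by move=> /(_ 1 m0); apply: match_inj.
apply: leq_trans (leq_mul (Reg_leq P) (leqnn D)); rewrite -/Om.
apply: card_sub_le (path_step (Om := Om) (T := fun p => M @: suitors p (best p u))
  (m := m) (u := u) _ _ _ _).
- apply/subsetP => p /setIdP[pR /and3P[Up h1 h2]]; apply/setIdP; split.
    by apply/setIdP; rewrite /P Up h1.
  by apply/imsetP; exists (nxt p (iter m (nxt p) u)); rewrite ?inE // /next_suitor matchK.
- by apply/subsetP => p /setIdP[].
- by move=> p /setIdP[_ /andP[]].
- move=> p q /setIdP[pR UP] qR accE _ E; rewrite (bE _ _ E) (same_acc_suitors accE); split=> //.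
  by apply/setIdP; rewrite /P (path_same_traject E) E // (bE _ _ E).
- by move=> p /setIdP[pR /andP[Up h1]]; apply: Reg_co2.
Qed.

Lemma best_ahead (r J : profile n -> 'I_n) :
  (forall p q, (forall k, best q k = best p k) -> r q = r p /\ J q = J p) ->
  #|[set p in Reg | ahead M p (r p) (J p)]| * d <= #|Reg|.
Proof.
move=> E; apply: (reshuffle matM).
- by apply/subsetP => p /Reg_Omega.
- by move=> p q pR qO accE bE; have [] := E p q bE; split=> //; apply: Reg_inv pR qO accE.
- by move=> p; apply: Reg_suitors.
Qed.

Lemma iter_same p q u l : (forall k, best q k = best p k) ->
  iter l (nxt q) u = iter l (nxt p) u.
Proof. by move=> E; apply: eq_iter => x; rewrite /next_suitor E. Qed.

(** A repetition on the path costs [(2 L + 1) ^ 2 / d]. The other obstructions are three hits of a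
    prescribed person and two people standing [ahead], each [1 / d], and two falls into an overlap,
    each [D / d]. *)
Lemma card_uncuttable u l : 1 < l <= L ->
  #|[set p in Reg | ~~ cuttable M L p u l]| * d
    <= #|Reg| * ((L + L).+1 ^ 2 + 2 * D + 5).
Proof.
move=> /andP[l1 lL].
have l0 : 0 < l by apply: ltnW.
have [lK lK2] : l.-1.+1 = l /\ l.-2.+1 = l.-1 by case: l l1 {lL l0} => [|[|]].
have [a1 a2 a3] : [/\ l.+1 <= (L + L).+2, l <= (L + L).+2 & l.-1 <= (L + L).+2] by split; lia.
have [c2 c3] : l < (L + L).+2 /\ l.+1 < (L + L).+2 by lia.
have e1 : (l == 0) = false by lia.
have e2 : (l.+1 == l) = false by lia.
have e3 : (1 == l.+1) = false by lia.
have e4 : (l == 1) = false by lia.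
have l12 : (l != 2) <= l.-2 by case: l l1 {lL l0 lK lK2 a1 a2 a3 c2 c3 e1 e2 e3 e4} => [|[|[|]]].
pose B1 := [set p in Reg | ~~ uniq (path p u (L + L).+2)].
pose B2 (m k : nat) := [set p in Reg | uniq (path p u m.+1) &&
  (best p (iter m (nxt p) u) == iter k (nxt p) u)].
pose B3 := [set p in Reg | uniq (path p u l.+1) && acc p u (best p (iter l (nxt p) u))].
pose B4 := [set p in Reg | [&& uniq (path p u l), iter l.-1 (nxt p) u != best p u &
      acc p (nxt p (iter l.-1 (nxt p) u)) (best p u)]].
pose B5 := [set p in Reg | ahead M p u (best p (iter l (nxt p) u))].
pose B6 := [set p in Reg | ahead M p (iter l (nxt p) u) (best p u)].
(* If [u] likes [best p w] better than [best p u], then either better than [M u] ([B3]) or in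
   between ([B5]); likewise for [w] with [B4] and [B6]. The sets [B2] collect coincidences. The
   third one prepares [B4]; for [l = 2] that coincidence is impossible, and the boolean [l != 2],
   read as 0 or 1, keeps the index in range. *)
have sub : [set p in Reg | ~~ cuttable M L p u l] \subset
    B1 :|: (B2 l 0 :|: (B2 l.-1 1 :|: (B2 l.-2 (l != 2) :|: (B3 :|: (B4 :|: (B5 :|: B6)))))).
  apply/subsetP => p /setIdP[pR ncut]; apply: contraR ncut.
  rewrite !in_setU !negb_or => /and5P[n1 n2 n3 n4 /and4P[n5 n6 n7 n8]].
  have nset (P : pred (profile n)) : p \notin [set p in Reg | P p] -> ~~ P p.
    by apply: contra => h; apply/setIdP.
  have Ul : uniq (path p u (L + L).+2) by move/nset: n1; rewrite negbK.
  have Um m : m <= (L + L).+2 -> uniq (path p u m).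
    by move=> mL; have := take_uniq m Ul; rewrite take_traject.
  have it (i j : nat) : i < (L + L).+2 -> j < (L + L).+2 ->
      (iter i (nxt p) u == iter j (nxt p) u) = (i == j).
    by move=> *; apply: eq_iter_traject Ul _ _.
  have bE (k : nat) : best p (iter k (nxt p) u) = M (iter k.+1 (nxt p) u).
    by rewrite iterS /next_suitor matchK.
  have b0 : best p u = M (nxt p u) by rewrite (bE 0).
  move/nset: n2; rewrite Um //= bE => n2.
  move/nset: n3; rewrite lK Um //= bE lK => n3.
  have n4' : iter l.-1 (nxt p) u != best p u.
    have [l2|l2] := eqVneq l 2.
      by rewrite l2 /= b0 eq_sym match_neq.
    by move/nset: n4; rewrite l2 lK2 Um //= bE lK2 b0 match_eq.
  move/nset: n5; rewrite Um //= => n5.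
  move/nset: n6; rewrite n4' Um //= => n6.
  rewrite -iterS lK in n6.
  move/nset: n7 => n7; move/nset: n8 => n8.
  rewrite /cuttable Ul /=.
  set w := iter l (nxt p) u in n5 n6 n7 n8 *.
  have uw : u != w by rewrite eq_sym (it l 0) // e1.
  have ub : best p u != M u.
    by rewrite b0 (inj_eq (match_inj matM)) (it 1 0).
  have wb : best p w != M w.
    by rewrite bE (inj_eq (match_inj matM)) it // e2.
  have bb : best p u != best p w.
    by rewrite b0 bE (inj_eq (match_inj matM)) (it 1 l.+1) // e3.
  have u2 : u != best p w by rewrite bE eq_sym.
  have w2 : w != best p u by rewrite b0 -match_eq.
  have u3 : M u != best p w.
    by rewrite bE (inj_eq (match_inj matM)) (it 0 l.+1).
  have w3 : M w != best p u.
    by rewrite b0 (inj_eq (match_inj matM)) (it l 1) // e4.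
  rewrite /switchable uw ub wb bb u2 w2 u3 w3 /=; apply/andP; split.
    by apply: contra n7 => h; rewrite /ahead h n5 eq_sym.
  by apply: contra n8 => h; rewrite /ahead h n6 eq_sym.
have h1 : #|B1| * d <= #|Reg| * (L + L).+1 ^ 2 by apply: path_repeat.
have h2 (m k : nat) : k <= m -> #|B2 m k| * d <= #|Reg| by apply: path_hit.
have h3 : #|B3| * d <= #|Reg| * D by apply: path_admired.
have h4 : #|B4| * d <= #|Reg| * D.
  by have := @path_suitors u l.-1; rewrite lK; apply; rewrite -ltnS lK.
have h5 : #|B5| * d <= #|Reg|.
  by apply: (best_ahead (r := fun=> u)) => p q E; rewrite E (iter_same _ _ E).
have h6 : #|B6| * d <= #|Reg|.
  by apply: best_ahead => p q E; rewrite E (iter_same _ _ E).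
have h7 : #|B2 l.-2 (l != 2)| * d <= #|Reg|.
  by apply: h2.
have hl : #|B2 l 0| * d <= #|Reg| by apply: h2.
have hl1 : #|B2 l.-1 1| * d <= #|Reg| by apply: h2; rewrite -ltnS lK.
apply: card_sub_le sub _.
have un (A B : {set profile n}) (x y : nat) : #|A| * d <= x -> #|B| * d <= y -> #|A :|: B| * d <= x + y.
  by move=> hA hB; apply: leq_trans (leq_mul (leq_card_setU A B) (leqnn d)) _; lia.
have := un _ _ _ _ h1 (un _ _ _ _ hl (un _ _ _ _ hl1 (un _ _ _ _ h7 (un _ _ _ _ h3
  (un _ _ _ _ h4 (un _ _ _ _ h5 h6)))))).
by move/leq_trans; apply; lia.
Qed.
End Regular.

Section DoubleCounting.
Variables (T1 T2 : finType) (A : {set T1}) (B : T1 -> pred T2).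

Lemma card_exchange :
  \sum_(p in A) #|[set i | B p i]| = \sum_i #|[set p in A | B p i]|.
Proof.
rewrite (eq_bigr (fun p => \sum_(i | B p i) 1)); last first.
  by move=> p _; rewrite sum1_card; apply: eq_card => i; rewrite inE.
rewrite (exchange_big_dep predT) //=; apply: eq_bigr => i _.
by rewrite sum1_card; apply: eq_card => p; rewrite [RHS]inE.
Qed.

Lemma card_exists_le :
  #|[set p in A | [exists i, B p i]]| <= \sum_i #|[set p in A | B p i]|.
Proof.
rewrite -card_exchange -sum1_card [leqRHS](bigID (fun p => [exists i, B p i])) /=.
rewrite (eq_bigl (fun p => (p \in A) && [exists i, B p i])); last first.
  by move=> p; rewrite inE.
apply: leq_trans (leq_addr _ _); apply: leq_sum => p /andP[_ /existsP[i iB]].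
by apply/card_gt0P; exists i; rewrite inE.
Qed.
End DoubleCounting.

(** * People on short cycles and their conflicts *)

Section CycleCounts.
Variables (n : nat) (M : {ffun 'I_n -> 'I_n}) (L d D : nat).
Hypothesis matM : matching M.
Implicit Types (p q : profile n) (i u w x y r : 'I_n) (j k l m : nat).
Local Notation Omega := (Omega M).
Local Notation acc := (acc M).
Local Notation best := (best M).
Local Notation nxt := (next_suitor M).
Local Notation suitors := (suitors M).
Local Notation admired := (admired M).
Local Notation path p u m := (traject (nxt p) u m).
Local Notation Reg := (Reg M d D).
Local Notation Q p := (short L (nxt p)).

Definition closes p i l := uniq (path p i l) && (iter l (nxt p) i == i).

Lemma short_closes p i : i \in Q p ->
  closes p i (order (nxt p) i) /\ 1 < order (nxt p) i <= L.
Proof.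
move=> iQ; have [_ U _ _] := short_orbit iQ; move: iQ; rewrite inE => /andP[].
by move=> /(orbitPcycle 0 4) E ->; rewrite /closes E U eqxx.
Qed.

Definition closed_under (Y : {set profile n}) i m :=
  forall p q, p \in Y -> uniq (path p i m.+1) -> q \in Reg -> same_acc M p q ->
  (forall x, x != iter m (nxt p) i -> best q x = best p x) ->
  (forall j, j <= m -> iter j (nxt q) i = iter j (nxt p) i) -> q \in Y.

(** Closing the path at [i] takes two coincidences. The last step must hit [i], with probability at
    most [1 / d]. Then [M i] is a suitor of the last point, so the step before had to land among the
    people admired by [M i], with probability at most [D / d]. The sets [Y1] and [Y2] carry side
    conditions that survive the resamplings. *)
Lemma card_closes (Y1 Y2 : {set profile n}) i l : 1 < l ->
  Y1 \subset Y2 -> Y2 \subset Reg ->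
  closed_under Y1 i l.-1 -> closed_under Y2 i l.-2 ->
  #|[set p in Y1 | closes p i l]| * d ^ 2 <= #|Y2| * D.
Proof.
case: l => [|[|l]] //= _ s12 s2 cl1 cl2; have s1 := subset_trans s12 s2.
pose P1 p := uniq (path p i l.+2) && acc p (M i) (iter l.+1 (nxt p) i).
pose Om1 := [set p in Y1 | P1 p].
pose Om2 := [set p in Y2 | uniq (path p i l.+1)].
have step1 : #|[set p in Y1 | closes p i l.+2]| * d <= #|Om1|.
  rewrite -[leqRHS]muln1.
  apply: card_sub_le (path_step matM (Om := Om1) (T := fun=> [set M i]) (m := l.+1) (u := i) _ _ _ _).
  - apply/subsetP => p /setIdP[pY /andP[Up /eqP E]].
    have b : best p (iter l.+1 (nxt p) i) = M i.
      by rewrite -[in RHS]E iterS /next_suitor matchK.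
    have ne : iter l.+1 (nxt p) i != i.
      by rewrite (eq_iter_traject (j := 0) Up).
    apply/setIdP; split; last by rewrite b inE.
    apply/setIdP; split=> //; rewrite /P1 Up -b next_suitor_acc //.
    by rewrite -iterS E eq_sym.
  - by apply/subsetP => p /setIdP[pY _]; apply: (subsetP s1).
  - by move=> p /setIdP[_ /andP[]].
  - move=> p q /setIdP[pY /andP[Up ac]] qR accE bE pE; split=> //.
    apply/setIdP; split; first exact: cl1 pY Up qR accE bE pE.
    by rewrite /P1 (path_same_traject pE) Up accE pE.
  - by move=> p _; rewrite -(cards1 (M i)) subset_leq_card ?subsetIr.
have step2 : #|Om1| * d <= #|Om2| * D.
  apply: card_sub_le (path_step matM (Om := Om2)
    (T := fun p => M @: admired p (M i)) (m := l) (u := i) _ _ _ _).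
  - apply/subsetP => p /setIdP[pY /andP[Up ac]]; apply/setIdP; split.
      apply/setIdP; split; first exact: (subsetP s12).
      by have := take_uniq l.+1 Up; rewrite take_traject.
    by apply/imsetP; exists (iter l.+1 (nxt p) i); rewrite ?inE // iterS /next_suitor matchK.
  - by apply/subsetP => p /setIdP[pY _]; apply: (subsetP s2).
  - by move=> p /setIdP[].
  - move=> p q /setIdP[pY Up] qR accE bE pE; rewrite (same_acc_admired accE); split=> //.
    apply/setIdP; split; first exact: cl2 pY Up qR accE bE pE.
    by rewrite (path_same_traject pE).
  - by move=> p /setIdP[pY _]; apply: Reg_co3 (subsetP s2 _ pY).
have step3 : #|Om2| <= #|Y2| by apply/subset_leq_card/subsetP => p /setIdP[].
rewrite -mulnn mulnA; apply: leq_trans (leq_mul step1 (leqnn d)) _.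
by apply: leq_trans step2 _; apply: leq_mul.
Qed.

Lemma card_closes_Reg i l : 1 < l ->
  #|[set p in Reg | closes p i l]| * d ^ 2 <= #|Reg| * D.
Proof. by move=> l1; apply: card_closes => // p q. Qed.

Lemma sum_card_short :
  (\sum_(p in Reg) #|Q p|) * d ^ 2 <= #|Reg| * (n * L.+1 * D).
Proof.
have le1 p : #|Q p| <= #|[set z : 'I_n * 'I_L.+1 | (1 < z.2) && closes p z.1 z.2]|.
  have inord_ok i : i \in Q p -> order (nxt p) i < L.+1.
    by case/short_closes => _ /andP[].
  rewrite -(card_in_imset (f := fun i => (i, inord (order (nxt p) i) : 'I_L.+1))).
    apply/subset_leq_card/subsetP => z /imsetP[i iQ ->]; rewrite inE /= inordK ?inord_ok //.
    by have [-> /andP[->]] := short_closes iQ.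
  by move=> i j _ _ [].
apply: (@leq_trans ((\sum_(p in Reg)
    #|[set z : 'I_n * 'I_L.+1 | (1 < z.2) && closes p z.1 z.2]|) * d ^ 2)).
  by rewrite leq_mul2r leq_sum ?orbT // => p _; apply: le1.
rewrite card_exchange big_distrl /=.
have -> : #|Reg| * (n * L.+1 * D) = \sum_(z : 'I_n * 'I_L.+1) #|Reg| * D.
  by rewrite sum_nat_const card_prod !card_ord; lia.
apply: leq_sum => -[i l] _ /=.
case: (ltnP 1 l) => l1; last first.
  by rewrite (_ : [set p in _ | _] = set0) ?cards0 //; apply/setP => p; rewrite !inE andbF.
exact: card_closes_Reg.
Qed.

Lemma path_same_avoid p q x r m : r \notin path p x m ->
  (forall y, y != r -> best q y = best p y) ->
  path q x m = path p x m /\ iter m (nxt q) x = iter m (nxt p) x.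
Proof.
move=> rp bE; elim: m rp => // m IH; rewrite !trajectSr mem_rcons in_cons negb_or.
move=> /andP[rm /IH[-> E]]; rewrite E; split=> //; rewrite !iterS E /next_suitor bE //.
by rewrite eq_sym.
Qed.

(** If [M i] lies on the cycle of [i], reaching it is one more prescribed hit and costs another
    factor [1 / d]. *)
Lemma card_closes_same i l k : 0 < k -> k < l.-1 ->
  #|[set p in Reg | closes p i l && (iter k (nxt p) i == M i)]| * d ^ 3 <= #|Reg| * D.
Proof.
move=> k0 kl; have l1 : 1 < l by lia.
pose Y := [set p in Reg | uniq (path p i k.+1) && (iter k (nxt p) i == M i)].
have clY m : k <= m -> closed_under Y i m.
  move=> km p q /setIdP[pR /andP[Up E]] _ qR _ _ pE; apply/setIdP; split=> //.
  by rewrite pE // E (path_same_traject (p := p)) ?Up // => j jk; apply: pE; lia.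
have step1 : #|[set p in Y | closes p i l]| * d ^ 2 <= #|Y| * D.
  apply: card_closes => //; first by apply/subsetP => p /setIdP[].
    by apply: clY; lia.
  by apply: clY; lia.
have step2 : #|Y| * d <= #|Reg|.
  apply: card_sub_le (@path_hit _ _ d D matM i k.-1 0 (leq0n _)).
  apply/subsetP => p /setIdP[pR /andP[Up E]]; apply/setIdP; split=> //.
  rewrite prednK //; apply/andP; split.
    by have := take_uniq k Up; rewrite take_traject.
  by move: E; rewrite -{1}(prednK k0) iterS /next_suitor (inj_eq (match_inj matM)).
have sub : [set p in Reg | closes p i l && (iter k (nxt p) i == M i)]
    \subset [set p in Y | closes p i l].
  apply/subsetP => p /setIdP[pR /andP[/andP[Up E] Ek]].
  apply/setIdP; rewrite /closes Up E; split=> //; apply/setIdP; rewrite Ek andbT; split=> //.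
  by have := take_uniq k.+1 Up; rewrite take_traject //; lia.
rewrite (expnSr d 2) mulnA.
apply: leq_trans (leq_mul (leq_mul (subset_leq_card sub) (leqnn _)) (leqnn d)) _.
by apply: leq_trans (leq_mul step1 (leqnn d)) _; rewrite mulnAC leq_mul2r step2 orbT.
Qed.

(** The last two points on the path of [i] avoid the cycle of [M i], so resampling there leaves that
    cycle intact and the two closing probabilities multiply. *)
Lemma card_closes_diff i l m : 1 < l -> 1 < m ->
  #|[set p in Reg | [&& closes p i l, closes p (M i) m,
      iter l.-1 (nxt p) i \notin path p (M i) m &
      iter l.-2 (nxt p) i \notin path p (M i) m]]| * d ^ 4 <= #|Reg| * D ^ 2.
Proof.
move=> l1 m1.
pose P p := closes p (M i) m && (iter l.-2 (nxt p) i \notin path p (M i) m).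
pose Y2 := [set p in Reg | P p].
pose Y1 := [set p in Y2 | iter l.-1 (nxt p) i \notin path p (M i) m].
have step1 : #|[set p in Y1 | closes p i l]| * d ^ 2 <= #|Y2| * D.
  apply: card_closes => //.
  - by apply/subsetP => p /setIdP[].
  - by apply/subsetP => p /setIdP[].
  - move=> p q /setIdP[/setIdP[pR /andP[/andP[U E] n2]] n1] Up qR _ bE pE.
    have [E1 E2] := path_same_avoid n1 bE.
    apply/setIdP; rewrite pE // E1; split=> //; apply/setIdP; split=> //.
    by rewrite /P /closes E1 E2 U E pE // leq_pred.
  - move=> p q /setIdP[pR /andP[/andP[U E] n2]] Up qR _ bE pE.
    have [E1 E2] := path_same_avoid n2 bE.
    by apply/setIdP; split=> //; rewrite /P /closes E1 E2 U E pE.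
have step2 : #|Y2| * d ^ 2 <= #|Reg| * D.
  apply: card_sub_le (card_closes_Reg (M i) m1).
  by apply/subsetP => p /setIdP[pR /andP[c _]]; apply/setIdP.
have sub : [set p in Reg | [&& closes p i l, closes p (M i) m,
      iter l.-1 (nxt p) i \notin path p (M i) m &
      iter l.-2 (nxt p) i \notin path p (M i) m]] \subset [set p in Y1 | closes p i l].
  apply/subsetP => p /setIdP[pR /and4P[c1 c2 n1 n2]]; apply/setIdP; split=> //.
  by apply/setIdP; split=> //; apply/setIdP; rewrite /P c2.
rewrite (expnD d 2 2) mulnA.
apply: leq_trans (leq_mul (leq_mul (subset_leq_card sub) (leqnn _)) (leqnn _)) _.
apply: leq_trans (leq_mul step1 (leqnn _)) _; rewrite mulnAC -(mulnn D) (mulnA #|Reg|).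
by rewrite leq_mul2r step2 orbT.
Qed.

Lemma card_short_match :
  #|[set p in Reg | [exists i, (i \in Q p) && (M i \in Q p)]]| * d ^ 4
    <= #|Reg| * (n * L.+1 ^ 2 * (D * d + D ^ 2)).
Proof.
pose B1 p (z : 'I_n * ('I_L.+1 * 'I_L.+1)) := [&& 0 < z.2.2, z.2.2 < z.2.1.-1,
  closes p z.1 z.2.1 & iter z.2.2 (nxt p) z.1 == M z.1].
pose B2 p (z : 'I_n * ('I_L.+1 * 'I_L.+1)) := [&& 1 < z.2.1, 1 < z.2.2,
  closes p z.1 z.2.1, closes p (M z.1) z.2.2,
      iter z.2.1.-1 (nxt p) z.1 \notin path p (M z.1) z.2.2 &
      iter z.2.1.-2 (nxt p) z.1 \notin path p (M z.1) z.2.2].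
pose B p z := B1 p z || B2 p z.
have sub : [set p in Reg | [exists i, (i \in Q p) && (M i \in Q p)]] \subset
    [set p in Reg | [exists z, B p z]].
  apply/subsetP => p /setIdP[pR /existsP[i /andP[iQ MQ]]]; apply/setIdP; split=> //.
  have [c1 /andP[o1 o2]] := short_closes iQ; have [c2 /andP[o3 o4]] := short_closes MQ.
  set l := order _ i in c1 o1 o2; set m := order _ (M i) in c2 o3 o4.
  apply/existsP; have [Mi|nMi] := boolP (M i \in path p i l).
    have /trajectP[k kl E] := Mi.
    exists (i, (inord l, inord k)); apply/orP; left.
    rewrite /B1 /= !inordK ?ltnS ?(leq_trans (ltnW kl)) // c1 -E eqxx /=.
    have k0 : 0 < k.
      by rewrite lt0n; apply: contraTneq (match_neq matM i) => k0; rewrite E k0 negbK.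
    rewrite k0 andbT ltn_neqAle -ltnS prednK ?(ltnW o1) // kl !andbT.
    (* For [k = l - 1] the step from [M i] leads to [i], so [M i] would be its own favourite
       suitor. *)
    apply/eqP => kE; have /andP[U /eqP cE] := c1.
    have nM : nxt p (M i) = i by rewrite E -iterS kE (prednK (ltnW o1)).
    have := next_suitor_acc matM (p := p) (i := M i).
    rewrite nM eq_sym match_neq // => /(_ isT).
    have -> : best p (M i) = M i by rewrite -[in RHS]nM /next_suitor matchK.
    by rewrite (acc_irr (Reg_Omega pR)).
  exists (i, (inord l, inord m)); apply/orP; right.
  rewrite /B2 /= !inordK ?ltnS // c1 c2 o1 o3 /=.
  have avoid k : iter k (nxt p) i \notin path p (M i) m.
    apply: contra nMi; rewrite -[path p (M i) m]/(orbit _ _) -fconnect_orbit => h1.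
    have h2 : iter k (nxt p) i \in component (nxt p) i by rewrite inE fconnect_iter.
    have h3 : iter k (nxt p) i \in component (nxt p) (M i) by rewrite inE.
    have [_ E2 _] := short_component iQ h2; have [_ E3 _] := short_component MQ h3.
    have : M i \in component (nxt p) i by rewrite -E2 E3 inE connect0.
    by rewrite inE fconnect_orbit.
  by rewrite !avoid.
apply: card_sub_le sub _; apply: leq_trans (leq_mul (card_exists_le _ _) (leqnn _)) _.
rewrite big_distrl /=.
have -> : #|Reg| * (n * L.+1 ^ 2 * (D * d + D ^ 2)) =
    \sum_(z : 'I_n * ('I_L.+1 * 'I_L.+1)) #|Reg| * (D * d + D ^ 2).
  by rewrite sum_nat_const !card_prod !card_ord; lia.
apply: leq_sum => -[i [l m]] _.
have b1 : #|[set p in Reg | B1 p (i, (l, m))]| * d ^ 4 <= #|Reg| * D * d.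
  have [/andP[m0 ml]|nml] := boolP ((0 < m) && (m < l.-1)).
    rewrite expnSr mulnA leq_mul2r; apply/orP; right.
    apply: card_sub_le (card_closes_same i m0 ml).
    by apply/subsetP => p /setIdP[pR /and4P[_ _ h1 h2]]; apply/setIdP; rewrite h1 h2.
  rewrite (_ : [set p in _ | _] = set0) ?cards0 //; apply/setP => p; rewrite in_set0.
  by apply/setIdP => -[_ /and4P[h1 h2 _ _]]; move: nml; rewrite h1 h2.
have b2 : #|[set p in Reg | B2 p (i, (l, m))]| * d ^ 4 <= #|Reg| * D ^ 2.
  have [/andP[l1 m1]|nml] := boolP ((1 < l) && (1 < m)).
    apply: card_sub_le (card_closes_diff i l1 m1).
    by apply/subsetP => p /setIdP[pR /and3P[_ _ h]]; apply/setIdP.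
  rewrite (_ : [set p in _ | _] = set0) ?cards0 //; apply/setP => p; rewrite in_set0.
  by apply/setIdP => -[_ /and3P[h1 h2 _]]; move: nml; rewrite h1 h2.
have b3 : #|[set p in Reg | B p (i, (l, m))]| <=
    #|[set p in Reg | B1 p (i, (l, m))]| + #|[set p in Reg | B2 p (i, (l, m))]|.
  apply: leq_trans (leq_card_setU _ _); apply/subset_leq_card/subsetP => p.
  by move=> /setIdP[pR /orP[h|h]]; apply/setUP; [left|right]; apply/setIdP.
apply: leq_trans (leq_mul b3 (leqnn _)) _.
by rewrite mulnDl mulnDr leq_add // mulnA.
Qed.

(** Markov's inequality. *)
Lemma card_short_gt (q : nat) : #|[set p in Reg | q < #|Q p|]| * q <= \sum_(p in Reg) #|Q p|.
Proof.
rewrite -sum_nat_const [leqRHS](bigID (fun p => q < #|Q p|)) /=.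
rewrite [leqLHS](eq_bigl (fun p => (p \in Reg) && (q < #|Q p|))); last first.
  by move=> p; apply/setIdP/andP.
by apply: leq_trans (leq_addr _ _); apply: leq_sum => p /andP[_ /ltnW].
Qed.

(** The set of people on short cycles depends on the favourites only, hence is fixed under
    reshuffling; a union bound over its at most [q ^ 2] pairs applies. *)
Lemma card_short_ahead (q : nat) :
  #|[set p in Reg | (#|Q p| <= q) && [exists z : 'I_n * 'I_n,
      [&& z.1 \in Q p, z.2 \in Q p & ahead M p z.1 z.2]]]| * d <= #|Reg| * q ^ 2.
Proof.
pose A := [set p in Reg | #|Q p| <= q].
pose B p (z : 'I_n * 'I_n) := (z.1 \in Q p) && (z.2 \in Q p).
have sub : [set p in Reg | (#|Q p| <= q) && [exists z : 'I_n * 'I_n,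
      [&& z.1 \in Q p, z.2 \in Q p & ahead M p z.1 z.2]]] \subset
    [set p in A | [exists z, B p z && ahead M p z.1 z.2]].
  apply/subsetP => p /setIdP[pR /andP[sQ /existsP[z /and3P[h1 h2 h3]]]].
  apply/setIdP; split; first exact/setIdP.
  by apply/existsP; exists z; rewrite /B h1 h2 h3.
apply: card_sub_le sub _; apply: leq_trans (leq_mul (card_exists_le _ _) (leqnn _)) _.
rewrite big_distrl /=; apply: (@leq_trans (\sum_z #|[set p in A | B p z]|)).
  apply: leq_sum => z _.
  apply: card_sub_le (reshuffle matM (Om := [set p in A | B p z])
     (r := fun=> z.1) (J := fun=> z.2) _ _ _).
  - by apply/subsetP => p /setIdP[pA /andP[h1 h2]]; apply/setIdP; split=> //; apply/setIdP.
  - by apply/subsetP => p /setIdP[/setIdP[/Reg_Omega]].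
  - move=> p p' /setIdP[/setIdP[pR sQ] Bp] p'O accE bE; split=> //.
    have QE : Q p' = Q p.
      have E : nxt p' =1 nxt p by move=> x; rewrite /next_suitor bE.
      have oE x : order (nxt p') x = order (nxt p) x by apply: eq_card => y; apply: (eq_fconnect E).
      have tE m x : traject (nxt p') x m = traject (nxt p) x m.
        by elim: m x => // m IH x; rewrite !trajectS IH E.
      apply/setP => x; rewrite !inE oE /orbit oE tE.
      by congr andb; apply: eq_cycle => a b /=; rewrite E.
    apply/setIdP; rewrite /B QE; split=> //; apply/setIdP; rewrite QE; split=> //.
    exact: Reg_inv pR p'O accE.
  - by move=> p /setIdP[/setIdP[pR _] _]; exact: (Reg_suitors _ pR).
rewrite -card_exchange; apply: leq_trans (leq_mul (Reg_leq _ _ _ (fun p => #|Q p| <= q)) (leqnn _)).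
rewrite -/A -sum_nat_const.
  apply: leq_sum => p /setIdP[_ sQ].
have -> : [set z | B p z] = setX (Q p) (Q p) by apply/setP => -[x y]; rewrite !inE.
by rewrite cardsX -mulnn leq_mul.
Qed.

(** If two people prefer each other to their favourite suitors, stability lets at most one of them
    prefer the other to the partner; for the remaining one, the other stands [ahead]. *)
Lemma conflict_cases (q : nat) p : p \in Reg -> ~~ conflict_free M L p ->
  [|| [exists i, (i \in Q p) && (M i \in Q p)], q < #|Q p| |
      (#|Q p| <= q) && [exists z : 'I_n * 'I_n,
      [&& z.1 \in Q p, z.2 \in Q p & ahead M p z.1 z.2]]].
Proof.
move=> pR; have [sQ|sQ] := leqP #|Q p| q; last by rewrite orbT.
rewrite /=.
case/forall_inPn => i iQ /forall_inPn[j jQ]; rewrite negb_and !negbK => h.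
have [ij|ij] := eqVneq (M i) j.
  by apply/orP; left; apply/existsP; exists i; rewrite iQ ij.
move: h; rewrite (negPf ij) /= => /andP[h1 h2]; apply/orP; right; apply/existsP.
have [ac|nac] := boolP (acc p i j); last first.
  by exists (i, j); rewrite /= iQ jQ /ahead h1 nac eq_sym.
exists (j, i); rewrite /= iQ jQ /ahead h2 (acc_asym (Reg_Omega pR)) //=.
by rewrite -match_eq // eq_sym -match_eq // eq_sym.
Qed.
End CycleCounts.

(** * The sum of 1 / X over the profiles with M stable *)

Section InverseCount.
Variables (R : realType) (n : nat) (M : {ffun 'I_n -> 'I_n}) (L d D q : nat).
Hypothesis matM : matching M.
Hypotheses (n0 : 0 < n) (L1 : 1 < L) (d0 : 0 < d) (q0 : 0 < q).
Implicit Types (p : profile n) (u : 'I_n) (l : nat).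
Local Notation Omega := (Omega M).
Local Notation Reg := (Reg M d D).
Local Notation Q p := (short L (next_suitor M p)).
Local Notation H := (harmonic_tail R L).

Local Open Scope ring_scope.

Let Reg_sub : Reg \subset Omega. Proof. by apply/subsetP => p /Reg_Omega. Qed.
Let dR : 0 < d%:R :> R. Proof. by rewrite ltr0n. Qed.
Let qR : 0 < q%:R :> R. Proof. by rewrite ltr0n. Qed.
Let nR : 0 < n%:R :> R. Proof. by rewrite ltr0n. Qed.

Lemma harmonic_tail_gt0 : 0 < H.
Proof.
rewrite /harmonic_tail big_nat_recr //=; apply: ltr_wpDl; last by rewrite invr_gt0 ltr0n ltnW.
by apply: sumr_ge0 => l _; rewrite invr_ge0.
Qed.

Lemma sum_uncuttable :
  (\sum_(p in Omega) uncuttable R M L p) / (n%:R * H)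
  <= #|Omega :\: Reg|%:R + #|Reg|%:R * (((L + L).+1 ^ 2 + 2 * D + 5)%:R / d%:R).
Proof.
have H0 := harmonic_tail_gt0; have nH : 0 < n%:R * H by rewrite mulr_gt0.
rewrite ler_pdivrMr // (big_setID Reg) /= (setIidPr Reg_sub) addrC mulrDl; apply: lerD.
  rewrite -sumr_const mulr_suml; apply: ler_sum => p _; rewrite mul1r.
  rewrite /uncuttable /harmonic_tail mulr_sumr; apply: ler_sum => l _.
  by rewrite ler_wpM2r ?invr_ge0 // ler_nat -[leqRHS](card_ord n) max_card.
have -> : \sum_(p in Reg) uncuttable R M L p =
    \sum_(2 <= l < L.+1) (\sum_u #|[set p in Reg | ~~ cuttable M L p u l]|%:R) / l%:R.
  rewrite exchange_big /=; apply: eq_bigr => l _; rewrite -mulr_suml; congr (_ / _).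
  rewrite -!natr_sum; congr _%:R.
  exact: (card_exchange Reg (fun p u => ~~ cuttable M L p u l)).
rewrite mulrCA mulrA [_ * H]mulrC /harmonic_tail mulr_suml; apply: ler_sum_nat => l l1.
rewrite [leRHS]mulrC; apply: ler_wpM2r; rewrite ?invr_ge0 //.
have -> : n%:R * (#|Reg|%:R * (((L + L).+1 ^ 2 + 2 * D + 5)%:R / d%:R)) =
    \sum_(u < n) (#|Reg|%:R * (((L + L).+1 ^ 2 + 2 * D + 5)%:R / d%:R)) :> R.
  by rewrite sumr_const card_ord mulr_natl.
apply: ler_sum => u _; rewrite mulrA ler_pdivlMr // -!natrM ler_nat.
exact: card_uncuttable.
Qed.

Lemma card_conflicts :
  #|[set p in Reg | ~~ conflict_free M L p]|%:R <= #|Reg|%:R *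
    ((n * L.+1 ^ 2 * (D * d + D ^ 2))%:R / (d ^ 4)%:R
     + (n * L.+1 * D)%:R / (d ^ 2 * q)%:R + (q ^ 2)%:R / d%:R) :> R.
Proof.
pose B1 := [set p in Reg | [exists i, (i \in Q p) && (M i \in Q p)]].
pose B2 := [set p in Reg | (q < #|Q p|)%N].
pose B3 := [set p in Reg | (#|Q p| <= q)%N && [exists z : 'I_n * 'I_n,
      [&& z.1 \in Q p, z.2 \in Q p & ahead M p z.1 z.2]]].
have sub : [set p in Reg | ~~ conflict_free M L p] \subset B1 :|: (B2 :|: B3).
  apply/subsetP => p /setIdP[pR /(conflict_cases matM q pR) /or3P[] h]; apply/setUP.
  - by left; apply/setIdP.
  - by right; apply/setUP; left; apply/setIdP.
  by right; apply/setUP; right; apply/setIdP.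
have b1 : #|B1|%:R <= #|Reg|%:R * ((n * L.+1 ^ 2 * (D * d + D ^ 2))%:R / (d ^ 4)%:R) :> R.
  rewrite mulrA ler_pdivlMr ?ltr0n ?expn_gt0 ?d0 // -!natrM ler_nat.
  exact: card_short_match.
have b2 : #|B2|%:R <= #|Reg|%:R * ((n * L.+1 * D)%:R / (d ^ 2 * q)%:R) :> R.
  rewrite mulrA ler_pdivlMr ?ltr0n ?muln_gt0 ?expn_gt0 ?d0 // -!natrM ler_nat.
  apply: leq_trans (sum_card_short L d D matM).
  by rewrite mulnCA mulnC leq_mul2r card_short_gt orbT.
have b3 : #|B3|%:R <= #|Reg|%:R * ((q ^ 2)%:R / d%:R) :> R.
  rewrite mulrA ler_pdivlMr // -!natrM ler_nat; exact: card_short_ahead.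
have le1 : (#|[set p in Reg | ~~ conflict_free M L p]| <= #|B1| + (#|B2| + #|B3|))%N.
  apply: leq_trans (subset_leq_card sub) _; apply: leq_trans (leq_card_setU _ _) _.
  by rewrite leq_add2l leq_card_setU.
rewrite -(ler_nat R) !natrD in le1; apply: le_trans le1 _.
by rewrite !mulrDr -addrA; do 2?apply: lerD.
Qed.

(** In this order: failing cuts, partners both on short cycles, more than [q] people on short
    cycles, people on short cycles standing [ahead] of one another's suitors. *)
Definition regular_error : R :=
  ((L + L).+1 ^ 2 + 2 * D + 5)%:R / d%:R
  + (n * L.+1 ^ 2 * (D * d + D ^ 2))%:R / (d ^ 4)%:R
  + (n * L.+1 * D)%:R / (d ^ 2 * q)%:R + (q ^ 2)%:R / d%:R.

(** The summand is at most 1 as [M] itself is stable, and at most [2 ^ -N] for regular conflict-free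
    profiles. Irregular profiles count twice: by the trivial bound, and as profiles whose cuts may
    all fail. *)
Lemma sum_inv_stable :
  \sum_(p in Omega) (nb_stable_matchings p)%:R^-1
  <= 2 * #|Omega :\: Reg|%:R + #|Reg|%:R * regular_error
     + expR (4^-1 - H / 2) * #|Omega|%:R.
Proof.
have ub p : p \in Omega -> (nb_stable_matchings p)%:R^-1 <=
    (p \in [set p in Reg | ~~ conflict_free M L p])%:R + (p \in Omega :\: Reg)%:R
    + 2^-1 ^+ nb_cycles M L p :> R.
  move=> pO; have h0 : 0 <= 2^-1 ^+ nb_cycles M L p :> R by rewrite exprn_ge0 ?invr_ge0.
  have le1 : (nb_stable_matchings p)%:R^-1 <= 1 :> R.
    rewrite invf_le1; last first.
      rewrite ltr0n; apply/card_gt0P; exists M; rewrite inE matM.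
      by move: pO; rewrite inE => /andP[].
    rewrite ler1n; apply/card_gt0P; exists M; rewrite inE matM.
    by move: pO; rewrite inE => /andP[].
  have [pR|pR] := boolP (p \in Reg); last first.
    by rewrite in_setD pR pO /=; apply: le_trans le1 _; rewrite -addrA ler_wpDl ?ler0n // lerDl.
  have [cf|cf] := boolP (conflict_free M L p); last first.
    have -> : p \in [set p in Reg | ~~ conflict_free M L p] by apply/setIdP.
    by apply: le_trans le1 _; rewrite -addrA lerDl addr_ge0.
  rewrite -[leLHS]add0r lerD ?addr_ge0 // exprVn -natrX lef_pV2 ?posrE ?ltr0n ?expn_gt0 //.
    by rewrite ler_nat stable_ge_cycles.
  by apply: leq_trans (stable_ge_cycles matM pO cf); rewrite expn_gt0.
apply: le_trans (ler_sum _ ub) _; rewrite !big_split /=.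
have cardE (A : {set profile n}) : A \subset Omega ->
    \sum_(p in Omega) (p \in A)%:R = #|A|%:R :> R.
  move=> sA; rewrite -natr_sum; congr _%:R; rewrite (big_setID A) /= (setIidPr sA).
  rewrite -sum1_card [X in (_ + X)%N]big1 ?addn0 => [|p]; last by rewrite in_setD => /andP[/negPf->].
  by apply: eq_bigr => p ->.
rewrite cardE; last by apply/subsetP => p /setIdP[/Reg_Omega].
rewrite cardE ?subsetDl //.
have c1 := card_conflicts; have c2 := cycles_gen_fun_half R matM n0 L1.
have c3 := sum_uncuttable; rewrite /regular_error.
move: c1 c2 c3; set E := expR _ * _; set W := _ / (n%:R * H).
set e1 := _ / d%:R; set e2 := _ / (d ^ 4)%:R; set e3 := _ / (d ^ 2 * q)%:R; set e4 := _ / d%:R.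
lra.
Qed.
End InverseCount.

(** * First moments *)

Section DiscreteBeta.

(** Combinatorially: choose [r + s + 1] out of [K + 1] places and sort by the place [k] of the
    chosen element that has [r] chosen ones before it. *)
Lemma sum_binom_mul K r s :
  \sum_(k < K.+1) 'C(k, r) * 'C(K - k, s) = 'C(K.+1, (r + s).+1).
Proof.
elim: K r s => [|K IH] r s.
  rewrite big_ord1 subn0 !bin0n; case: r s => [|r] [|s] //=;
    by rewrite bin_small // addnS.
rewrite big_ord_recr /= subnn; case: s => [|s].
  rewrite bin0 muln1 [RHS]binS -IH addn0; congr addn.
  by apply: eq_bigr => k _; rewrite !bin0.
rewrite bin0n muln0 addn0 [RHS]binS -IH addnS -IH -big_split /=.
by apply: eq_bigr => k _; rewrite subSn ?binS ?mulnDr // -ltnS.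
Qed.

Lemma ffact_le_exp k r : k ^_ r <= k ^ r.
Proof.
elim: r k => [|r IH] k; first by rewrite ffactn0.
by rewrite ffactnSr expnSr leq_mul ?IH ?leq_subr.
Qed.

Lemma exp_le_ffact K m : m <= K -> (K - m) ^ m.+1 <= K.+1 ^_ m.+1.
Proof.
move=> mK; suff: forall r, r <= m.+1 -> (K - m) ^ r <= K.+1 ^_ r by apply.
elim=> // r IH rm; rewrite ffactnSr expnSr leq_mul ?IH ?(ltnW rm) //.
by lia.
Qed.

Lemma fact_mul_le_sum K r s : r + s <= K ->
  r`! * s`! * (K - (r + s)) ^ (r + s).+1
    <= (r + s).+1`! * \sum_(k < K.+1) k ^ r * (K - k) ^ s.
Proof.
move=> rsK; apply: leq_trans (leq_mul (leqnn _) (exp_le_ffact rsK)) _.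
rewrite -(bin_ffact K.+1) [_ * (_.+1)`!]mulnC mulnCA leq_mul2l; apply/orP; right.
rewrite -sum_binom_mul big_distrr /=; apply: leq_sum => k _.
by rewrite [_ * ('C(_, _) * _)]mulnC mulnACA !bin_ffact leq_mul ?ffact_le_exp.
Qed.

Variable R : realType.
Local Open Scope ring_scope.

(* A Riemann sum majorizes the Beta integral int x^r (1-x)^s dx = r! s! / (r+s+1)! *)
Lemma beta_le_sum K r s : (r + s < K)%N ->
  (r`!%:R * s`!%:R : R) <= (r + s).+1`!%:R *
    ((K%:R / (K - (r + s))%:R) ^+ (r + s).+1 / K%:R
      * \sum_(k < K.+1) (k%:R / K%:R) ^+ r * (1 - k%:R / K%:R) ^+ s).
Proof.
move=> rsK; have K0 : 0 < K%:R :> R by rewrite ltr0n; lia.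
have Km0 : 0 < (K - (r + s))%:R :> R by rewrite ltr0n subn_gt0.
move: (fact_mul_le_sum (ltnW rsK)); rewrite -(ler_nat R) !natrM natrX => h.
rewrite expr_div_n -(ler_pM2r (exprn_gt0 (r + s).+1 Km0)); apply: le_trans h _.
rewrite -[leRHS]mulrA ler_wpM2l ?mulr_ge0 ?ler0n // natr_sum.
have -> : \sum_(k < K.+1) (k ^ r * (K - k) ^ s)%:R =
    K%:R ^+ (r + s) * \sum_(k < K.+1) (k%:R / K%:R) ^+ r * (1 - k%:R / K%:R) ^+ s :> R.
  rewrite mulr_sumr; apply: eq_bigr => k _.
  rewrite exprD natrM !natrX natrB; last by rewrite -ltnS.
  rewrite mulrACA -!exprMn.
  congr (_ ^+ _ * _ ^+ _); first by field; rewrite gt_eqF.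
  by field; rewrite gt_eqF.
rewrite le_eqVlt; apply/orP; left; apply/eqP.
have a0 : K%:R != 0 :> R by rewrite gt_eqF.
have b0 : (K - (r + s))%:R ^+ (r + s).+1 != 0 :> R by rewrite gt_eqF // exprn_gt0.
by rewrite exprS; move: (_ ^+ (r + s).+1) b0 (\sum_(k < K.+1) _) => b b0 S; field; rewrite a0 b0.
Qed.
End DiscreteBeta.

Section RankingCounts.
Variable n : nat.
Implicit Types (i j k : 'I_n).

Lemma card_rankings i : #|rankings i| = (n.-1)`!.
Proof.
rewrite -ffactnn -[X in X ^_ _](_ : #|predC1 i| = _); last by rewrite cardC1 card_ord.
rewrite -card_uniq_tuples ?cardC1 ?card_ord //; apply: eq_card => t; rewrite !inE andbC.
congr andb; apply/idP/allP => [it j jt|h].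
  by rewrite inE; apply: contraNneq it => <-.
by apply/negP => /h; rewrite inE eqxx.
Qed.

(** Such a ranking consists of the people of [c] in some order, then [k], then the remaining
    [n - 2 - #|c|] people in some order. *)
Lemma card_rankings_before i k (c : pred 'I_n) : k != i ->
  #|[set t in rankings i | [forall j, (index j t < index k t) == c j]]|
  <= #|c|`! * (n - 2 - #|c|)`!.
Proof.
move=> ki; set T := [set t in _ | _].
have [->|[t0]] := set_0Vmem T; first by rewrite cards0.
pose c' := [predD1 [predD1 [predC c] & i] & k].
have spec t : t \in T -> [/\ uniq t, forall j, (j \in val t) = (j != i),
    forall j, c j = (index j t < index k t), c i = false & index k t = #|c|].
  rewrite !inE => /andP[/andP[Ut it] /forallP tc].
  have cE j : c j = (index j t < index k t) by rewrite (eqP (tc j)).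
  have mem j : (j \in val t) = (j != i).
    have sub : {subset t <= enum (predC1 i)}.
      by move=> x xt; rewrite mem_enum inE; apply: contraNneq it => <-.
    have [|_ /(_ j)] := uniq_min_size Ut sub.
      by rewrite -cardE cardC1 card_ord size_tuple.
    by rewrite mem_enum inE.
  have ci : c i = false.
    rewrite cE memNindex // size_tuple; apply/negbTE; rewrite -leqNgt.
    by rewrite -[leqRHS](size_tuple t) index_size.
  split=> //.
  have Utk := take_uniq (index k t) Ut.
  have kt : index k t <= size t by rewrite index_size.
  rewrite -{1}(size_takel kt) -(card_uniqP Utk); apply: eq_card => j.
  have [jt|jt] := boolP (j \in val t); first by rewrite in_take // -cE.
  apply/esym; rewrite [LHS](_ : _ = c j) //.
  have -> : j = i by apply/eqP; move: jt; rewrite mem negbK.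
  by rewrite ci; apply/esym/negP => /mem_take; rewrite mem eqxx.
move=> t0T; have [_ _ cE0 ci _] := spec _ t0T.
have ck : c k = false by rewrite cE0 ltnn.
have c'E : #|c'| = n - 2 - #|c|.
  have := cardC c; rewrite card_ord => E.
  have := cardD1 i [predC c]; rewrite [_ \in _]/= inE /= -[i \in c]/(c i) ci /= => E1.
  have := cardD1 k [predD1 [predC c] & i].
  rewrite !inE /= -[k \in c]/(c k) ck ki /= => E2.
  have -> : #|c'| = #|[predD1 [predD1 [predC c] & i] & k]| by [].
  have arith a x N : a + (1 + (1 + x)) = N -> x = N - 2 - a by lia.
  by apply: arith; rewrite -[X in 1 + X]E2 -E1.
pose S := [seq a ++ k :: b | a <- permutations (enum c), b <- permutations (enum c')].
have szS : size S = #|c|`! * (n - 2 - #|c|)`!.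
  by rewrite size_allpairs !size_permutations ?enum_uniq // -!cardE c'E.
rewrite -szS cardE -(size_map val); apply: uniq_leq_size.
  by rewrite map_inj_uniq ?enum_uniq //; apply: val_inj.
move=> s /mapP[t]; rewrite mem_enum => tT ->.
have [Ut mem cE _ kE] := spec _ tT.
have kt : k \in val t by rewrite mem.
have tE : val t = take (index k t) t ++ k :: drop (index k t).+1 t.
  rewrite -[LHS](cat_take_drop (index k t)); congr (_ ++ _).
  by rewrite (drop_nth k) ?index_mem // nth_index.
apply/allpairsP; exists (take (index k t) t, drop (index k t).+1 t); split=> //=.
  rewrite mem_permutations; apply: uniq_perm; rewrite ?enum_uniq ?take_uniq // => j.
  rewrite mem_enum -[RHS]/(c j) cE.
  have [jt|jt] := boolP (j \in val t); first by rewrite in_take.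
  rewrite (memNindex jt) ltnNge index_size /=.
  by apply/negbTE; apply: contra jt => /mem_take.
have := Ut; rewrite {1}tE cat_uniq /= => /and3P[_ /norP[knt hno] /andP[knd Ud]].
rewrite mem_permutations; apply: uniq_perm; rewrite ?enum_uniq // => j.
rewrite mem_enum !inE /= -[j \in c]/(c j) cE.
have [->|jk] := eqVneq j k; first by rewrite (negPf knd).
have [->|ji] := eqVneq j i.
  rewrite /=; apply/negbTE; apply/negP => /mem_drop; by rewrite mem eqxx.
rewrite /=; have jt : j \in val t by rewrite mem.
rewrite -(in_take _ jt) //; move: (jt); rewrite {1}tE mem_cat in_cons (negPf jk) /=.
have [jT|//] := boolP (j \in take _ _).
by move=> _; apply/negbTE; apply: contra hno => jd; apply/hasP; exists j.
Qed.
End RankingCounts.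

(** * Weighted first moments as sums over a grid *)

Section FirstMoment.
Variables (R : realType) (n : nat) (M : {ffun 'I_n -> 'I_n}) (K : nat).
Hypothesis matM : matching M.
Hypothesis nK : (n < K)%N.
Implicit Types (p : profile n) (i j : 'I_n) (z : 'I_n * 'I_n).
Local Notation acc := (acc M).
Local Notation Omega := (Omega M).
Local Open Scope ring_scope.

Definition unmatched z := (z.1 < z.2)%N && (M z.1 != z.2).

Lemma big_unmatched (T : Type) (idx : T) (op : Monoid.com_law idx)
    (h : 'I_n -> 'I_n -> T) :
  \big[op/idx]_i \big[op/idx]_(j | (i != j) && (M i != j)) h i j =
  \big[op/idx]_(z | unmatched z) op (h z.1 z.2) (h z.2 z.1).
Proof.
rewrite pair_big_dep /= (bigID (fun z : 'I_n * 'I_n => (z.1 < z.2)%N)) /=.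
rewrite [RHS]big_split /=; congr (op _ _).
  apply: eq_bigl => z.
  by rewrite /unmatched andbC; case: ltnP => //= lt12; rewrite neq_ltn lt12.
rewrite (reindex_inj (h := fun z : 'I_n * 'I_n => (z.2, z.1))) /=; last first.
  by move=> [a b] [c d] [-> ->].
apply: eq_bigl => z.
rewrite /unmatched -leqNgt andbC [z.2 == z.1]eq_sym (match_eq matM) [z.2 == _]eq_sym.
by rewrite andbA [(_ <= _)%N && _]andbC -ltn_neqAle.
Qed.

Definition bern (x : R) (b : bool) : R := if b then x else 1 - x.

(** A discrete point [x] of the cube, where [x i] stands for the relative place of [M i] in the
    ranking of [i]: everybody else precedes [M i] with probability [x i]. *)
Definition grid (k : {ffun 'I_n -> 'I_K.+1}) i : R := (k i)%:R / K%:R.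

Variable rho : 'I_n -> 'I_n -> bool -> R.
Hypothesis rho0 : forall i j b, 0 <= rho i j b.

Definition weight p : R :=
  \prod_(z | unmatched z) (rho z.1 z.2 (acc p z.1 z.2) * rho z.2 z.1 (acc p z.2 z.1)).

(** The mean weight of one pair when its members accept each other independently with probabilities
    [x z.1] and [x z.2]; mutual acceptance is excluded by stability. *)
Definition pair_sum (x : 'I_n -> R) z : R :=
  \sum_(b : bool * bool | b != (true, true))
    rho z.1 z.2 b.1 * rho z.2 z.1 b.2 * (bern (x z.1) b.1 * bern (x z.2) b.2).

(** On [Omega], [acc] is determined by its values on unmatched pairs; [fam] contains the codes
    without mutual acceptance. *)
Let code p : {ffun 'I_n * 'I_n -> bool * bool} :=
  [ffun z => if unmatched z then (acc p z.1 z.2, acc p z.2 z.1) else (false, false)].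
Let dec (e : {ffun 'I_n * 'I_n -> bool * bool}) i j : bool :=
  if (i < j)%N then (e (i, j)).1 else if (j < i)%N then (e (j, i)).2 else false.
Let fam := pfamily (false, false) unmatched
  (fun _ : 'I_n * 'I_n => [pred b : bool * bool | b != (true, true)]).

Let code_dec p i j : p \in Omega -> dec (code p) i j = acc p i j.
Proof.
move=> pO; rewrite /dec !ffunE /unmatched /=; case: ltnP => ij /=.
  by case: eqP => [<-|//] /=; rewrite acc_match.
case: ltnP => ji /=.
  by case: eqP => [<-|//] /=; rewrite acc_matchl.
have -> : i = j by apply: val_inj; apply/eqP; rewrite eqn_leq ij ji.
by rewrite (acc_irr pO).
Qed.

Let code_fam p : p \in Omega -> code p \in fam.
Proof.
move=> pO; apply/pfamilyP; split.
  by apply/subsetP => z; rewrite inE ffunE; case: ifP; rewrite ?eqxx.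
move=> z zu; have {}zu : unmatched z := zu.
rewrite inE ffunE zu xpair_eqE; apply/negP => /andP[/eqP h1 /eqP h2].
by have := acc_asym pO h1; rewrite h2.
Qed.

Let dec_irr e i : dec e i i = false. Proof. by rewrite /dec ltnn. Qed.
Let dec_match e i : e \in fam -> dec e i (M i) = false.
Proof.
move=> /pfamilyP[/subsetP se _]; rewrite /dec.
have e0 z : ~~ unmatched z -> e z = (false, false).
  by move=> nz; apply/eqP; apply: contraNT nz => h; apply: se; rewrite inE.
case: ifP => _; first by rewrite e0 // /unmatched /= eqxx andbF.
by case: ifP => _ //; rewrite e0 // /unmatched /= matchK // eqxx andbF.
Qed.

Let card_dec e i : e \in fam -> (#|dec e i| <= n - 2)%N.
Proof.
move=> ef; have sub : dec e i \subset [predD1 predC1 i & M i].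
  apply/subsetP => j ji; rewrite !inE.
  have [E|_] := eqVneq j (M i); first by rewrite E -topredE /= dec_match in ji.
  by have [E|//] := eqVneq j i; rewrite E -topredE /= dec_irr in ji.
apply: leq_trans (subset_leq_card sub) _.
have := cardD1 (M i) (predC1 i); rewrite cardC1 card_ord inE /= match_neq // => E.
have arith a b : (a.-1 = 1 + b -> b <= a - 2)%N by lia.
exact: arith E.
Qed.

Let wcode (e : {ffun 'I_n * 'I_n -> bool * bool}) : R :=
  \prod_(z | unmatched z) (rho z.1 z.2 (e z).1 * rho z.2 z.1 (e z).2).

Let wcode0 e : 0 <= wcode e.
Proof. by apply: prodr_ge0 => z _; rewrite mulr_ge0. Qed.

Let weight_code p : weight p = wcode (code p).
Proof. by apply: eq_bigr => z zu; rewrite ffunE zu. Qed.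

Let fiber_card e : e \in fam ->
  (#|[set p in Omega | code p == e]| <= \prod_i (#|dec e i|`! * (n - 2 - #|dec e i|)`!))%N.
Proof.
move=> ef; pose T i := [set t in rankings i |
  [forall j, (index j t < index (M i) t)%N == dec e i j]].
apply: (@leq_trans #|family (fun i => mem (T i))|).
  apply/subset_leq_card/subsetP => p /setIdP[pO /eqP pe]; apply/familyP => i.
  suff: p i \in T i by []. apply/setIdP; split.
    by move: pO; rewrite inE => /andP[/forallP].
  by apply/forallP => j; rewrite -pe code_dec.
rewrite card_family foldrE big_map big_enum /=.
apply: leq_prod => i _; apply: leq_trans (card_rankings_before _ (match_neq matM i)).
by rewrite leq_eqVlt; apply/orP; left; apply/eqP/eq_card.
Qed.

(** The product over the [n] rankings of the factors in [beta_le_sum], where [r + s = n - 2]. *)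
Definition beta_const : R := ((K%:R / (K - (n - 2))%:R) ^+ n.-1 / K%:R) ^+ n.

Let prod_bern (x : 'I_n -> R) e : e \in fam ->
  \prod_i (x i ^+ #|dec e i| * (1 - x i) ^+ (n - 2 - #|dec e i|)) =
  \prod_(z | unmatched z) (bern (x z.1) (e z).1 * bern (x z.2) (e z).2).
Proof.
move=> ef; pose h i j := bern (x i) (dec e i j).
have row i : x i ^+ #|dec e i| * (1 - x i) ^+ (n - 2 - #|dec e i|) =
    \prod_(j | (i != j) && (M i != j)) h i j.
  rewrite (bigID (dec e i)) /=; congr (_ * _).
    rewrite (eq_bigl (dec e i)); last first.
      move=> j /=; apply/andb_idl => ej; apply/andP; split.
        by apply: contraTneq ej => <-; rewrite dec_irr.
      by apply: contraTneq ej => <-; rewrite dec_match.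
    by rewrite (eq_bigr (fun=> x i)) ?prodr_const // => j ej; rewrite /h ej.
  rewrite (eq_bigr (fun=> 1 - x i)) => [|j /andP[_ /negPf ej]]; last by rewrite /h ej.
  rewrite prodr_const; congr (_ ^+ _).
  have E : #|[pred j | (i != j) && (M i != j)]| = (n - 2)%N.
    have := cardD1 (M i) (predC1 i); rewrite cardC1 card_ord inE /= match_neq //.
    rewrite (@eq_card _ [predD1 predC1 i & M i] [pred j | (i != j) && (M i != j)]).
      have arith a b : (a.-1 = 1 + b -> b = a - 2)%N by lia.
      exact: arith.
    by move=> j; rewrite !inE [j == i]eq_sym [j == M i]eq_sym andbC.
  rewrite -E -(cardID (dec e i) [pred j | (i != j) && (M i != j)]).
  rewrite (@eq_card _ [predI [pred j | (i != j) && (M i != j)] & dec e i] (dec e i)).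
    rewrite addKn; apply: eq_card => j; rewrite !inE -!topredE /= andbC //.
  move=> j; rewrite !inE -!topredE /=; apply/andb_idl => ej; apply/andP; split.
    by apply: contraTneq ej => <-; rewrite dec_irr.
  by apply: contraTneq ej => <-; rewrite dec_match.
rewrite (eq_bigr _ (fun i _ => row i)) big_unmatched /=.
apply: eq_bigr => z /andP[lt12 _]; rewrite /h /dec lt12 ltnNge (ltnW lt12) /=.
by case: z {lt12}.
Qed.

(** Group the profiles by [acc]: each row then contributes a Beta integral. For a fixed grid point
    the product over rows is also a product over unmatched pairs, so the sum over all codes
    factorizes into the [pair_sum]. *)
Lemma first_moment_grid :
  \sum_(p in Omega) weight p <= (n.-1)`!%:R ^+ n * beta_const *
    \sum_(k : {ffun 'I_n -> 'I_K.+1}) \prod_(z | unmatched z) pair_sum (grid k) z.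
Proof.
rewrite (partition_big code (fun e => e \in fam)) => [|p pO]; last exact: code_fam.
pose S r : R := \sum_(k < K.+1) (k%:R / K%:R) ^+ r * (1 - k%:R / K%:R) ^+ (n - 2 - r).
pose B : R := (K%:R / (K - (n - 2))%:R) ^+ n.-1 / K%:R.
have B0 : 0 <= B by rewrite divr_ge0 // exprn_ge0 // divr_ge0.
have beta i e : e \in fam -> (#|dec e i|`!%:R * (n - 2 - #|dec e i|)`!%:R : R)
    <= (n.-1)`!%:R * B * S #|dec e i|.
  move=> ef; have le2 := card_dec i ef.
  have n2 : (n - 2).+1 = n.-1.
    have := match_neq matM i; case: (n) (i) (M i) => [|[|m]] //; first by case.
      by move=> [[] //] ? [[] //] ?; rewrite -val_eqE.
    by move=> *; rewrite subn2.
  have lt1 : (#|dec e i| + (n - 2 - #|dec e i|) < K)%N.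
    by rewrite subnKC //; apply: (leq_ltn_trans _ nK); apply: leq_subr.
  by have := beta_le_sum R lt1; rewrite subnKC // n2 /B /S mulrA.
apply: (@le_trans _ _ (\sum_(e in fam) (n.-1)`!%:R ^+ n * B ^+ n *
    (wcode e * \prod_i S #|dec e i|))).
  apply: ler_sum => e ef.
  rewrite (eq_bigr (fun=> wcode e)) => [|p /andP[_ /eqP <-]]; last exact: weight_code.
  rewrite sumr_const -[leLHS]mulr_natl mulrC mulrCA ler_wpM2l ?wcode0 //.
  have le1 : (#|(fun p => (p \in Omega) && (code p == e))| <=
      \prod_i (#|dec e i|`! * (n - 2 - #|dec e i|)`!))%N.
    apply: leq_trans (fiber_card ef); rewrite leq_eqVlt; apply/orP; left.
    by apply/eqP/eq_card => p; rewrite [RHS]inE.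
  rewrite -(ler_nat R) in le1; apply: le_trans le1 _.
  rewrite -exprMn -[X in _ ^+ X]card_ord -prodr_const -big_split natr_prod /=.
  apply: ler_prod => i _; rewrite natrM mulr_ge0 //=; exact: beta.
rewrite -mulr_sumr /beta_const -/B ler_wpM2l ?mulr_ge0 ?exprn_ge0 //.
rewrite le_eqVlt; apply/orP; left; apply/eqP.
transitivity (\sum_(e in fam) \sum_(k : {ffun 'I_n -> 'I_K.+1})
   \prod_(z | unmatched z) (rho z.1 z.2 (e z).1 * rho z.2 z.1 (e z).2 *
      (bern (grid k z.1) (e z).1 * bern (grid k z.2) (e z).2))).
  apply: eq_bigr => e ef; rewrite bigA_distr_bigA mulr_sumr; apply: eq_bigr => k _.
  by rewrite (prod_bern (grid k) ef) /wcode -big_split.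
rewrite exchange_big /=; apply: eq_bigr => k _; rewrite /pair_sum.
rewrite (big_distr_big_dep (false, false)) /=.
by apply: eq_bigl.
Qed.
End FirstMoment.

(** * Exponential sums over the grid *)

Section ExpBounds.
Variable R : realType.
Local Open Scope ring_scope.
Implicit Types (x y t a : R).

Lemma expRN_le_inv y : 0 <= y -> expR (- y) <= (1 + y)^-1.
Proof.
move=> y0; rewrite expRN lef_pV2 ?posrE ?expR_gt0 ?expR_ge1Dx //; lra.
Qed.

Lemma expR_le_affine t : 0 <= t <= 1 -> expR t <= 1 + 3 * t.
Proof.
move=> /andP[t0 t1]; have := expR_ge1Dx (- (t / 2)) => h.
have h1 : 0 < 1 - t / 2 by lra.
have h2 : (1 - t / 2) ^+ 2 * expR t <= 1.
  have -> : expR t = (expR (- (t / 2)) ^+ 2)^-1.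
    by rewrite expRN exprVn invrK -expRM_natl; congr expR; lra.
  rewrite ler_pdivrMr ?exprn_gt0 ?expR_gt0 // mul1r lerXn2r ?nnegrE ?expR_ge0 //; lra.
have h3 : 1 <= (1 + 3 * t) * (1 - t / 2) ^+ 2.
  have : 0 <= t * (1 - t) * (8 - 3 * t) by rewrite !mulr_ge0 //; lra.
  by lra.
rewrite -(ler_pM2l (exprn_gt0 2 h1)); apply: le_trans h2 _; rewrite mulrC; lra.
Qed.

Lemma sqr_le_expR y : 0 <= y -> y ^+ 2 <= 2 * expR y.
Proof.
by move=> y0; have := expR_ge1Dxn 1 y0; rewrite /= (_ : 2`!%:R = 2) //; lra.
Qed.

Lemma geometric_exp_le (K : nat) a : (0 < K)%N -> 0 < a ->
  \sum_(k < K.+1) expR (- a * (k%:R / K%:R)) <= K%:R / a * (1 + a / K%:R).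
Proof.
move=> K0 a0; have KR : 0 < K%:R :> R by rewrite ltr0n.
set y := a / K%:R; have y0 : 0 < y by rewrite divr_gt0.
have -> : \sum_(k < K.+1) expR (- a * (k%:R / K%:R)) = \sum_(k < K.+1) expR (- y) ^+ k.
  apply: eq_bigr => k _; rewrite -expRM_natl; congr expR; rewrite /y; field.
  by rewrite gt_eqF.
set z := expR (- y); have z0 : 0 <= z by rewrite expR_ge0.
have zl : z <= (1 + y)^-1 by apply: expRN_le_inv; exact: ltW.
have z1 : y / (1 + y) <= 1 - z.
  have -> : y / (1 + y) = 1 - (1 + y)^-1 by field; rewrite gt_eqF //; lra.
  by lra.
have d0 : 0 < y / (1 + y) by rewrite divr_gt0 //; lra.
have := subrX1 z K.+1 => E.
have h1 : (1 - z) * \sum_(k < K.+1) z ^+ k <= 1.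
  have -> : (1 - z) * \sum_(k < K.+1) z ^+ k = 1 - z ^+ K.+1 by rewrite -opprB mulNr -E; lra.
  by rewrite gerBl exprn_ge0.
have S0 : 0 <= \sum_(k < K.+1) z ^+ k by apply: sumr_ge0 => k _; rewrite exprn_ge0.
have h2 : y / (1 + y) * \sum_(k < K.+1) z ^+ k <= 1.
  by apply: le_trans h1; rewrite ler_wpM2r.
have -> : K%:R / a * (1 + y) = (y / (1 + y))^-1.
  by rewrite invf_div mulrC; congr (_ * _); rewrite /y invf_div.
by rewrite -[leRHS]mul1r ler_pdivlMr // mulrC.
Qed.

(** Fine enough that the discretization factors of all [n] Beta integrals together are at most 2,
    see [beta_const_le]. *)
Definition mesh (n : nat) : nat := (2 * n ^ 3)%N.

(** The sum is concentrated on arguments of order [1 / a], where the quadratic term changes it by a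
    relative [O(1 / n)]: replace [exp (x ^ 2)] by [1 + 3 x ^ 2], and [x ^ 2] by a multiple of
    [exp (a x / 2) / a ^ 2]. The product over [n] coordinates then stays bounded. *)
Lemma gaussian_exp_le (n : nat) a : (0 < n)%N ->
  Num.sqrt n%:R / 2 <= a <= 2 * Num.sqrt n%:R ->
  \sum_(k < (mesh n).+1) expR (- a * (k%:R / (mesh n)%:R) + (k%:R / (mesh n)%:R) ^+ 2)
    <= (mesh n)%:R / a * (1 + 385 / n%:R).
Proof.
move=> n0 /andP[a1 a2]; set K := mesh n.
have nR : 1 <= n%:R :> R by rewrite ler1n.
set lam := Num.sqrt n%:R in a1 a2.
have lam2 : lam ^+ 2 = n%:R by rewrite sqr_sqrtr.
have lam1 : 1 <= lam by rewrite -sqrtr1 ler_wsqrtr.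
have lamn : lam <= n%:R by rewrite -lam2 expr2; nra.
have a0 : 0 < a by lra.
have K0 : (0 < K)%N by rewrite muln_gt0 expn_gt0 n0.
have KR : 0 < K%:R :> R by rewrite ltr0n.
have KE : K%:R = 2 * n%:R ^+ 3 :> R by rewrite natrM natrX.
pose x (k : 'I_K.+1) : R := k%:R / K%:R.
have x01 k : 0 <= x k <= 1.
  by rewrite divr_ge0 //= ler_pdivrMr // mul1r ler_nat -ltnS ltn_ord.
have a20 : 0 < a / 2 by lra.
have le1 (k : 'I_K.+1) : expR (- a * (k%:R / K%:R) + (k%:R / K%:R) ^+ 2) <=
    expR (- a * (k%:R / K%:R)) + 24 / a ^+ 2 * expR (- (a / 2) * (k%:R / K%:R)).
  rewrite -/(x k); have /andP[x0 x1] := x01 k.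
  have q01 : 0 <= x k ^+ 2 <= 1 by rewrite exprn_ge0 //= exprn_ile1.
  rewrite expRD; apply: le_trans (ler_wpM2l (expR_ge0 _) (expR_le_affine q01)) _.
  rewrite mulrDr mulr1 lerD2l.
  have y0 : 0 <= a / 2 * x k by rewrite mulr_ge0 // ltW.
  have s1 : x k ^+ 2 <= 8 / a ^+ 2 * expR (a / 2 * x k).
    have := sqr_le_expR y0; rewrite exprMn expr_div_n => h.
    by rewrite mulrAC ler_pdivlMr ?exprn_gt0 //; lra.
  have E : expR (- (a / 2) * x k) = expR (- a * x k) * expR (a / 2 * x k).
    by rewrite -expRD; congr expR; lra.
  rewrite E; have e0 := expR_ge0 (- a * x k).
  have := ler_wpM2l e0 s1; lra.
apply: le_trans (ler_sum _ (fun k _ => le1 k)) _; rewrite big_split /= -mulr_sumr.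
have g1 := geometric_exp_le K0 a0; have g2 := geometric_exp_le K0 a20.
have c0 : 0 <= 24 / a ^+ 2 by rewrite divr_ge0 // exprn_ge0 // ltW.
have {}g2 := ler_wpM2l c0 g2.
apply: le_trans (lerD g1 g2) _.
have -> : 24 / a ^+ 2 * (K%:R / (a / 2) * (1 + a / 2 / K%:R)) =
    K%:R / a * (48 / a ^+ 2 * (1 + a / 2 / K%:R)).
  by field; rewrite !gt_eqF.
rewrite -mulrDr ler_wpM2l ?divr_ge0 ?(ltW a0) //.
have aK : a / K%:R <= 1 / n%:R.
  rewrite ler_pdivrMr // KE.
  have -> : 1 / n%:R * (2 * n%:R ^+ 3) = 2 * n%:R * n%:R :> R.
    by field; rewrite gt_eqF //; lra.
  by nra.
have n1 : 1 / n%:R <= 1 :> R by rewrite ler_pdivrMr; lra.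
have aa : 48 / a ^+ 2 <= 192 / n%:R.
  rewrite ler_pdivrMr ?exprn_gt0 // mulrAC ler_pdivlMr; last lra.
  rewrite -lam2; nra.
have t0 : 0 <= 48 / a ^+ 2 by rewrite divr_ge0 // exprn_ge0 // ltW.
have -> : a / 2 / K%:R = a / K%:R / 2 by rewrite mulrAC.
have u0 : 0 <= a / K%:R by rewrite divr_ge0 // ltW.
move: aK aa n1 u0 t0; set u := a / K%:R; set v := 48 / a ^+ 2.
have -> : 192 / n%:R = 192 * (1 / n%:R) :> R by rewrite mulrA mulr1.
have -> : 385 / n%:R = 385 * (1 / n%:R) :> R by rewrite mulrA mulr1.
set w := 1 / n%:R; move=> h1 h2 h3 h4 h5; nra.
Qed.
End ExpBounds.

(** * Product bounds for the integrand *)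

Section Tilting.
Variables (R : realType) (n : nat) (M : {ffun 'I_n -> 'I_n}).
Hypothesis matM : matching M.
Hypothesis n0 : (0 < n)%N.
Implicit Types (p : profile n) (i j : 'I_n) (z : 'I_n * 'I_n) (x mu : 'I_n -> R).
Local Notation Omega := (Omega M).
Local Notation K := (mesh n).
Local Notation unmatched := (unmatched M).
Local Open Scope ring_scope.

Definition sqrtn : R := Num.sqrt n%:R.
Local Notation lam := sqrtn.

Lemma sqrtn2 : lam ^+ 2 = n%:R. Proof. by rewrite sqr_sqrtr. Qed.
Lemma sqrtn_ge1 : 1 <= lam.
Proof. by rewrite -sqrtr1 ler_wsqrtr // ler1n. Qed.
Let lam0 : 0 < lam. Proof. exact: lt_le_trans sqrtn_ge1. Qed.

Lemma bernoulli_le (y : R) m : 0 <= y <= 1 -> 1 - m%:R * y <= (1 - y) ^+ m.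
Proof.
move=> /andP[y0 y1]; elim: m => [|m IH]; first by rewrite expr0; lra.
have h : 0 <= 1 - y by lra.
rewrite exprS; apply: le_trans (ler_wpM2l h IH); rewrite -natr1.
have : 0 <= m%:R * y * y by rewrite !mulr_ge0.
lra.
Qed.

Lemma mesh_gt : (n < K)%N.
Proof.
rewrite /mesh; have : (n <= n ^ 3)%N by rewrite -{1}(expn1 n) leq_pexp2l.
by move: n0; lia.
Qed.

Lemma beta_const_le : beta_const R n K * K%:R ^+ n <= 2.
Proof.
have KR : 0 < K%:R :> R by rewrite ltr0n (leq_ltn_trans _ mesh_gt).
have nK : (n - 2 <= K)%N by rewrite (leq_trans (leq_subr _ _)) // ltnW // mesh_gt.
rewrite /beta_const -exprMn divfK ?gt_eqF // -exprM natrB //.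
set y : R := (n - 2)%:R / K%:R.
have yK : (n - 2)%:R = y * K%:R by rewrite divfK // gt_eqF.
have small : ((n.-1 * n)%N)%:R * y <= 2^-1.
  have KE : K%:R = 2 * (n ^ 3)%:R :> R by rewrite natrM.
  rewrite /y mulrA ler_pdivrMr // -natrM KE mulrA mulVf ?mul1r ?pnatr_eq0 //.
  rewrite ler_nat expnS expnS expn1 mulnC.
  by apply: leq_mul; [rewrite leq_subr | rewrite mulnC leq_mul // leq_pred].
have y0 : 0 <= y by rewrite divr_ge0.
have y1 : y <= 1 by rewrite ler_pdivrMr // mul1r ler_nat.
have h := bernoulli_le (n.-1 * n) (introT andP (conj y0 y1)).
have h2 : 2^-1 <= (1 - y) ^+ (n.-1 * n) by lra.
have -> : K%:R / (K%:R - (n - 2)%:R) = (1 - y)^-1 :> R.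
  rewrite yK -{1}[K%:R]mul1r -[X in _ / (X - _)]mul1r -mulrBl.
  by rewrite -mulf_div divff ?gt_eqF // mulr1 mul1r.
by rewrite exprVn -[leRHS]invrK lef_pV2 ?posrE ?invr_gt0 //; apply: lt_le_trans h2; rewrite invr_gt0.
Qed.

Lemma grid_tilt (a : 'I_n -> R) : (forall i, lam / 2 <= a i <= 2 * lam) ->
  \sum_(k : {ffun 'I_n -> 'I_K.+1})
     \prod_i expR (- a i * grid R k i + grid R k i ^+ 2)
  <= K%:R ^+ n * expR 385 * \prod_i (a i)^-1.
Proof.
move=> ha; rewrite -(bigA_distr_bigA (fun i (k : 'I_K.+1) =>
  expR (- a i * (k%:R / K%:R) + (k%:R / K%:R) ^+ 2))) /=.
have nR : 0 < n%:R :> R by rewrite ltr0n.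
apply: (@le_trans _ _ (\prod_i (K%:R / a i * (1 + 385 / n%:R)))).
  apply: ler_prod => i _; rewrite sumr_ge0 /= => [|k _]; last exact: expR_ge0.
  exact: gaussian_exp_le.
rewrite big_split big_split /= !prodr_const card_ord mulrAC ler_wpM2r //.
  by apply: prodr_ge0 => i _; rewrite invr_ge0; have /andP[h _] := ha i; move: lam0; lra.
rewrite ler_wpM2l ?exprn_ge0 //.
apply: le_trans (_ : expR (385 / n%:R) ^+ n <= _).
  by rewrite lerXn2r ?nnegrE ?expR_ge0 ?expR_ge1Dx // addr_ge0 ?divr_ge0 // ltW.
by rewrite -expRM_natr divfK // gt_eqF.
Qed.

(** In the expansion of the squared sum, the diagonal and the matched pairs contribute at most the
    sum of the [x i ^+ 2] each. *)
Lemma unmatched_sum_ge x :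
  lam * (\sum_i x i) - n%:R / 2 - \sum_i x i ^+ 2
  <= \sum_(z | unmatched z) x z.1 * x z.2.
Proof.
set s := \sum_i x i; set sq := \sum_i x i ^+ 2.
have e1 : s ^+ 2 = sq + \sum_i x i * x (M i) +
    2 * \sum_(z | unmatched z) x z.1 * x z.2.
  have -> : 2 * \sum_(z | unmatched z) x z.1 * x z.2 =
      \sum_i \sum_(j | (i != j) && (M i != j)) x i * x j.
    rewrite (big_unmatched matM _ (fun i j => x i * x j)) mulr_sumr.
    by apply: eq_bigr => z _ /=; ring.
  rewrite expr2 {1}/s mulr_suml -!big_split /=; apply: eq_bigr => i _.
  rewrite /s mulr_sumr (bigD1 i) //= (bigD1 (M i)) /=; last exact: match_neq.
  rewrite addrA; congr (_ + _); apply: eq_bigl => j.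
  by rewrite [i == j]eq_sym [M i == j]eq_sym.
have e2 : \sum_i x i * x (M i) <= sq.
  have -> : sq = \sum_i (x i ^+ 2 + x (M i) ^+ 2) / 2.
    rewrite -mulr_suml big_split /=.
    have -> : \sum_i x (M i) ^+ 2 = sq.
      by rewrite /sq [RHS](reindex_inj (match_inj matM)).
    by rewrite -/sq; lra.
  apply: ler_sum => i _; have : 0 <= (x i - x (M i)) ^+ 2 by rewrite sqr_ge0.
  lra.
have : 0 <= (s - lam) ^+ 2 by rewrite sqr_ge0.
have := sqrtn2; lra.
Qed.

(** Up to a constant, the total number of profiles times [exp (n / 2) * n ^ (- n / 2)], the order of
    the bound for the probability that a given matching is stable. The 2 comes from [beta_const_le],
    [expR 385] from [grid_tilt]. *)
Definition kappa : R :=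
  (n.-1)`!%:R ^+ n * (2 * expR 385 * expR (n%:R / 2) * lam ^- n).

Lemma kappa_ge0 : 0 <= kappa.
Proof. by rewrite !mulr_ge0 ?exprn_ge0 ?invr_ge0 ?expR_ge0 ?exprn_ge0 // ltW. Qed.

Section WithWeight.
Variable rho : 'I_n -> 'I_n -> bool -> R.
Hypothesis rho0 : forall i j b, 0 <= rho i j b.
Variable h : ('I_n -> R) -> 'I_n * 'I_n -> R.
Hypothesis h0 : forall x z, (forall i, 0 <= x i <= 1) -> 0 <= h x z.
Hypothesis pair_le : forall x z, (forall i, 0 <= x i <= 1) -> unmatched z ->
  pair_sum rho x z <= expR (- (x z.1 * x z.2)) * h x z.

(* The inequality [s^2 / 2 >= sqrt n * s - n / 2] for [s = sum_i x i] makes the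
   bound on the integrand a product over the coordinates. *)
Lemma first_moment (c1 c2 : R) mu1 mu2 : 0 <= c1 -> 0 <= c2 ->
  (forall i, lam / 2 <= lam + mu1 i <= 2 * lam) ->
  (forall i, lam / 2 <= lam + mu2 i <= 2 * lam) ->
  (forall x, (forall i, 0 <= x i <= 1) -> \prod_(z | unmatched z) h x z <=
     c1 * expR (- \sum_i mu1 i * x i) + c2 * expR (- \sum_i mu2 i * x i)) ->
  \sum_(p in Omega) weight M rho p <= kappa *
     (c1 * \prod_i (lam / (lam + mu1 i)) + c2 * \prod_i (lam / (lam + mu2 i))).
Proof.
move=> c10 c20 m1 m2 hle.
apply: le_trans (first_moment_grid matM mesh_gt rho0) _.
have K0 : 0 < K%:R :> R by rewrite ltr0n (leq_ltn_trans _ mesh_gt).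
have B0 : 0 <= beta_const R n K.
  by rewrite exprn_ge0 // divr_ge0 // exprn_ge0 // divr_ge0.
pose T mu (k : {ffun 'I_n -> 'I_K.+1}) :=
  \prod_i expR (- (lam + mu i) * grid R k i + grid R k i ^+ 2).
have grid01 (k : {ffun 'I_n -> 'I_K.+1}) i : 0 <= grid R k i <= 1.
  by rewrite /grid divr_ge0 //= ler_pdivrMr // mul1r ler_nat -ltnS ltn_ord.
have TE mu k : expR (n%:R / 2) * T mu k =
    expR (- (lam * (\sum_i grid R k i) - n%:R / 2 - \sum_i grid R k i ^+ 2))
    * expR (- \sum_i mu i * grid R k i).
  rewrite /T -expR_sum -!expRD; congr expR; rewrite !big_split /= -!sumrN mulr_sumr.
  rewrite (eq_bigr (fun i => - (lam * grid R k i) - mu i * grid R k i)); last first.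
    by move=> i _; lra.
  by rewrite big_split /= !sumrN; lra.
have step (k : {ffun 'I_n -> 'I_K.+1}) :
    \prod_(z | unmatched z) pair_sum rho (grid R k) z
    <= expR (n%:R / 2) * (c1 * T mu1 k + c2 * T mu2 k).
  set x := grid R k; have x01 : forall i, 0 <= x i <= 1 by exact: grid01.
  apply: (@le_trans _ _ (\prod_(z | unmatched z) (expR (- (x z.1 * x z.2)) * h x z))).
    apply: ler_prod => z zu; rewrite pair_le // andbT; apply: sumr_ge0 => b _.
    have b0 (t : R) c : 0 <= t <= 1 -> 0 <= bern t c by case: c => /= /andP[]; lra.
    by rewrite !mulr_ge0 ?b0.
  rewrite big_split /= -expR_sum sumrN.
  apply: (@le_trans _ _ (expR (- (lam * (\sum_i x i) - n%:R / 2 - \sum_i x i ^+ 2)) *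
     (c1 * expR (- \sum_i mu1 i * x i) + c2 * expR (- \sum_i mu2 i * x i)))).
    apply: ler_pM; rewrite ?expR_ge0 ?hle //.
      by apply: prodr_ge0 => z _; exact: h0.
    by rewrite ler_expR lerN2 unmatched_sum_ge.
  by rewrite !mulrDr !(mulrCA _ c1) !(mulrCA _ c2) !TE.
have e2 := expR_ge0 (n%:R / 2 : R).
have f0 : 0 <= (n.-1)`!%:R ^+ n :> R by rewrite exprn_ge0.
have lamE mu : \prod_i (lam / (lam + mu i)) = lam ^+ n * \prod_i (lam + mu i)^-1.
  by rewrite big_split /= prodr_const card_ord.
have P0 mu : (forall i, lam / 2 <= lam + mu i <= 2 * lam) ->
    0 <= \prod_i (lam + mu i)^-1.
  move=> hm; apply: prodr_ge0 => i _; rewrite invr_ge0.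
  by have /andP[? _] := hm i; move: lam0; lra.
rewrite -mulrA /kappa -[leRHS]mulrA ler_wpM2l //.
apply: (@le_trans _ _ (beta_const R n K * (expR (n%:R / 2) *
   (K%:R ^+ n * expR 385 * (c1 * \prod_i (lam + mu1 i)^-1 + c2 * \prod_i (lam + mu2 i)^-1))))).
  rewrite ler_wpM2l //; apply: le_trans (ler_sum _ (fun k _ => step k)) _.
  rewrite -mulr_sumr ler_wpM2l // big_split /= -!mulr_sumr mulrDr.
  rewrite !(mulrCA _ c1) !(mulrCA _ c2).
  by apply: lerD; rewrite ler_wpM2l // grid_tilt.
rewrite !lamE; move: (P0 _ m1) (P0 _ m2).
set P1 := \prod_i (lam + mu1 i)^-1; set P2 := \prod_i (lam + mu2 i)^-1 => p1 p2.
have -> : 2 * expR 385 * expR (n%:R / 2) * lam ^- n * (c1 * (lam ^+ n * P1) + c2 * (lam ^+ n * P2))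
   = 2 * (expR (n%:R / 2) * (expR 385 * (c1 * P1 + c2 * P2))).
  have l0 : lam ^+ n != 0 by rewrite gt_eqF // exprn_gt0.
  by move: (lam ^+ n) l0 => l l0; field.
have -> : beta_const R n K * (expR (n%:R / 2) * (K%:R ^+ n * expR 385 * (c1 * P1 + c2 * P2)))
   = (beta_const R n K * K%:R ^+ n) * (expR (n%:R / 2) * (expR 385 * (c1 * P1 + c2 * P2))).
  by ring.
rewrite ler_wpM2r ?beta_const_le //.
by rewrite !mulr_ge0 ?expR_ge0 // addr_ge0 ?mulr_ge0.
Qed.
End WithWeight.
End Tilting.

(** * Prescribed acceptances and small numbers of suitors *)

Section Planted.
Variables (R : realType) (n : nat) (M : {ffun 'I_n -> 'I_n}).
Hypothesis matM : matching M.
Hypothesis n0 : (0 < n)%N.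
Implicit Types (p : profile n) (i j : 'I_n) (z : 'I_n * 'I_n) (x mu : 'I_n -> R).
Local Notation Omega := (Omega M).
Local Notation acc := (acc M).
Local Notation unmatched := (unmatched M).
Local Notation lam := (sqrtn R n).
Local Notation kappa := (kappa R n).
Local Open Scope ring_scope.

Let lam1 : 1 <= lam. Proof. exact: sqrtn_ge1. Qed.

Lemma pair_sumE (rho : 'I_n -> 'I_n -> bool -> R) x z : pair_sum rho x z =
  rho z.1 z.2 false * rho z.2 z.1 false * ((1 - x z.1) * (1 - x z.2))
  + rho z.1 z.2 true * rho z.2 z.1 false * (x z.1 * (1 - x z.2))
  + rho z.1 z.2 false * rho z.2 z.1 true * ((1 - x z.1) * x z.2).
Proof.
rewrite /pair_sum (bigD1 (false, false)) //= (bigD1 (true, false)) //=.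
by rewrite (bigD1 (false, true)) //= big1 ?addr0 ?addrA // => -[[] []].
Qed.

Lemma one_sub_le_expR (t : R) : 1 - t <= expR (- t).
Proof. exact: expR_ge1Dx. Qed.

Lemma card_Omega_le : #|Omega|%:R <= kappa.
Proof.
have W1 p : weight M (fun _ _ _ => 1 : R) p = 1.
  by rewrite /weight big1 // => z _; rewrite mulr1.
rewrite -sumr_const -(eq_bigr _ (fun p _ => W1 p)).
have lamE : lam / (lam + 0) = 1 by rewrite addr0 divff // gt_eqF //; move: lam1; lra.
have pl x z : (forall i, 0 <= x i <= 1) -> unmatched z ->
    pair_sum (fun _ _ _ => 1) x z <= expR (- (x z.1 * x z.2)) * 1.
  move=> _ _; rewrite pair_sumE !mul1r mulr1.
  by apply: le_trans (one_sub_le_expR _); lra.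
have range (i : 'I_n) : lam / 2 <= lam + 0 <= 2 * lam by rewrite addr0; move: lam1; lra.
have := @first_moment R n M matM n0 (fun _ _ _ => 1) (fun _ _ _ => ler01)
  (fun _ _ => 1) (fun _ _ _ => ler01) pl 1 0 (fun=> 0) (fun=> 0) ler01 (lexx 0) range range.
rewrite mul0r addr0 mul1r [X in kappa * X]big1 // mulr1; apply => x _.
rewrite big1 // (_ : \sum_i 0 * x i = 0) ?oppr0 ?expR0 ?mul0r ?mulr1 ?addr0 //.
by rewrite big1 // => i _; rewrite mul0r.
Qed.

Lemma card_le_sum (A : {set profile n}) (w : profile n -> R) :
  A \subset Omega -> (forall p, p \in Omega -> 0 <= w p) ->
  (forall p, p \in A -> 1 <= w p) -> #|A|%:R <= \sum_(p in Omega) w p.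
Proof.
move=> sA w0 w1; rewrite -sumr_const [leRHS](big_setID A) /= (setIidPr sA).
rewrite -[leLHS]addr0; apply: lerD; first exact: ler_sum.
by apply: sumr_ge0 => p /setDP[pO _]; exact: w0.
Qed.

Section Edges.
Variable E : {set 'I_n * 'I_n}.
Hypothesis E0 : (0 < #|E|)%N.
Local Notation r := (#|E|).

Let rho i j b : R := (((i, j) \in E) ==> b)%:R.
Let g x i j : R := if (i, j) \in E then expR 1 * x i else 1.
Let h x z : R := g x z.1 z.2 * g x z.2 z.1.
Let deg i := #|[set z in E | z.1 == i]|.
Let rR : 0 < r%:R :> R. Proof. by rewrite ltr0n. Qed.
Let lam0 : 0 < lam. Proof. exact: lt_le_trans lam1. Qed.

Let sum_deg (a : 'I_n -> R) : \sum_(z in E) a z.1 = \sum_i (deg i)%:R * a i.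
Proof.
rewrite (partition_big fst predT) //=; apply: eq_bigr => i _.
rewrite (eq_bigr (fun=> a i)) => [|z /andP[_ /eqP->]] //.
rewrite sumr_const mulr_natl; congr (_ *+ _); apply: eq_card => z.
by rewrite [RHS]inE.
Qed.

Let deg_le i : (deg i <= r)%N.
Proof. by apply/subset_leq_card/subsetP => z /setIdP[]. Qed.

(** Each prescribed acceptance [(i, j)] contributes a factor [expR 1 * x i] to the integrand, where
    [expR 1] makes up for the lost [exp (- x i * x j)]. Bounding [y] by [exp y] after scaling turns
    these factors into an exponential tilt, and every edge costs a factor of order [r / sqrt n]. *)
Lemma card_edges_le :
  #|[set p in Omega | [forall z in E, acc p z.1 z.2]]|%:R
  <= kappa * (expR 1 * (2 * expR 1 * r%:R / lam) ^+ r).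
Proof.
have k0 := kappa_ge0 R n0.
have e1 : 0 < expR 1 :> R := expR_gt0 _.
have c0 : 0 <= (2 * expR 1 * r%:R / lam) ^+ r :> R.
  by rewrite exprn_ge0 // divr_ge0 ?mulr_ge0 // ltW.
have [bad|good] := boolP [exists z in E, (z.1 == z.2) || (M z.1 == z.2)].
  have [z zE zb] := exists_inP bad.
  rewrite (_ : [set p in _ | _] = set0) ?cards0; last first.
    apply/setP => p; rewrite in_set0; apply/setIdP => -[pO /forall_inP/(_ z zE)].
    by case/orP: zb => /eqP <-; rewrite ?(acc_irr pO) ?acc_match.
  by rewrite mulr_ge0 ?k0 // mulr_ge0 ?expR_ge0 ?c0.
have {}good z : z \in E -> (z.1 != z.2) && (M z.1 != z.2).
  move=> zE; have := exists_inPn good z zE; by rewrite negb_or.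
have rho0 i j b : 0 <= rho i j b by rewrite ler0n.
have h0 x z : (forall i, 0 <= x i <= 1) -> 0 <= h x z.
  move=> x01; have g0 i j : 0 <= g x i j.
    by rewrite /g; case: ifP => _ //; rewrite mulr_ge0 ?expR_ge0 //; have /andP[] := x01 i.
  by rewrite /h mulr_ge0 ?g0.
have pair_le x z : (forall i, 0 <= x i <= 1) -> unmatched z ->
    pair_sum rho x z <= expR (- (x z.1 * x z.2)) * h x z.
  move=> x01 _; rewrite pair_sumE /h /g /rho.
  have /andP[a0 a1] := x01 z.1; have /andP[b0 b1] := x01 z.2.
  set a := x z.1 in a0 a1 *; set b := x z.2 in b0 b1 *.
  have ee : 1 <= expR (- (a * b)) * expR 1.
    rewrite -expRD; apply: le_trans (expR_ge1Dx _); have : a * b <= 1 * 1 by rewrite ler_pM.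
    lra.
  have ab := one_sub_le_expR (a * b); have ab0 := expR_ge0 (- (a * b)).
  case: ((z.1, z.2) \in E); case: ((z.2, z.1) \in E) => /=; rewrite ?mul0r ?mul1r ?mulr1 ?mulr0 ?add0r
    ?addr0 ?mulr0n ?mulr1n ?mul0r ?mul1r ?mulr1 ?mulr0 ?add0r ?addr0.
  - by rewrite !mulr_ge0 // ltW.
  - rewrite mulrA; apply: (@le_trans _ _ (1 * a)); last by rewrite ler_wpM2r.
    nra.
  - rewrite mulrA; apply: (@le_trans _ _ (1 * b)); last by rewrite ler_wpM2r.
    nra.
  - by apply: le_trans ab; lra.
(* The tilt is shared in proportion to the number of edges leaving [i], with total 1/2: so
   [lam - lam * th i >= lam / 2], and the product of the normalizations is at most [expR 1]. *)
pose th i : R := (deg i)%:R / (2 * r%:R).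
have th01 i : 0 <= th i <= 2^-1.
  rewrite /th divr_ge0 ?mulr_ge0 ?ler0n //= ler_pdivrMr ?mulr_gt0 //.
  by rewrite (_ : 2^-1 * (2 * r%:R) = r%:R) ?ler_nat ?deg_le //; lra.
have sum_th : \sum_i th i = 2^-1.
  rewrite /th -mulr_suml (eq_bigr (fun i => (deg i)%:R * 1)) => [|i _]; last by rewrite mulr1.
  rewrite -(sum_deg (fun=> 1)) sumr_const.
  by rewrite invfM mulrCA mulfV ?mulr1 // gt_eqF.
have rng i : lam / 2 <= lam + - (lam * th i) <= 2 * lam.
  have /andP[t0 t1] := th01 i.
  have : 0 <= lam * th i <= lam * 2^-1 by rewrite mulr_ge0 ?(ltW lam0) //= ler_wpM2l // ltW.
  by move: lam0; lra.
have inv_th i : lam / (lam + - (lam * th i)) <= expR (2 * th i).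
  have /andP[t0 t1] := th01 i; have d0 : 0 < 1 - th i by lra.
  have -> : lam / (lam + - (lam * th i)) = (1 - th i)^-1.
    have -> : lam + - (lam * th i) = lam * (1 - th i) by ring.
    by rewrite invfM mulrA divff ?mul1r // gt_eqF.
  rewrite -[expR _]invrK lef_pV2 ?posrE ?invr_gt0 ?expR_gt0 //.
  rewrite -expRN; apply: le_trans (expRN_le_inv _) _; first by rewrite mulr_ge0.
  have q : 0 <= th i * (2^-1 - th i) by rewrite mulr_ge0 // subr_ge0.
  by rewrite -[leLHS]mul1r ler_pdivrMr; lra.
have Wle : #|[set p in Omega | [forall z in E, acc p z.1 z.2]]|%:R
    <= \sum_(p in Omega) weight M rho p.
  apply: card_le_sum => [|p _|p /setIdP[pO /forall_inP pE]].
  - by apply/subsetP => p /setIdP[].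
  - by apply: prodr_ge0 => z _; rewrite mulr_ge0.
  rewrite /weight big1 // => z _; rewrite /rho.
  have accT i j : (((i, j) \in E) ==> acc p i j) = true by apply/implyP => /pE.
  by rewrite !accT mulr1.
have hle x : (forall i, 0 <= x i <= 1) -> \prod_(z | unmatched z) h x z <=
    (2 * expR 1 * r%:R / lam) ^+ r * expR (- \sum_i - (lam * th i) * x i)
    + 0 * expR (- \sum_i 0 * x i).
  move=> x01; rewrite mul0r addr0.
  have -> : \prod_(z | unmatched z) h x z = \prod_(z in E) (expR 1 * x z.1).
    rewrite -(big_unmatched matM _ (g x)) pair_big_dep /= /g.
    rewrite (bigID (mem E)) /= [X in _ * X]big1 ?mulr1; last first.
      by move=> -[i j] /= /andP[_ /negPf->].
    apply: eq_big => [z|[i j] /andP[_ ->]] //.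
    by apply/andb_idl => /good.
  have term (y : R) : 0 <= y -> expR 1 * y <=
      2 * expR 1 * r%:R / lam * expR (lam / (2 * r%:R) * y).
    move=> y0; have := expR_ge1Dx (lam / (2 * r%:R) * y) => q.
    have q2 : lam / (2 * r%:R) * y <= expR (lam / (2 * r%:R) * y) by lra.
    have q3 : 0 <= 2 * expR 1 * r%:R / lam :> R by rewrite divr_ge0 ?mulr_ge0 // ltW.
    apply: le_trans (ler_wpM2l q3 q2).
    rewrite le_eqVlt; apply/orP; left; apply/eqP; field.
    by rewrite !gt_eqF.
  apply: (@le_trans _ _ (\prod_(z in E) (2 * expR 1 * r%:R / lam * expR (lam / (2 * r%:R) * x z.1)))).
    apply: ler_prod => z _; have /andP[y0 _] := x01 z.1; rewrite term // andbT.
    by rewrite mulr_ge0 // ltW.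
  rewrite big_split /= prodr_const -expR_sum ler_wpM2l // ler_expR.
  rewrite (sum_deg (fun i => lam / (2 * r%:R) * x i)) -sumrN; apply: ler_sum => i _.
  by rewrite /th !mulNr opprK le_eqVlt; apply/orP; left; apply/eqP; ring.
have rng0 i : lam / 2 <= lam + 0 <= 2 * lam by rewrite addr0; move: lam0; lra.
have := @first_moment R n M matM n0 rho rho0 h h0 pair_le _ 0
  (fun i => - (lam * th i)) (fun=> 0) c0 (lexx 0) rng rng0 hle.
move=> main; apply: le_trans Wle _; apply: le_trans main _.
rewrite mul0r addr0 ler_wpM2l // [leRHS]mulrC ler_wpM2l //.
apply: (@le_trans _ _ (\prod_i expR (2 * th i))).
  apply: ler_prod => i _; rewrite inv_th andbT divr_ge0 ?(ltW lam0) //.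
  by have /andP[q _] := rng i; apply: le_trans q; rewrite divr_ge0 ?(ltW lam0).
by rewrite -expR_sum -mulr_sumr sum_th divff ?pnatr_eq0.
Qed.
End Edges.

Section FewSuitors.
Variable i0 : 'I_n.
Hypothesis lam3 : 3 <= lam.

Let rho i j b : R := if (j == i0) && b then 2^-1 else 1.
Let g x i j : R := if j == i0 then expR (- (x i * (1 - x j) / 2)) else 1.
Let h x z : R := g x z.1 z.2 * g x z.2 z.1.
Let far i := (i != i0) && (M i != i0).

Let card_far : #|far| = (n - 2)%N.
Proof.
have := cardD1 (M i0) (predC1 i0); rewrite cardC1 card_ord inE /= match_neq // => E.
have arith a b : (a.-1 = 1 + b -> b = a - 2)%N by lia.
rewrite -(arith _ _ E); apply: eq_card => i; rewrite !inE -topredE /= /far.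
by rewrite (match_eq matM) andbC.
Qed.

Let pair_le x z : (forall i, 0 <= x i <= 1) -> unmatched z ->
  pair_sum rho x z <= expR (- (x z.1 * x z.2)) * h x z.
Proof.
move=> x01 /andP[lt12 _]; rewrite pair_sumE /h /g /rho !andbF !andbT.
have /andP[a0 a1] := x01 z.1; have /andP[b0 b1] := x01 z.2.
set a := x z.1 in a0 a1 *; set b := x z.2 in b0 b1 *.
have [E2|E2] := eqVneq z.2 i0.
  have -> : (z.1 == i0) = false by rewrite -E2 -val_eqE; apply/negbTE; rewrite neq_ltn lt12.
  rewrite [expR _ * 1]mulr1 -expRD -opprD; apply: le_trans (one_sub_le_expR _).
  by lra.
have [E1|E1] := eqVneq z.1 i0.
  rewrite [1 * expR _]mul1r -expRD -opprD; apply: le_trans (one_sub_le_expR _); lra.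
by rewrite !mulr1; apply: le_trans (one_sub_le_expR _); lra.
Qed.

(** Every suitor of [i0] outside [M i0] halves the weight, whence the factor [2 ^+ d]. If
    [x i0 <= 1/2], the integrand gains a tilt 1/4 in nearly all coordinates; the case [x i0 > 1/2]
    is itself exponentially rare and is paid for by a tilt of coordinate [i0] alone. These are the
    two terms of [first_moment]. *)
Lemma card_few_suitors d :
  #|[set p in Omega | (#|suitors M p i0| <= d)%N]|%:R
  <= 2 ^+ d * (kappa * (3 * expR (- (lam / 6)))).
Proof.
have lam0 : 0 < lam by move: lam3; lra.
pose mu1 i : R := if far i then 4^-1 else 0.
pose mu2 i : R := if i == i0 then - (lam / 2) else 0.
have rho0 i j b : 0 <= rho i j b by rewrite /rho; case: ifP => _ //; rewrite invr_ge0.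
have h0 x z : (forall i, 0 <= x i <= 1) -> 0 <= h x z.
  by move=> _; rewrite /h mulr_ge0 // /g; case: ifP; rewrite ?expR_ge0.
have r1 i : lam / 2 <= lam + mu1 i <= 2 * lam.
  by rewrite /mu1; case: ifP => _; move: lam3; lra.
have r2 i : lam / 2 <= lam + mu2 i <= 2 * lam.
  by rewrite /mu2; case: ifP => _; move: lam3; lra.
have hle x : (forall i, 0 <= x i <= 1) -> \prod_(z | unmatched z) h x z <=
    1 * expR (- \sum_i mu1 i * x i) + expR (- (lam / 4)) * expR (- \sum_i mu2 i * x i).
  move=> x01; have -> : \prod_(z | unmatched z) h x z =
      expR (- ((1 - x i0) / 2 * \sum_(i | far i) x i)).
    rewrite -(big_unmatched matM _ (g x)) mulr_sumr -sumrN expR_sum [RHS]big_mkcond.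
    apply: eq_bigr => i _; rewrite /g.
    have [fi|fi] := boolP (far i).
      rewrite (bigD1 i0) //= eqxx big1 => [|j /andP[_ /negPf->]] //.
      by rewrite mulr1; congr expR; lra.
    rewrite big1 // => j ij; have [Ej|//] := eqVneq j i0.
    by move: ij fi; rewrite /far Ej => ->.
  have S0 : 0 <= \sum_(i | far i) x i.
    by apply: sumr_ge0 => i _; have /andP[] := x01 i.
  have -> : \sum_i mu1 i * x i = 4^-1 * \sum_(i | far i) x i.
    rewrite mulr_sumr [RHS]big_mkcond; apply: eq_bigr => i _; rewrite /mu1.
    by case: ifP => _; rewrite ?mul0r.
  have -> : \sum_i mu2 i * x i = - (lam / 2) * x i0.
    rewrite (bigD1 i0) //= [X in _ + X]big1 => [|i /negPf ii].
      by rewrite /mu2 eqxx addr0.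
    by rewrite /mu2 ii mul0r.
  have /andP[a0 a1] := x01 i0; set S := \sum_(i | far i) x i in S0 *.
  rewrite mul1r -expRD; have [small|large] := lerP (x i0) 2^-1.
    rewrite -[leLHS]addr0 lerD ?expR_ge0 // ler_expR lerN2.
    by rewrite ler_wpM2r //; lra.
  rewrite -[leLHS]add0r lerD ?expR_ge0 // ler_expR.
  have : 0 <= (1 - x i0) / 2 * S by rewrite mulr_ge0 //; lra.
  have : 0 <= lam * (x i0 - 2^-1) by rewrite mulr_ge0 ?ltW // subr_gt0.
  by lra.
have e0 : 0 <= expR (- (lam / 4)) :> R by exact: expR_ge0.
have := @first_moment R n M matM n0 rho rho0 h h0 pair_le 1 _ mu1 mu2 ler01 e0 r1 r2 hle.
have k0 := kappa_ge0 R n0.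
have P2 : \prod_i (lam / (lam + mu2 i)) = 2.
  rewrite (bigD1 i0) //= big1 => [|i /negPf ii].
    by rewrite /mu2 eqxx mulr1; field; rewrite !gt_eqF //; lra.
  by rewrite /mu2 ii addr0 divff // gt_eqF.
have P1 : \prod_i (lam / (lam + mu1 i)) <= expR (- (lam / 6)).
  apply: (@le_trans _ _ (\prod_(i | far i) expR (- (4^-1 / (lam + 4^-1))))).
    rewrite [leRHS]big_mkcond; apply: ler_prod => i _; rewrite /mu1; case: ifP => _.
      rewrite divr_ge0 ?(ltW lam0) //=; last by lra.
      apply: le_trans (one_sub_le_expR _); rewrite le_eqVlt; apply/orP; left; apply/eqP.
      by field; rewrite gt_eqF //; lra.
    by rewrite addr0 divff ?gt_eqF // lexx ler01.
  rewrite prodr_const card_far -expRM_natr ler_expR mulNr lerN2.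
  have n2 : lam ^+ 2 - 2 <= (n - 2)%:R.
    by rewrite sqrtn2 lerBlDr -natrD ler_nat; lia.
  have -> : 4^-1 / (lam + 4^-1) = (4 * lam + 1)^-1 by field; rewrite !gt_eqF //; lra.
  rewrite [_ * (n - 2)%:R]mulrC ler_pdivlMr; last by lra.
  apply: le_trans n2; move: lam3; nra.
have e46 : expR (- (lam / 4)) <= expR (- (lam / 6)) by rewrite ler_expR; lra.
rewrite mul1r P2 => main.
have tot : \sum_(p in Omega) weight M rho p <= kappa * (3 * expR (- (lam / 6))).
  by apply: le_trans main _; rewrite ler_wpM2l //; lra.
have d0 : 0 <= 2 ^+ d :> R by rewrite exprn_ge0.
apply: le_trans (ler_wpM2l d0 tot); rewrite mulr_sumr.
apply: card_le_sum => [|p pO|p /setIdP[pO sd]].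
- by apply/subsetP => p /setIdP[].
- by rewrite mulr_ge0 // prodr_ge0 // => z _; rewrite mulr_ge0.
have -> : weight M rho p = 2^-1 ^+ #|[pred i | far i && acc p i i0]|.
  rewrite /weight -(big_unmatched matM _ (fun i j => rho i j (acc p i j))).
  rewrite -prodr_const [RHS]big_mkcond; apply: eq_bigr => i _; rewrite /rho inE.
  have [fi|fi] := boolP (far i).
    rewrite (bigD1 i0) //= eqxx big1 => [|j /andP[_ /negPf->]] //.
    by rewrite mulr1.
  rewrite big1 // => j ij; have [Ej|//] := eqVneq j i0.
  by move: ij fi; rewrite /far Ej => ->.
rewrite exprVn -[leRHS]/(_ / _) ler_pdivlMr ?exprn_gt0 // mul1r.
rewrite ler_weXn2l ?ler1n //; apply: leq_trans sd.
by apply/subset_leq_card/subsetP => i; rewrite !inE => /andP[].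
Qed.
End FewSuitors.
End Planted.

(** * Irregular profiles are rare *)

Section Irregular.
Variables (R : realType) (n : nat) (M : {ffun 'I_n -> 'I_n}) (d D m : nat).
Hypothesis matM : matching M.
Hypothesis n0 : (0 < n)%N.
Hypothesis m0 : (0 < m)%N.
Hypothesis mD : (m <= D)%N.
Implicit Types (p : profile n) (i j k : 'I_n).
Local Notation Omega := (Omega M).
Local Notation acc := (acc M).
Local Notation lam := (sqrtn R n).
Local Notation kappa := (kappa R n).
Local Open Scope ring_scope.

(** The constant of [card_edges_le] for [2 * m] edges, without the power of [lam]. *)
Definition edge_const : R := expR 1 * (4 * expR 1 * m%:R) ^+ (2 * m).

Let lam0 : 0 < lam. Proof. exact: lt_le_trans (sqrtn_ge1 R n0). Qed.

Section TwoEdges.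
Variables e1 e2 : 'I_n -> 'I_n * 'I_n.
Hypothesis inj1 : injective e1.
Hypothesis inj2 : injective e2.
Let X p := [set k | acc p (e1 k).1 (e1 k).2 && acc p (e2 k).1 (e2 k).2].
Hypothesis dis : forall p k k', p \in Omega -> k \in X p -> k' \in X p -> e1 k != e2 k'.

Let edges (J : {set 'I_n}) := e1 @: J :|: e2 @: J.

Let card_edges p (J : {set 'I_n}) : p \in Omega -> J \subset X p -> #|edges J| = (2 * #|J|)%N.
Proof.
move=> pO JX; rewrite cardsU !card_imset //.
rewrite (_ : _ :&: _ = set0) ?cards0 ?subn0 ?addnn ?mul2n //.
apply/setP => z; rewrite !inE; apply/andP => -[/imsetP[k kJ ->] /imsetP[k' k'J E]].
have := dis pO (subsetP JX _ kJ) (subsetP JX _ k'J).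
by rewrite E eqxx.
Qed.

(** An [m]-th binomial moment of [#|X p|]: an [m]-subset of [X p] prescribes [2 * m] distinct
    acceptances, of probability [O(n ^ -m)], which cancels the number of [m]-subsets. Any fixed
    power of [D] can thus be gained. *)
Lemma card_two_edges_gt :
  #|[set p in Omega | (D < #|X p|)%N]|%:R * ((D.+1 - m) ^ m)%:R <= kappa * edge_const.
Proof.
set Bad := [set p in _ | _]; have k0 := kappa_ge0 R n0.
have e1R : 0 < expR 1 :> R := expR_gt0 _.
pose sub p (J : {set 'I_n}) := (J \subset X p) && (#|J| == m).
have count : (#|Bad| * 'C(D.+1, m) <= \sum_(J : {set 'I_n} | #|J| == m)
    #|[set p in Omega | J \subset X p]|)%N.
  apply: (@leq_trans (\sum_(p in Omega) #|[set J | sub p J]|)).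
    rewrite -sum_nat_const [leqRHS](big_setID Bad) /=.
    have -> : Omega :&: Bad = Bad by apply/setIidPr/subsetP => p /setIdP[].
    apply: leq_trans (leq_addr _ _); apply: leq_sum => p /setIdP[pO Dp].
    by rewrite cards_draws leq_bin2l.
  rewrite card_exchange big_mkcond [leqRHS]big_mkcond /=; apply: leq_sum => J _.
  case: eqP => Jm; first by apply/subset_leq_card/subsetP => p /setIdP[pO /andP[h _]]; apply/setIdP.
  by rewrite leqn0 cards_eq0; apply/eqP/setP => p; rewrite in_set0; apply/setIdP => -[_ /andP[_ /eqP]].
have each (J : {set 'I_n}) : #|J| = m -> #|[set p in Omega | J \subset X p]|%:R <=
    kappa * (edge_const / lam ^+ (2 * m)).
  move=> Jm; have [->|[p /setIdP[pO JX]]] := set_0Vmem [set p in Omega | J \subset X p].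
    rewrite cards0 mulr_ge0 // divr_ge0 ?exprn_ge0 ?(ltW lam0) //.
    by rewrite mulr_ge0 ?exprn_ge0 ?mulr_ge0 // ltW.
  have cE := card_edges pO JX; rewrite Jm in cE.
  have E0 : (0 < #|edges J|)%N by rewrite cE muln_gt0.
  have le1 := card_edges_le R matM n0 E0; rewrite cE in le1.
  apply: le_trans (_ : #|[set p in Omega | [forall z in edges J, acc p z.1 z.2]]|%:R <= _).
    rewrite ler_nat; apply/subset_leq_card/subsetP => p' /setIdP[p'O JX']; apply/setIdP.
    split=> //; apply/forall_inP => z /setUP[] /imsetP[k kJ ->].
      by have := subsetP JX' _ kJ; rewrite inE => /andP[].
    by have := subsetP JX' _ kJ; rewrite inE => /andP[].
  apply: le_trans le1 _; rewrite le_eqVlt; apply/orP; left; apply/eqP; congr (_ * _).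
  rewrite /edge_const -[RHS]mulrA -expr_div_n; congr (_ * _ ^+ _).
  by rewrite natrM; field; rewrite gt_eqF.
have total : (#|Bad| * 'C(D.+1, m))%N%:R <= 'C(n, m)%:R * (kappa * (edge_const / lam ^+ (2 * m))).
  apply: (@le_trans _ _ (\sum_(J : {set 'I_n} | #|J| == m)
    #|[set p in Omega | J \subset X p]|%:R)); first by rewrite -natr_sum ler_nat.
  apply: le_trans (ler_sum _ (fun J JP => each J (eqP JP))) _.
  rewrite sumr_const -[leLHS]mulr_natl le_eqVlt; apply/orP; left; apply/eqP.
  congr (_%:R * _); rewrite -[in RHS](card_ord n) -cardsT -cards_draws.
  by apply: eq_card => J; rewrite inE subsetT.
have mf : 0 < m`!%:R :> R by rewrite ltr0n fact_gt0.
have low : ((D.+1 - m) ^ m <= D.+1 ^_ m)%N.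
  case: (m) m0 mD => // m' _ m'D; rewrite subSS; apply: exp_le_ffact; exact: ltnW.
have up : (n ^_ m)%:R <= lam ^+ (2 * m).
  by rewrite exprM sqrtn2 -natrX ler_nat ffact_le_exp.
have c0 : 0 <= edge_const by rewrite mulr_ge0 ?exprn_ge0 ?mulr_ge0 // ltW.
apply: (@le_trans _ _ ((#|Bad| * 'C(D.+1, m))%N%:R * m`!%:R)).
  by rewrite -!natrM ler_nat -mulnA bin_ffact leq_mul2l low orbT.
apply: le_trans (ler_wpM2r (ltW mf) total) _.
rewrite mulrAC -natrM bin_ffact mulrCA ler_wpM2l //.
rewrite mulrCA -[leRHS]mulr1 ler_wpM2l // ler_pdivrMr ?mul1r //.
by rewrite exprn_gt0.
Qed.
End TwoEdges.

(** Each overlap in [regular] is a set of people [k] subject to two acceptances, hence of the form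
    treated in [card_two_edges_gt]; the rest is a union bound over people and pairs of people. *)
Lemma card_irregular : 3 <= lam ->
  #|Omega :\: Reg M d D|%:R <= kappa *
    (n%:R * (2 ^+ d * (3 * expR (- (lam / 6))))
     + 3 * n%:R ^+ 2 * (edge_const / ((D.+1 - m) ^ m)%:R)).
Proof.
move=> lam3; set w := ((D.+1 - m) ^ m)%:R.
have w0 : 0 < w by rewrite ltr0n expn_gt0 subn_gt0 ltnS mD.
have k0 := kappa_ge0 R n0.
pose B0 := [set p in Omega | [exists i, (#|suitors M p i| <= d)%N]].
pose X1 (z : 'I_n * 'I_n) p := [set k | acc p k z.1 && acc p z.2 k].
pose X2 (z : 'I_n * 'I_n) p := [set k | acc p k z.1 && acc p (M k) z.2].
pose X3 (z : 'I_n * 'I_n) p := [set k | acc p k z.1 && acc p z.2 (M k)].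
pose B1 := [set p in Omega | [exists z, (D < #|X1 z p|)%N]].
pose B2 := [set p in Omega | [exists z, (z.1 != z.2) && (D < #|X2 z p|)%N]].
pose B3 := [set p in Omega | [exists z, (D < #|X3 z p|)%N]].
have sub : Omega :\: Reg M d D \subset B0 :|: (B1 :|: (B2 :|: B3)).
  apply/subsetP => p /setDP[pO nR]; have {nR} : ~~ regular M d D p.
    by apply: contra nR => h; apply/setIdP.
  case/forallPn => i /forallPn[j]; rewrite !negb_and !negb_imply -!ltnNge ltnS.
  have imM (A : {set 'I_n}) k : (k \in M @: A) = (M k \in A).
    apply/imsetP/idP => [[x xA ->]|h]; first by rewrite matchK.
    by exists (M k); rewrite ?matchK.
  case/or4P=> [h|/andP[_ h]|/andP[ij h]|h]; rewrite !in_setU.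
  - by apply/or4P; constructor 1; apply/setIdP; split=> //; apply/existsP; exists i.
  - apply/or4P; constructor 2; apply/setIdP; split=> //; apply/existsP; exists (i, j).
    apply: leq_trans h _; apply/subset_leq_card/subsetP => k.
    by rewrite !inE.
  - apply/or4P; constructor 3; apply/setIdP; split=> //; apply/existsP; exists (i, j).
    rewrite ij; apply: leq_trans h _; apply/subset_leq_card/subsetP => k.
    by rewrite in_setI imM !inE.
  - apply/or4P; constructor 4; apply/setIdP; split=> //; apply/existsP; exists (i, j).
    apply: leq_trans h _; apply/subset_leq_card/subsetP => k.
    by rewrite in_setI imM !inE.
have b0 : #|B0|%:R <= kappa * (n%:R * (2 ^+ d * (3 * expR (- (lam / 6))))).
  apply: le_trans (_ : (\sum_i #|[set p in Omega | (#|suitors M p i| <= d)%N]|)%:R <= _).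
    by rewrite ler_nat card_exists_le.
  rewrite natr_sum; apply: le_trans (ler_sum _ (fun i _ => card_few_suitors matM n0 i lam3 d)) _.
  by rewrite sumr_const card_ord -[leLHS]mulr_natl le_eqVlt; apply/orP; left; apply/eqP; ring.
have cod (B : {set profile n}) (P : 'I_n * 'I_n -> pred (profile n)) :
    B = [set p in Omega | [exists z, P z p]] ->
    (forall z, #|[set p in Omega | P z p]|%:R * w <= kappa * edge_const) ->
    #|B|%:R <= kappa * (n%:R ^+ 2 * (edge_const / w)).
  move=> -> hz; apply: le_trans (_ : (\sum_z #|[set p in Omega | P z p]|)%:R <= _).
    by rewrite ler_nat (card_exists_le Omega (fun p z => P z p)).
  rewrite natr_sum; apply: (@le_trans _ _ (\sum_(z : 'I_n * 'I_n) kappa * edge_const / w)).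
    by apply: ler_sum => z _; rewrite ler_pdivlMr.
  rewrite sumr_const card_prod !card_ord -[leLHS]mulr_natl natrM -expr2.
  by rewrite le_eqVlt; apply/orP; left; apply/eqP; ring.
have ec0 : 0 <= edge_const.
  by rewrite mulr_ge0 ?exprn_ge0 ?mulr_ge0 ?expR_ge0.
have b1 : #|B1|%:R <= kappa * (n%:R ^+ 2 * (edge_const / w)).
  apply: cod (erefl _) _ => -[i j].
  apply: (@card_two_edges_gt (fun k => (k, i)) (fun k => (j, k))).
  - by move=> a b [].
  - by move=> a b [].
  move=> p k k' pO; rewrite !inE /= => /andP[h1 h2] _; rewrite xpair_eqE.
  by apply/negP => /andP[/eqP kj _]; move: h2; rewrite kj (acc_irr pO).
have b2 : #|B2|%:R <= kappa * (n%:R ^+ 2 * (edge_const / w)).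
  apply: cod (erefl _) _ => -[i j] /=; have [->|ij] := eqVneq i j.
    rewrite (_ : #|_|%:R = 0) ?mul0r ?(mulr_ge0 k0 ec0) //.
    by apply/eqP; rewrite pnatr_eq0 cards_eq0; apply/eqP/setP => p; rewrite !inE andbF.
  rewrite /=.
  apply: (@card_two_edges_gt (fun k => (k, i)) (fun k => (M k, j))).
  - by move=> a b [].
  - by move=> a b [/match_inj]; apply.
  by move=> p k k' pO _ _; rewrite xpair_eqE (negPf ij) andbF.
have b3 : #|B3|%:R <= kappa * (n%:R ^+ 2 * (edge_const / w)).
  apply: cod (erefl _) _ => -[i j].
  apply: (@card_two_edges_gt (fun k => (k, i)) (fun k => (j, M k))).
  - by move=> a b [].
  - by move=> a b [/match_inj]; apply.
  move=> p k k' pO; rewrite !inE /= => /andP[h1 h2] _; rewrite xpair_eqE.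
  by apply/negP => /andP[/eqP kj _]; move: h2; rewrite kj acc_match.
have le1 : (#|Omega :\: Reg M d D| <= #|B0| + (#|B1| + (#|B2| + #|B3|)))%N.
  apply: leq_trans (subset_leq_card sub) _.
  by do 2!(apply: leq_trans (leq_card_setU _ _) _; rewrite leq_add2l); apply: leq_card_setU.
rewrite -(ler_nat R) !natrD in le1; apply: le_trans le1 _.
rewrite mulrDr; set t := n%:R ^+ 2 * _ in b1 b2 b3.
have -> : 3 * n%:R ^+ 2 * (edge_const / w) = t + (t + t) by rewrite /t; ring.
by rewrite !mulrDr; do 3?apply: lerD.
Qed.
End Irregular.

(** * The number of matchings *)

Section CountMatchings.

(** The double factorial [(2 h - 1)!!]. *)
Definition odd_fact h : nat := \prod_(k < h) (2 * k).+1.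

(** Extending by the identity outside [S] keeps all pairings in one function type, so a pair can be
    removed from [S] in the induction. *)
Definition pairings (T : finType) (S : {set T}) : {set {ffun T -> T}} :=
  [set f : {ffun T -> T} | [forall x, if x \in S
     then [&& f x \in S, f x != x & f (f x) == x] else f x == x]].

Lemma card_pairings (T : finType) (S : {set T}) h : #|S| = 2 * h ->
  #|pairings S| <= odd_fact h.
Proof.
elim: h S => [|h IH] S cS.
  rewrite /odd_fact big_ord0; have S0 : S = set0 by apply: cards0_eq; rewrite cS.
  rewrite -(cards1 [ffun x : T => x]); apply/subset_leq_card/subsetP => f.
  rewrite inE => /forallP fP; rewrite inE; apply/eqP/ffunP => x.
  by have := fP x; rewrite S0 inE ffunE => /eqP.
have [x0 x0S] : exists x, x \in S by apply/card_gt0P; rewrite cS.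
have fiber y : y \in S :\ x0 ->
    #|[set f in pairings S | f x0 == y]| <= odd_fact h.
  rewrite in_setD1 => /andP[yx yS].
  have cS' : #|S :\ x0 :\ y| = 2 * h.
    have := cardsD1 x0 S; have := cardsD1 y (S :\ x0).
    by rewrite in_setD1 yx yS x0S cS; lia.
  pose F (f : {ffun T -> T}) := [ffun x => if (x == x0) || (x == y) then x else f x].
  apply: leq_trans (IH _ cS'); rewrite -(card_in_imset (f := F)).
    apply/subset_leq_card/subsetP => g /imsetP[f /setIdP[]]; rewrite inE => /forallP fP /eqP fx ->.
    have fy : f y = x0.
      by have := fP x0; rewrite x0S fx => /and3P[_ _ /eqP].
    rewrite inE; apply/forallP => x; rewrite !inE !ffunE.
    have [->|xx] := eqVneq x x0; first by rewrite andbF.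
    have [->|xy] := eqVneq x y; first by rewrite /=.
    rewrite /=; have := fP x; case: ifP => // xS /and3P[h1 h2 h3].
    have n1 : f x != x0.
      by apply: contraNneq xy => E; rewrite -(eqP h3) E fx.
    have n2 : f x != y.
      by apply: contraNneq xx => E; rewrite -(eqP h3) E fy.
    by rewrite (negPf n1) (negPf n2) /= h1 h2.
  move=> f g /setIdP[]; rewrite inE => /forallP fP /eqP fx /setIdP[].
  rewrite inE => /forallP gP /eqP gx /ffunP E.
  have fy : f y = x0 by have := fP x0; rewrite x0S fx => /and3P[_ _ /eqP].
  have gy : g y = x0 by have := gP x0; rewrite x0S gx => /and3P[_ _ /eqP].
  apply/ffunP => x; have := E x; rewrite !ffunE.
  have [->|xx] := eqVneq x x0; first by rewrite fx gx.
  by have [->|xy] := eqVneq x y; first by rewrite fy gy.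
have cover : #|pairings S| <= \sum_(y in S :\ x0) #|[set f in pairings S | f x0 == y]|.
  rewrite -sum1_card (partition_big (fun f : {ffun T -> T} => f x0) (mem (S :\ x0))) /=.
    apply: leq_sum => y _; rewrite sum1_card leq_eqVlt; apply/orP; left; apply/eqP.
    by apply: eq_card => f; rewrite [RHS]inE.
  move=> f; rewrite inE => /forallP/(_ x0); rewrite x0S => /and3P[h1 h2 _].
  by rewrite in_setD1 h1 h2.
apply: leq_trans cover _; apply: leq_trans (leq_sum _ fiber) _.
rewrite sum_nat_const /odd_fact big_ord_recr /= mulnC leq_mul2l; apply/orP; right.
by have := cardsD1 x0 S; rewrite x0S cS; lia.
Qed.

Lemma card_matchings n h : n = 2 * h ->
  #|[set M : {ffun 'I_n -> 'I_n} | matching M]| <= odd_fact h.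
Proof.
move=> nh; have cT : #|[set: 'I_n]| = 2 * h by rewrite cardsT card_ord.
apply: leq_trans (card_pairings cT); apply/subset_leq_card/subsetP => M; rewrite !inE => /forallP mM.
by apply/forallP => x; rewrite !inE mM.
Qed.


Variable R : realType.
Local Open Scope ring_scope.

(** With [F t = (1 + t) / (1 - t)] one has [F (t / 2) ^ 2 <= F t]. After [k] halvings the estimate
    [F w >= exp (2 w - w ^ 2)] near 0 loses only [z ^ 2 / 2 ^ k] in the exponent, which tends to
    0. *)
Lemma expR_le_mobius (z : R) : 0 <= z < 1 -> expR (2 * z) <= (1 + z) / (1 - z).
Proof.
move=> /andP[z0 z1]; pose F (t : R) := (1 + t) / (1 - t).
have half t : 0 <= t < 1 -> F (t / 2) ^+ 2 <= F t.
  move=> /andP[t0 t1]; rewrite /F expr_div_n ler_pdivlMr ?subr_gt0 // mulrAC.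
  rewrite ler_pdivrMr ?exprn_gt0 ?subr_gt0 //; last by lra.
  have : 0 <= t ^+ 3 by rewrite exprn_ge0.
  have -> : t ^+ 3 = t * t * t by ring.
  lra.
have iter k : forall t, 0 <= t < 1 -> F (t / 2 ^+ k) ^+ (2 ^ k) <= F t.
  elim: k => [|k IH] t t01; first by rewrite expr0 divr1 expn0 expr1.
  have t2 : 0 <= t / 2 < 1 by lra.
  apply: le_trans (half t t01); rewrite exprS invfM mulrA expnSr exprM.
  apply: lerXn2r; rewrite ?nnegrE ?IH //.
    rewrite exprn_ge0 // divr_ge0 //.
      by rewrite addr_ge0 // !divr_ge0 ?exprn_ge0 //; lra.
    rewrite subr_ge0 ler_pdivrMr ?exprn_gt0 //.
    have : 1 <= 2 ^+ k :> R by rewrite exprn_ege1 //; lra.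
    lra.
  by rewrite divr_ge0 //; lra.
have low w : 0 <= w < 1 -> expR (2 * w - w ^+ 2) <= F w.
  move=> /andP[w0 w1]; have h1 := expR_ratio_le w0.
  have h2 : expR w <= (1 - w)^-1.
    rewrite -[expR w]invrK lef_pV2 ?posrE ?invr_gt0 ?expR_gt0 ?subr_gt0 //.
    by rewrite -expRN; exact: expR_ge1Dx.
  apply: le_trans (ler_pM (expR_ge0 _) (expR_ge0 _) h1 h2); rewrite -expRD ler_expR.
  have : w - w ^+ 2 <= w / (1 + w).
    rewrite ler_pdivlMr; last by lra.
    have : 0 <= w * w * w by rewrite !mulr_ge0.
    lra.
  lra.
have main k : expR (2 * z - z ^+ 2 / 2 ^+ k) <= F z.
  have z01 : 0 <= z < 1 by rewrite z0 z1.
  have p1 : 1 <= 2 ^+ k :> R by rewrite exprn_ege1 //; lra.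
  have p0 : 0 < 2 ^+ k :> R by lra.
  have w01 : 0 <= z / 2 ^+ k < 1.
    by rewrite divr_ge0 ?(ltW p0) //= ltr_pdivrMr //; lra.
  apply: le_trans (iter k z z01).
  have -> : 2 * z - z ^+ 2 / 2 ^+ k = (2 * (z / 2 ^+ k) - (z / 2 ^+ k) ^+ 2) * (2 ^ k)%:R.
    by rewrite natrX; field; rewrite gt_eqF.
  rewrite expRM_natr; apply: lerXn2r; rewrite ?nnegrE ?expR_ge0 ?low //.
  by case/andP: w01 => *; rewrite divr_ge0 //; lra.
rewrite -/(F z) leNgt; apply/negP => lt.
set e := expR (2 * z) in lt; pose del := e - F z.
have del0 : 0 < del by rewrite subr_gt0.
have [k hk] : exists k : nat, e * z ^+ 2 / del < k%:R.
  exists (Num.truncn (e * z ^+ 2 / del)).+1.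
  have q : 0 <= e * z ^+ 2 / del by rewrite divr_ge0 ?(ltW del0) // mulr_ge0 ?expR_ge0 ?exprn_ge0.
  by have /andP[] := Num.Theory.truncn_itv q.
have k2 : (k%:R : R) <= 2 ^+ k by rewrite -natrX ler_nat ltnW // ltn_expl.
have p0 : 0 < 2 ^+ k :> R by rewrite exprn_gt0.
have := main k; rewrite expRD -/e => mk.
have h1 := expR_ge1Dx (- (z ^+ 2 / 2 ^+ k)).
have e0 : 0 < e by exact: expR_gt0.
have h2 := ler_wpM2l (ltW e0) h1.
have h3 : e * z ^+ 2 < del * 2 ^+ k.
  by rewrite -ltr_pdivrMl // mulrC; apply: lt_le_trans hk k2.
have h4 : e * (z ^+ 2 / 2 ^+ k) < del by rewrite mulrA ltr_pdivrMr.
by move: h4; rewrite /del; lra.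
Qed.

(** A bound of Stirling type; the term [1 / (2 h)] in the exponent makes the induction close,
    through [expR_le_mobius] at [z = 1 / (2 h + 1)]. *)
Lemma odd_fact_le h : (0 < h)%N ->
  (odd_fact h)%:R * expR (h%:R + (2 * h%:R)^-1) <= (2 * h%:R) ^+ h * expR 2 :> R.
Proof.
elim: h => // -[|h] IH _.
  rewrite /odd_fact big_ord1 expr1 mulr1 mul1r.
  have e2 : expR (1 + 2^-1) <= expR 2 :> R by rewrite ler_expR; lra.
  by have := expR_ge0 (2 : R); lra.
have {}IH := IH isT; rewrite /odd_fact big_ord_recr /= -/(odd_fact h.+1) natrM.
set c : R := h.+1%:R in IH *; have c1 : 1 <= c by rewrite ler1n.
have -> : (2 * h.+1).+1%:R = 2 * c + 1 :> R by rewrite -natr1 natrM.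
have -> : h.+2%:R = c + 1 :> R by rewrite -natr1.
have z01 : 0 <= (2 * c + 1)^-1 < 1.
  by rewrite invr_ge0 invf_lt1; lra.
have mob := expR_le_mobius z01.
have mobE : (1 + (2 * c + 1)^-1) / (1 - (2 * c + 1)^-1) = (c + 1) / c :> R.
  by field; rewrite !gt_eqF //; lra.
rewrite mobE in mob.
have pw : expR (1 - (2 * c + 1)^-1) <= ((c + 1) / c) ^+ h.+1.
  have -> : 1 - (2 * c + 1)^-1 = 2 * (2 * c + 1)^-1 * c by field; rewrite gt_eqF //; lra.
  by rewrite /c expRM_natr; apply: lerXn2r; rewrite ?nnegrE ?expR_ge0 ?divr_ge0 //; lra.
have lo : (2 * c + 1) <= (2 * c + 2) * expR (- (2 * c + 2)^-1).
  have := expR_ge1Dx (- (2 * c + 2)^-1) => q.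
  have c20 : 0 <= 2 * c + 2 by lra.
  apply: le_trans (ler_wpM2l c20 q); rewrite le_eqVlt; apply/orP; left; apply/eqP.
  by field; rewrite gt_eqF //; lra.
have inv : (2 * c + 1)^-1 <= (2 * c)^-1 by rewrite lef_pV2 ?posrE; lra.
have split : expR (c + 1 + (2 * (c + 1))^-1) =
   expR (c + (2 * c)^-1) * expR (1 - (2 * c)^-1 + (2 * c + 2)^-1) :> R.
  have -> : 2 * (c + 1) = 2 * c + 2 by ring.
  rewrite -expRD; congr expR; move: (2 * c)^-1 (2 * c + 2)^-1 => a b; ring.
rewrite split.
have -> : (odd_fact h.+1)%:R * (2 * c + 1) * (expR (c + (2 * c)^-1) *
    expR (1 - (2 * c)^-1 + (2 * c + 2)^-1)) =
   (odd_fact h.+1)%:R * expR (c + (2 * c)^-1) *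
   ((2 * c + 1) * expR (1 - (2 * c)^-1 + (2 * c + 2)^-1)) :> R by ring.
have -> : (2 * (c + 1)) ^+ h.+2 * expR 2 =
  (2 * c) ^+ h.+1 * expR 2 * ((2 * c + 2) * ((c + 1) / c) ^+ h.+1) :> R.
  have -> : 2 * (c + 1) = 2 * c + 2 by ring.
  rewrite exprS; have -> : (2 * c + 2) ^+ h.+1 = (2 * c) ^+ h.+1 * ((c + 1) / c) ^+ h.+1.
    by rewrite -exprMn; congr (_ ^+ _); field; rewrite gt_eqF //; lra.
  by ring.
have o0 : 0 <= 2 * c + 1 by lra.
apply: ler_pM; rewrite ?mulr_ge0 ?expR_ge0 ?IH //.
apply: le_trans (ler_wpM2r (expR_ge0 _) lo) _.
rewrite -mulrA ler_wpM2l //; first by lra.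
rewrite -expRD; apply: le_trans pw; rewrite ler_expR; move: inv.
by move: (2 * c)^-1 (2 * c + 1)^-1 (2 * c + 2)^-1 => u v s; lra.
Qed.

(** The number of matchings is at most a constant times [(n / e) ^ (n / 2)], which cancels the
    factor [exp (n / 2) * n ^ (- n / 2)] of [kappa]. *)
Lemma sum_kappa_le n : (0 < n)%N -> ~~ odd n ->
  #|[set M : {ffun 'I_n -> 'I_n} | matching M]|%:R * kappa R n
  <= (n.-1)`!%:R ^+ n * (2 * expR 387).
Proof.
move=> n0 en; have nh : n = (2 * n./2)%N by rewrite mul2n -[LHS]odd_double_half (negPf en).
set h := n./2 in nh; have h0 : (0 < h)%N by move: n0; rewrite nh; lia.
have cM := card_matchings nh; rewrite -(ler_nat R) in cM.
apply: le_trans (ler_wpM2r (kappa_ge0 R n0) cM) _.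
have lamn : sqrtn R n ^+ n = (2 * h%:R) ^+ h.
  by rewrite {2}nh exprM sqrtn2 {1}nh natrM.
have nE : n%:R / 2 = h%:R :> R by rewrite nh natrM mulrC mulrA mulVf ?mul1r // pnatr_eq0.
rewrite /kappa nE lamn mulrCA ler_wpM2l ?exprn_ge0 //.
have H0 : 0 < (2 * h%:R) ^+ h :> R by rewrite exprn_gt0 // mulr_gt0 // ltr0n.
have := odd_fact_le h0; rewrite expRD => of1.
have of2 : (odd_fact h)%:R * expR h%:R <= (2 * h%:R) ^+ h * expR 2 :> R.
  apply: (le_trans _ of1); rewrite mulrA -[leLHS]mulr1 ler_wpM2l ?mulr_ge0 ?expR_ge0 //.
  by rewrite -[leLHS]expR0 ler_expR invr_ge0 mulr_ge0 ?ler0n.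
have -> : 387 = 2 + 385 :> R by rewrite -natrD.
rewrite [expR (2 + 385)]expRD !mulrA ler_pdivrMr //.
have e385 := expR_ge0 (385 : R).
have := ler_wpM2l (mulr_ge0 (ler0n R 2) e385) of2.
set e := expR 385; set e2 := expR 2; set H := (2 * h%:R) ^+ h; set eh := expR h%:R.
set o := (odd_fact h)%:R; lra.
Qed.
End CountMatchings.

(** * Asymptotics *)

Section StableProbability.
Variables (R : realType) (n : nat).
Local Open Scope ring_scope.
Local Notation tot := ((n.-1)`!%:R ^+ n : R).

Lemma Prob_stable_le :
  Prob R (fun p : profile n => (1 <= nb_stable_matchings p)%N) <=
  (\sum_(M in [set M : {ffun 'I_n -> 'I_n} | matching M])
     \sum_(p in Omega M) (nb_stable_matchings p)%:R^-1) / tot.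
Proof.
have tot0 : 0 < tot by rewrite exprn_gt0 // ltr0n fact_gt0.
rewrite (exchange_big_dep (fun p : profile n => [forall i, p i \in rankings i])) /=; last first.
  by move=> M p _; rewrite inE => /andP[].
rewrite mulr_suml /Prob [leLHS](bigID (fun p : profile n => [forall i, p i \in rankings i])) /=.
rewrite [X in _ + X]big1 ?addr0 => [|p /andP[_ /forallPn[i pi]]]; last first.
  by rewrite /profile_prob (bigD1 i) //= /uniform_prob (negPf pi) !mul0r.
rewrite big_mkcondl /=; apply: ler_sum => p valid.
have -> : profile_prob R p = tot^-1.
  rewrite /profile_prob /uniform_prob (eq_bigr (fun=> (n.-1)`!%:R^-1)) => [|i _].
    by rewrite prodr_const card_ord exprVn.
  by rewrite card_rankings (forallP valid) mul1r.
case: ifP => [p1|_]; last first.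
  apply: mulr_ge0; last by rewrite invr_ge0 ltW.
  by apply: sumr_ge0 => M _; rewrite invr_ge0.
rewrite -[leLHS]mul1r ler_wpM2r ?invr_ge0 ?(ltW tot0) //.
rewrite sumr_const.
set c := #|_|; suff -> : c = nb_stable_matchings p.
  by rewrite -(mulr_natl (_^-1)) divff // pnatr_eq0 -lt0n.
by apply: eq_card => M; rewrite !inE unfold_in /= !inE valid.
Qed.

Lemma Prob_stable_error L d D q m :
  ~~ odd n -> (1 < L)%N -> (0 < d)%N -> (0 < q)%N -> (0 < m <= D)%N ->
  3 <= sqrtn R n ->
  Prob R (fun p : profile n => (1 <= nb_stable_matchings p)%N) <=
  2 * expR 387 *
  (2 * (n%:R * (2 ^+ d * (3 * expR (- (sqrtn R n / 6))))
        + 3 * n%:R ^+ 2 * (edge_const R m / ((D.+1 - m) ^ m)%:R))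
   + regular_error R n L d D q + expR (4^-1 - harmonic_tail R L / 2)).
Proof.
move=> en L1 d0 q0 /andP[m0 mD] n3.
have n0 : (0 < n)%N.
  rewrite lt0n; apply/eqP => n0; move: n3; rewrite /sqrtn n0 sqrtr0; lra.
have tot0 : 0 < tot by rewrite exprn_gt0 // ltr0n fact_gt0.
apply: le_trans Prob_stable_le _; rewrite ler_pdivrMr //.
set e := 2 * _ + _ + _.
have e0 : 0 <= regular_error R n L d D q.
  by rewrite /regular_error !addr_ge0 // mulr_ge0 ?invr_ge0.
have K0 := kappa_ge0 R n0.
have step (M : {ffun 'I_n -> 'I_n}) : M \in [set M | matching M] ->
    \sum_(p in Omega M) (nb_stable_matchings p)%:R^-1 <= kappa R n * e.
  rewrite inE => matM; apply: le_trans (sum_inv_stable R D matM n0 L1 d0 q0) _.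
  have c1 := card_irregular (R := R) d matM n0 m0 mD n3.
  have c2 := card_Omega_le R matM n0.
  have c3 : #|Reg M d D|%:R <= kappa R n.
    by apply: le_trans c2; rewrite ler_nat subset_leq_card //; apply/subsetP => p /Reg_Omega.
  have c4 := ler_wpM2r e0 c3.
  have c5 := ler_wpM2l (expR_ge0 (4^-1 - harmonic_tail R L / 2)) c2.
  rewrite /e; move: c1 c4 c5; set i := #|_ :\: _|%:R; set r := #|_|%:R * _.
  by set w := _ + 3 * _ * _; set E := expR _; lra.
apply: le_trans (ler_sum _ step) _; rewrite sumr_const -(mulr_natl (_ * _)) mulrA.
have skl := sum_kappa_le R n0 en.
have ee0 : 0 <= e.
  have E0 : 0 <= edge_const R m by rewrite !mulr_ge0 ?expR_ge0 ?exprn_ge0 ?mulr_ge0 ?expR_ge0.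
  have x0 : 0 <= expR (4^-1 - harmonic_tail R L / 2) by exact: expR_ge0.
  have y0 : 0 <= expR (- (sqrtn R n / 6)) by exact: expR_ge0.
  rewrite /e; apply: addr_ge0 => //; apply: addr_ge0 => //; apply: mulr_ge0 => //.
  apply: addr_ge0; first by rewrite mulr_ge0 // mulr_ge0 ?exprn_ge0 // mulr_ge0.
  by rewrite mulr_ge0 // ?divr_ge0 // mulr_ge0 ?exprn_ge0.
apply: le_trans (ler_wpM2r ee0 skl) _.
by rewrite [leRHS]mulrC -!mulrA.
Qed.
End StableProbability.

Section Asymptotics.
Variable R : realType.
Local Open Scope ring_scope.
Implicit Types (a b c C x : R) (y n k j : nat).

Lemma div_power_le a c x k j : 1 <= x -> 0 <= c -> a <= c * x ^+ k ->
  (k + 13 <= j)%N -> a / x ^+ j <= c / x ^+ 13.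
Proof.
move=> x1 c0 ac kj; have x0 : 0 < x by exact: lt_le_trans x1.
rewrite ler_pdivrMr ?exprn_gt0 //; apply: le_trans ac _.
rewrite -mulrA ler_wpM2l // mulrC ler_pdivlMr ?exprn_gt0 // -exprD.
by rewrite ler_weXn2l.
Qed.

Lemma regular_error_le C y n : (0 < y)%N -> 0 <= C -> n%:R <= C * y%:R ^+ 200 ->
  regular_error R n (y ^ 26) (y ^ 99) y (y ^ 42) <= (17 + 10 * C) / y%:R ^+ 13.
Proof.
move=> y0 C0 nC; set x : R := y%:R; have x1 : 1 <= x by rewrite ler1n.
have xp k : 1 <= x ^+ k by rewrite exprn_ege1.
have L1 : (y ^ 26).+1%:R <= 2 * x ^+ 26 :> R.
  by rewrite -natr1 natrX; have := xp 26%N; rewrite /x; lra.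
have xle k j : (k <= j)%N -> x ^+ k <= x ^+ j by move=> kj; rewrite ler_weXn2l.
have t1 : ((y ^ 26 + y ^ 26).+1 ^ 2 + 2 * y + 5)%:R / (y ^ 99)%:R <= 16 / x ^+ 13.
  rewrite (natrX R y 99); apply: (div_power_le (k := 52)) => //.
  have -> : ((y ^ 26 + y ^ 26).+1 ^ 2 + 2 * y + 5)%:R =
      (x ^+ 26 + x ^+ 26 + 1) ^+ 2 + 2 * x + 5 :> R.
    by rewrite natrD natrD natrM (natrX R _.+1 2) -natr1 natrD (natrX R y 26).
  have : (x ^+ 26 + x ^+ 26 + 1) ^+ 2 <= (3 * x ^+ 26) ^+ 2.
    have := xp 26%N => ?; rewrite ler_sqr ?nnegrE; lra.
  rewrite exprMn -exprM => s1; have := xp 52%N; have := xle 1%N 52%N isT; rewrite expr1.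
  by move: s1; set u := _ ^+ 2; rewrite (_ : 26 * 2 = 52)%N //; set v := x ^+ 52; lra.
have nn : 0 <= n%:R :> R by [].
have t2 : (n * (y ^ 26).+1 ^ 2 * (y * y ^ 99 + y ^ 2))%:R / ((y ^ 99) ^ 4)%:R
    <= 8 * C / x ^+ 13.
  rewrite -expnM (natrX R y (99 * 4)); apply: (div_power_le (k := 352)) => //.
    by rewrite mulr_ge0.
  have -> : 8 * C * x ^+ 352 = C * x ^+ 200 * ((2 * x ^+ 26) ^+ 2) * (2 * x ^+ 100).
    by rewrite exprMn -exprM (_ : 352 = 200 + 26 * 2 + 100)%N // !exprD; ring.
  rewrite natrM; apply: ler_pM; rewrite ?ler0n //.
    rewrite natrM; apply: ler_pM; rewrite ?ler0n //.
    by rewrite natrX; apply: lerXn2r; rewrite ?nnegrE // mulr_ge0 // exprn_ge0 // (le_trans _ x1).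
  by rewrite natrD -expnS !natrX -/x; have := xle 2%N 100%N isT; lra.
have t3 : (n * (y ^ 26).+1 * y)%:R / ((y ^ 99) ^ 2 * y ^ 42)%:R <= 2 * C / x ^+ 13.
  rewrite -expnM -expnD (natrX R y (99 * 2 + 42)); apply: (div_power_le (k := 227)) => //.
    by rewrite mulr_ge0.
  have -> : 2 * C * x ^+ 227 = C * x ^+ 200 * (2 * x ^+ 26) * x.
    by rewrite (_ : 227 = 200 + 26 + 1)%N // !exprD; ring.
  rewrite natrM; apply: ler_pM; rewrite ?ler0n //.
  by rewrite natrM; apply: ler_pM; rewrite ?ler0n.
have t4 : ((y ^ 42) ^ 2)%:R / (y ^ 99)%:R <= 1 / x ^+ 13.
  rewrite -expnM !natrX; apply: (div_power_le (k := 84)) => //.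
  by rewrite mul1r.
rewrite /regular_error.
have -> : (17 + 10 * C) / x ^+ 13 = 16 / x ^+ 13 + 8 * C / x ^+ 13 + 2 * C / x ^+ 13 + 1 / x ^+ 13.
  by move: (x ^+ 13)^-1 => u; ring.
by do ?apply: lerD.
Qed.

(** With [z = y ^ 99] and [y >= 12] one has [sqrt n / 6 >= 2 z], which beats [2 ^ z] and leaves
    [exp (- z) <= 27 / z ^ 3]. *)
Lemma few_suitors_error_le C y n : (12 <= y)%N -> 0 <= C ->
  n%:R <= C * y%:R ^+ 200 -> y%:R ^+ 100 <= sqrtn R n ->
  n%:R * (2 ^+ (y ^ 99) * (3 * expR (- (sqrtn R n / 6)))) <= 81 * C / y%:R ^+ 13.
Proof.
move=> y12 C0 nC sn; set x : R := y%:R; have x12 : 12 <= x by rewrite ler_nat.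
have x1 : 1 <= x by lra.
set z := x ^+ 99; have z1 : 1 <= z by rewrite exprn_ege1.
have z30 : 0 < z ^+ 3 by apply: exprn_gt0; apply: lt_le_trans z1.
have two : 2 ^+ (y ^ 99) <= expR z.
  have -> : z = (y ^ 99)%:R by rewrite natrX.
  rewrite -[(y ^ 99)%:R]mul1r expRM_natr; apply: lerXn2r; rewrite ?nnegrE ?expR_ge0 //.
  by have := expR_ge1Dx (1 : R); lra.
have ez : expR z * expR (- (sqrtn R n / 6)) <= expR (- z).
  rewrite -expRD ler_expR.
  have : 12 * z <= sqrtn R n.
    by apply: le_trans sn; rewrite exprS -/x -/z ler_wpM2r // ltW // (lt_le_trans _ z1).
  lra.
have cube : z ^+ 3 <= 27 * expR z.
  have -> : expR z = expR (z / 3) ^+ 3.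
    by rewrite -expRM_natr mulfVK // pnatr_eq0.
  have -> : 27 = 3 ^+ 3 :> R by rewrite -natrX.
  rewrite -exprMn; apply: lerXn2r; first by rewrite nnegrE (le_trans _ z1).
    by rewrite nnegrE mulr_ge0 ?expR_ge0.
  have := expR_ge1Dx (z / 3); lra.
have ezb : expR (- z) <= 27 / x ^+ 297.
  have -> : x ^+ 297 = z ^+ 3 by rewrite -exprM.
  rewrite expRN ler_pdivlMr //.
  by rewrite mulrC ler_pdivrMr ?expR_gt0.
have le1 : 2 ^+ (y ^ 99) * (3 * expR (- (sqrtn R n / 6))) <= 81 / x ^+ 297.
  rewrite mulrCA (_ : 81 / x ^+ 297 = 3 * (27 / x ^+ 297)); last first.
    by move: (x ^+ 297)^-1 => u; ring.
  rewrite ler_wpM2l //; apply: le_trans ezb; apply: le_trans ez.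
  by rewrite ler_wpM2r ?expR_ge0.
have p0 : 0 <= 2 ^+ (y ^ 99) * (3 * expR (- (sqrtn R n / 6))).
  by rewrite mulr_ge0 ?exprn_ge0 // mulr_ge0 ?expR_ge0.
apply: le_trans (ler_pM (ler0n _ n) p0 nC le1) _; rewrite mulrA.
apply: (div_power_le (k := 200)) => //; first by rewrite mulr_ge0.
by rewrite -/x le_eqVlt; apply/orP; left; apply/eqP; ring.
Qed.

(** Here [413 = 400 + 13]: the factor [n ^ 2] is of degree 400 in [y]. *)
Lemma edge_error_le C E m y n : (2 * m <= y)%N -> (413 <= m)%N -> (0 < y)%N ->
  0 <= C -> 0 <= E -> n%:R <= C * y%:R ^+ 200 ->
  3 * n%:R ^+ 2 * (E / ((y.+1 - m) ^ m)%:R) <= 3 * C ^+ 2 * E * 2 ^+ m / y%:R ^+ 13.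
Proof.
move=> my m413 y0 C0 E0 nC; set x : R := y%:R; have x1 : 1 <= x by rewrite ler1n.
have x0 : 0 < x by exact: lt_le_trans x1.
have half : (x / 2) ^+ m <= ((y.+1 - m) ^ m)%:R.
  rewrite natrX; apply: lerXn2r; rewrite ?nnegrE ?divr_ge0 //.
  by rewrite ler_pdivrMr // -natrM ler_nat; lia.
have h0 : 0 < (x / 2) ^+ m by rewrite exprn_gt0 // divr_gt0.
have inv : ((y.+1 - m) ^ m)%:R^-1 <= 2 ^+ m / x ^+ m :> R.
  rewrite -expr_div_n -[2 / x]invf_div exprVn lef_pV2 ?posrE //.
  exact: lt_le_trans half.
have n2 : n%:R ^+ 2 <= (C * x ^+ 200) ^+ 2.
  by apply: lerXn2r; rewrite ?nnegrE // mulr_ge0 // exprn_ge0 // ltW.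
apply: (@le_trans _ _ (3 * C ^+ 2 * E * 2 ^+ m * x ^+ 400 / x ^+ m)).
  have -> : 3 * C ^+ 2 * E * 2 ^+ m * x ^+ 400 / x ^+ m =
      3 * (C * x ^+ 200) ^+ 2 * (E * (2 ^+ m / x ^+ m)).
    by rewrite exprMn -exprM; move: (x ^+ m)^-1 (2 ^+ m) => u v; rewrite (_ : 200 * 2 = 400)%N //; ring.
  apply: ler_pM; rewrite ?mulr_ge0 ?exprn_ge0 ?invr_ge0 //.
    by rewrite ler_wpM2l.
  by rewrite ler_wpM2l.
apply: (div_power_le (k := 400)) => //.
by rewrite !mulr_ge0 ?exprn_ge0.
Qed.

(** By [harmonic_expR], [exp (- H / 2)] is of order [L ^ (-1/2)], and [L = y ^ 26]. *)
Lemma cycle_error_le y : (0 < y)%N ->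
  expR (4^-1 - harmonic_tail R (y ^ 26) / 2) <= 2 * expR 1 / y%:R ^+ 13.
Proof.
move=> y0; set x : R := y%:R; have x0 : 0 < x by rewrite ltr0n.
have L0 : (0 < y ^ 26)%N by rewrite expn_gt0 y0.
have he := harmonic_expR R L0; set H := harmonic_tail _ _ in he *.
have e1 : 1 <= expR 1 :> R by have := expR_ge1Dx (1 : R); lra.
rewrite -ler_sqr ?nnegrE ?expR_ge0 //; last first.
  by rewrite !mulr_ge0 ?invr_ge0 ?exprn_ge0 ?expR_ge0 // ltW.
have -> : (2 * expR 1 / x ^+ 13) ^+ 2 = 4 * expR 1 ^+ 2 / x ^+ 26.
  rewrite !exprMn exprVn -exprM (_ : 13 * 2 = 26)%N //; congr (_ * _ / _).
  by rewrite -natrX.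
rewrite ler_pdivlMr ?exprn_gt0 // -(expRM_natr 2 (4^-1 - _)).
have -> : (4^-1 - H / 2) * 2 = 2^-1 - H by field.
have xe : x ^+ 26 <= 2 * expR H.
  have : x ^+ 26 <= (y ^ 26).+1%:R by rewrite -natrX ler_nat.
  by move: he; rewrite ler_pdivrMr // mulrC => he /le_trans; apply.
apply: le_trans (ler_wpM2l (expR_ge0 _) xe) _.
rewrite mulrCA -expRD subrK.
have : expR 2^-1 <= expR 1 :> R by rewrite ler_expR; lra.
by move: (expR 2^-1) (expR 1) e1 => u v; nra.
Qed.

(** [200 / 17 <= 12]. *)
Lemma root_lower_bound y n : (0 < y)%N -> (0 < n)%N ->
  n%:R <= (2 * y%:R) ^+ 200 :> R ->
  (2 ^+ 12 * y%:R ^+ 12)^-1 <= n%:R `^ (- (1 / 17%:R)) :> R.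
Proof.
move=> y0 n0 ny; have y1 : 1 <= y%:R :> R by rewrite ler1n.
have npos : 0 < n%:R :> R by rewrite ltr0n.
have y0R : 0 < y%:R :> R by rewrite ltr0n.
rewrite powRN lef_pV2 ?posrE ?powR_gt0 ?mulr_gt0 ?exprn_gt0 //.
have z1 : 1 <= 2 * y%:R :> R by lra.
rewrite -exprMn -powR_mulrn; last by rewrite (le_trans _ z1).
have e0 : 0 <= 1 / 17%:R :> R by rewrite divr_ge0.
apply: le_trans (ge0_ler_powR e0 _ _ ny) _; rewrite ?nnegrE ?exprn_ge0 // ?(le_trans _ z1) //.
rewrite -powR_mulrn ?(le_trans _ z1) // -powRrM ler_powR //.
by rewrite mulrA mulr1 ler_pdivrMr // -natrM ler_nat.
Qed.

End Asymptotics.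

Local Open Scope ring_scope.

Lemma power_floor (n k : nat) : (0 < n)%N -> (0 < k)%N ->
  exists2 y : nat, (y ^ k <= n)%N & (n < y.+1 ^ k)%N.
Proof.
move=> n0 k0.
have ex : exists y, (y ^ k <= n)%N by exists 0%N; rewrite exp0n.
have ub y : (y ^ k <= n)%N -> (y <= n)%N.
  by case: y => // y; apply: leq_trans; rewrite -[leqLHS]expn1 leq_pexp2l.
case: (ex_maxnP ex ub) => y yn ymax; exists y => //.
by rewrite ltnNge; apply/negP => /ymax; rewrite ltnn.
Qed.

Theorem theorem1p1 (R : realType) :
  exists N : nat, forall n : nat, (N <= n)%N -> ~~ odd n ->
    Prob R (fun p : profile n => (1 <= nb_stable_matchings p)%N)
      <= n%:R `^ (- (1 / 17%:R)).
Proof.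
have combine (a1 a2 a3 a4 c1 c2 c3 c4 u : R) :
    a1 <= c1 * u -> a2 <= c2 * u -> a3 <= c3 * u -> a4 <= c4 * u ->
    2 * (a1 + a2) + a3 + a4 <= (2 * (c1 + c2) + c3 + c4) * u by move=> *; lra.
pose C : R := 2 ^+ 200; have C0 : 0 <= C by rewrite exprn_ge0.
(* [m = 413], made opaque so that the powers [_ ^ m] are never unfolded. *)
have [m m413] : exists m, (413 <= m)%N by exists 413%N.
have E0 : 0 <= edge_const R m by rewrite !mulr_ge0 ?expR_ge0 ?exprn_ge0 ?mulr_ge0 ?expR_ge0.
pose K : R := 2 * expR 387 * (2 * (81 * C + 3 * C ^+ 2 * edge_const R m * 2 ^+ m)
  + (17 + 10 * C) + 2 * expR 1).
(* For [y = n ^ (1 / 200)] take cycles of length at most [y ^ 26], at least [y ^ 99]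
   suitors each, overlaps at most [y] and at most [y ^ 42] people on short cycles:
   every error is then [O (y ^ -13)], while [n ^ (- 1 / 17) > (2 y) ^ -12]. *)
pose y0 := maxn (2 * m) (Num.Def.truncn (2 ^+ 12 * K)).+1.
exists (y0 ^ 200)%N => n Nn en.
have y0m : (2 * m <= y0)%N by rewrite leq_maxl.
have y0K : 2 ^+ 12 * K <= y0%:R.
  apply: le_trans (ltW (truncnS_gt _)) _; by rewrite ler_nat leq_maxr.
have y00 : (0 < y0)%N by apply: leq_trans y0m; rewrite muln_gt0 (leq_trans _ m413).
have n0 : (0 < n)%N by apply: leq_trans Nn; rewrite expn_gt0 y00.
have [y yn ny] := power_floor n0 (isT : (0 < 200)%N).
have y0y : (y0 <= y)%N.
  by rewrite -ltnS -(@ltn_exp2r _ _ 200) //; apply: leq_ltn_trans ny.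
have ypos : (0 < y)%N by exact: leq_trans y0y.
have ym := leq_trans y0m y0y.
have n2 : n%:R <= (2 * y%:R) ^+ 200 :> R.
  rewrite -natrM -natrX ler_nat; apply: leq_trans (ltnW ny) _.
  by rewrite leq_exp2r // mul2n -addnn -addn1 leq_add2l.
have nC : n%:R <= C * y%:R ^+ 200 by rewrite -exprMn.
have sn : y%:R ^+ 100 <= sqrtn R n.
  rewrite /sqrtn -[leLHS]ger0_norm ?exprn_ge0 // -sqrtr_sqr ler_sqrt //.
  by rewrite -exprM -natrX ler_nat.
have my : (m <= y)%N by apply: leq_trans ym; rewrite leq_pmull.
have y413 := leq_trans m413 my.
have y3 : (3 <= y)%N by apply: leq_trans y413.
have sn3 : 3 <= sqrtn R n.
  apply: le_trans sn; rewrite -natrX ler_nat.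
  by apply: leq_trans y3 _; rewrite -[leqLHS]expn1 leq_pexp2l.
have x0 : 0 < y%:R :> R by rewrite ltr0n.
apply: le_trans (root_lower_bound ypos n0 n2).
have L1 : (1 < y ^ 26)%N.
  by apply: (@leq_trans y); [exact: leq_trans y3 | rewrite -[leqLHS]expn1 leq_pexp2l].
have d0 : (0 < y ^ 99)%N by rewrite expn_gt0 ypos.
have q0 : (0 < y ^ 42)%N by rewrite expn_gt0 ypos.
have mD : (0 < m <= y)%N by rewrite my andbT; apply: leq_trans m413.
have y12 : (12 <= y)%N by apply: leq_trans y413.
apply: le_trans (Prob_stable_error en L1 d0 q0 mD sn3) _.
have e1 := few_suitors_error_le y12 C0 nC sn.
have e2 := edge_error_le ym m413 ypos C0 E0 nC.
have e3 := regular_error_le ypos C0 nC.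
have e4 := cycle_error_le R ypos.
have K387 : 0 <= 2 * expR 387 :> R by rewrite mulr_ge0 ?expR_ge0.
apply: (@le_trans _ _ (K / y%:R ^+ 13)).
  rewrite /K -[leRHS]mulrA; apply: ler_wpM2l => //.
  exact: combine e1 e2 e3 e4.
(* The thirteenth factor [y] absorbs the constant [2 ^ 12 * K], by the choice of [y0]. *)
have y12R : y%:R ^+ 12 != 0 :> R by rewrite expf_neq0 // gt_eqF.
rewrite ler_pdivrMr ?exprn_gt0 // (exprS y%:R 12) invfM -mulrA (mulrCA _^-1 y%:R) mulVf // mulr1.
by rewrite mulrC ler_pdivlMr ?exprn_gt0 // mulrC (le_trans y0K) // ler_nat.
Qed.
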